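(* Fix $r\in(0,\infty)$, and for each $n=(n_1,n_2)$ let $z=z(n)=(z_1,z_2)$ be given by $z_j=e^{-\alpha_j}$, $\alpha_j=\delta_jn_j^{-1/3}$ ($j=1,2$), where $\delta_1=\kappa r^{1/3}(n_2/n_1)^{1/3}$, $\delta_2=\kappa r^{1/3}(n_1/n_2)^{1/3}$ and $\kappa=(\zeta(3)/\zeta(2))^{1/3}$ (so that $E_z^r(\xi)=n(1+o(1))$). Then $$E_z^r(\xi)=n+o(|n|^{2/3}),\qquad n\to\infty .$$
   Context: $\mathbb Z_+=\{0,1,2,\dots\}$; $\mathcal X=\{x=(x_1,x_2)\in\mathbb Z_+^2:\gcd(x_1,x_2)=1\}$ (containing $(1,0)$ and $(0,1)$ but not $(0,0)$). For $z=(z_1,z_2)\in(0,1)^2$ and $x\in\mathbb Z_+^2$ write $z^x=z_1^{x_1}z_2^{x_2}$ and $z^{kx}=(z^x)^k$. For $r\in(0,\infty)$, $Q_z^r$ is the probability measure on $(\mathbb Z_+)^{\mathcal X}$ under which the coordinates $\nu(x)$, $x\in\mathcal X$, are mutually independent with $$Q_z^r\{\nu(x)=k\}=\binom{r+k-1}{k}z^{kx}(1-z^x)^r,\qquad k\in\mathbb Z_+,\qquad \binom{r+k-1}{k}=\frac{r(r+1)\cdots(r+k-1)}{k!}.$$ $E_z^r$ is expectation under $Q_z^r$. Almost surely only finitely many $\nu(x)$ are nonzero, and $\xi=(\xi_1,\xi_2)=\sum_{x\in\mathcal X}x\,\nu(x)$. $|\cdot|$ is the Euclidean norm and $\zeta$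 is the Riemann zeta function. The limit $n\to\infty$ means $n_1,n_2\to\infty$ with $n_1/n_2$ bounded away from $0$ and $\infty$. *)

(* Defs.v *)
From HB Require Import structures.
From mathcomp Require Import all_boot all_order all_algebra.
From mathcomp Require Import all_classical all_reals all_analysis.
Set Implicit Arguments.
Unset Strict Implicit.
Unset Printing Implicit Defensive.
Import Order.TTheory GRing.Theory Num.Theory.
Import numFieldNormedType.Exports.
Local Open Scope classical_set_scope.
Local Open Scope ring_scope.

(* gcdn 0 0 = 0, so (0,0) is excluded. *)
Definition primitive_vec := {x : nat * nat | coprime x.1 x.2}.

(* (Z_+)^X with the product sigma-algebra, generated by the one-coordinate
   cylinders; nat carries its discrete sigma-algebra. *)
Definition cylinders : set (set (primitive_vec -> nat)) :=
  [set A | exists x k, A = [set nu | nu x = k]].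

Notation config := (g_sigma_algebraType cylinders).

Definition mutually_independent_coords (R : realType)
    (Q : probability config R) : Prop :=
  forall (s : seq primitive_vec) (A : primitive_vec -> set nat), uniq s ->
    Q [set nu : config | forall x, x \in s -> A x (nu x)] =
    (\prod_(x <- s) Q [set nu : config | A x (nu x)])%E.

(* r (r+1) ... (r+k-1) / k! *)
Definition binom_shift (R : realType) (r : R) (k : nat) : R :=
  (\prod_(i < k) (r + i%:R)) / k`!%:R.

Definition vec_pow (R : realType) (z : R * R) (x : nat * nat) : R :=
  z.1 ^+ x.1 * z.2 ^+ x.2.

(* "Q is the measure Q_z^r"; these conditions determine Q uniquely, since they
   prescribe it on the pi-system of finite-dimensional cylinders. *)
Definition is_Qzr (R : realType) (r : R) (z : R * R)
    (Q : probability config R) : Prop :=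
  mutually_independent_coords Q /\
  forall (x : primitive_vec) (k : nat),
    Q [set nu : config | nu x = k] =
    (binom_shift r k * vec_pow z (val x) ^+ k
       * (1 - vec_pow z (val x)) `^ r)%:E.

(* A finitely supported sum in nat * nat; by the convention for such sums it is
   (0,0) on the null event that infinitely many nu x are nonzero. *)
Definition xi (nu : config) : nat * nat :=
  \sum_(x \in [set: primitive_vec]) val x *+ nu x.

(* fine sends an infinite expectation to 0; an estimate E_xi = n + o(|n|^(2/3))
   then fails, so such an estimate still entails finiteness for large n. *)
Definition E_xi (R : realType) (Q : probability config R) : R * R :=
  (fine ('E_Q[fun nu => (xi nu).1%:R])%E, fine ('E_Q[fun nu => (xi nu).2%:R])%E).

(* The Riemann zeta function at real s > 1. *)
Definition zeta (R : realType) (s : R) : R :=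
  limn (series (fun k : nat => k.+1%:R `^ (- s))).

Definition kappa (R : realType) : R := (zeta 3 / zeta 2) `^ 3^-1.

Definition delta1 (R : realType) (r : R) (n : nat * nat) : R :=
  kappa R * r `^ 3^-1 * (n.2%:R / n.1%:R) `^ 3^-1.

Definition delta2 (R : realType) (r : R) (n : nat * nat) : R :=
  kappa R * r `^ 3^-1 * (n.1%:R / n.2%:R) `^ 3^-1.

Definition alpha1 (R : realType) (r : R) (n : nat * nat) : R :=
  delta1 r n * n.1%:R `^ (- 3^-1).

Definition alpha2 (R : realType) (r : R) (n : nat * nat) : R :=
  delta2 r n * n.2%:R `^ (- 3^-1).

Definition z_of (R : realType) (r : R) (n : nat * nat) : R * R :=
  (expR (- alpha1 r n), expR (- alpha2 r n)).

Definition vec_R (R : realType) (n : nat * nat) : R * R := (n.1%:R, n.2%:R).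

(* The norm `|_| of the library on R * R is the sup norm, not the Euclidean one. *)
Definition eucl_norm (R : realType) (v : R * R) : R :=
  Num.sqrt (v.1 ^+ 2 + v.2 ^+ 2).

(* n1, n2 -> oo with c <= n1/n2 <= C. *)
Definition n_to_oo (R : realType) (c C : R) : set_system (nat * nat) :=
  within [set n | c <= n.1%:R / n.2%:R <= C] (filter_prod \oo \oo).

(* Needed for n_to_oo to be usable in Landau notations. *)
Global Instance n_to_oo_filter (R : realType) (c C : R) : Filter (n_to_oo c C).
Proof. exact: within_filter. Qed.

Canonical n_to_oo_filter_on (R : realType) (c C : R) : filter_on (nat * nat) :=
  FilterType (n_to_oo c C) (n_to_oo_filter c C).

(* Main.v *)
Require Import Defs.
From HB Require Import structures.
From mathcomp Require Import all_boot all_order all_algebra.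
From mathcomp Require Import all_classical all_reals all_analysis.
From mathcomp Require Import measurable_realfun.
From mathcomp Require Import zify ring lra.
Set Implicit Arguments.
Unset Strict Implicit.
Unset Printing Implicit Defensive.
Import Order.TTheory GRing.Theory Num.Theory.
Import numFieldNormedType.Exports.
Local Open Scope classical_set_scope.
Local Open Scope ring_scope.

(** Put [w] for [vec_pow z x]. The mean [m] of one coordinate solves
    [m = w * (r + m)] ([coord_mean]), so the first component of the expectation
    of [xi] is [r] times the sum of [x.1 * w / (1 - w)] over the primitive
    vectors [x] ([expectation_xi], [E_xi_eq]). Write [w / (1 - w)] as the sum of
    the powers [w ^ m] and [1 / m] as the sum of [inv_coef d] over the divisors
    [d] of [m]; here [inv_coef] is the sequence of coefficients of the Dirichlet
    series [zeta (s + 1) / zeta s]. For a fixed [d] the sum runs over all the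
    multiples of [d] of all the primitive vectors, that is over the lattice
    vectors divisible by [d], and it factors into two geometric sums: up to [r],
    the component is the series of
    [inv_coef d * d * pker (d * a) * qker (d * b)], where [a] and [b] are the two
    exponents [alpha] ([primitive_sum], [dirichlet_inv]).

    As [d * a] and [d * b] tend to [0] the leading term is [1 / (d ^ 2 * a ^ 2 * b)];
    it sums to [zeta 3 / zeta 2 / (a ^ 2 * b)], and the choice of the exponents
    makes [r] times this the component of [n] itself. It remains to bound the
    rest by [o (1 / (a * b))]. By [lattice_kernel_split] the rest consists of an explicit geometric
    series ([inv_coef_pker]) and of sums of [inv_coef] against nonincreasing
    functions of [d] of mass [O (1 / a)]. The latter are small by Abel summation
    ([abel_inv_coef]), because the summatory function of [inv_coef] is [o (x)]
    ([sum_inv_coef_little_o]); this gives [lattice_sum_estimate].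

    The last fact comes from [M x = o (x)] for the Mertens function [M], the sum
    of the Moebius function, which has the depth of the prime number theorem. It
    is proved in Selberg's elementary way. Selberg's formula ([selberg_formula])
    bounds [ln x ^ 2 * |M x|] by twice the sum of [ln n * |M (x / n)|], up to
    [O (x * ln x)] ([mertens_selberg]); this alone reproduces any bound
    [|M x| <= g * x]. But the steps of [M] are at most 1 and the sum of
    [M t / t ^ 2] is bounded, so every long enough window contains a [t] at which
    [M t] is small ([mertens_window]); around it the bound is not attained, and
    the gain over all windows lowers [g] by a fixed amount ([tauberian_step]),
    repeatedly, down to any positive value. *)

(** * Dirichlet convolution *)

Definition psum (R : realType) (f : nat -> R) (N : nat) : R :=
  \sum_(1 <= n < N.+1) f n.

Definition conv (R : realType) (f g : nat -> R) (n : nat) : R :=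
  \sum_(d <- divisors n) f d * g (n %/ d)%N.

Section Convolution.
Context {R : realType}.
Implicit Types (f g h : nat -> R) (x : R) (n N : nat).

Lemma psum0 f : psum f 0 = 0.
Proof. by rewrite /psum big_geq. Qed.

Lemma psumS f N : psum f N.+1 = psum f N + f N.+1.
Proof. by rewrite /psum big_nat_recr. Qed.

Lemma eq_psum f g N : (forall n, (0 < n <= N)%N -> f n = g n) ->
  psum f N = psum g N.
Proof. by move=> fg; apply: eq_big_nat => n; rewrite ltnS => /fg. Qed.

Lemma ler_psum f g N : (forall n, (0 < n <= N)%N -> f n <= g n) ->
  psum f N <= psum g N.
Proof.
by move=> fg; rewrite /psum !big_nat; apply: ler_sum => n; rewrite ltnS => /fg.
Qed.

Lemma ler_norm_psum f N : `|psum f N| <= psum (fun n => `|f n|) N.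
Proof. exact: ler_norm_sum. Qed.

Lemma psumD f g N : psum (fun n => f n + g n) N = psum f N + psum g N.
Proof. exact: big_split. Qed.

Lemma psumB f g N : psum (fun n => f n - g n) N = psum f N - psum g N.
Proof. by rewrite /psum sumrB. Qed.

Lemma psumZ x f N : psum (fun n => x * f n) N = x * psum f N.
Proof. by rewrite /psum mulr_sumr. Qed.

Lemma psumZr x f N : psum (fun n => f n * x) N = psum f N * x.
Proof. by rewrite /psum mulr_suml. Qed.

Lemma psum_cst x N : psum (fun=> x) N = N%:R * x.
Proof. by rewrite /psum big_const_nat subn1 iter_addr addr0 mulr_natl. Qed.

Lemma psum_le f M N : (forall n, (0 < n)%N -> 0 <= f n) -> (M <= N)%N ->
  psum f M <= psum f N.
Proof.
move=> f0 MN; rewrite /psum (@big_cat_nat _ _ _ M.+1 1 N.+1)//=.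
rewrite lerDl big_nat sumr_ge0// => n /andP[+ _].
by move=> /(leq_ltn_trans (leq0n M)) /f0.
Qed.

Lemma exchange_psum (F : nat -> nat -> R) M N :
  psum (fun m => psum (F m) N) M = psum (fun n => psum (F^~ n) M) N.
Proof. exact: exchange_big. Qed.

Lemma psum_pick (P : pred nat) f N M : (M <= N)%N ->
  (forall n, (0 < n <= N)%N -> P n = (n <= M)%N) ->
  psum (fun n => (P n)%:R * f n) N = psum f M.
Proof.
move=> MN PM; rewrite /psum (@big_cat_nat _ _ _ M.+1 1 N.+1)//=.
rewrite [X in _ + X]big_nat [X in _ + X]big1 ?addr0.
  apply: eq_big_nat => n /andP[n0 nM]; rewrite PM ?n0 ?(leq_trans _ MN)//.
  by rewrite -ltnS nM mul1r.
move=> n /andP[Mn nN]; rewrite PM; last first.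
  by rewrite (leq_trans _ Mn)//= -ltnS.
by rewrite leqNgt Mn mul0r.
Qed.

Lemma psum_eq1 f k N : (0 < k <= N)%N ->
  psum (fun n => (n == k)%:R * f n) N = f k.
Proof.
move=> kN; rewrite /psum (bigD1_seq k)/= ?iota_uniq//; last first.
  by rewrite mem_index_iota ltnS.
by rewrite eqxx mul1r big1 ?addr0// => n /negPf ->; rewrite mul0r.
Qed.

Lemma conv_widen f g n N : (0 < n <= N)%N ->
  conv f g n = psum (fun a => psum (fun b => ((a * b)%N == n)%:R * (f a * g b)) N) N.
Proof.
move=> /andP[n0 nN].
transitivity (\sum_(1 <= a < N.+1 | (a %| n)%N) f a * g (n %/ a)%N).
  rewrite /conv -[RHS]big_filter; apply: perm_big; apply: uniq_perm.
  - exact: divisors_uniq.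
  - by rewrite filter_uniq// iota_uniq.
  move=> d; rewrite mem_filter mem_index_iota ltnS -dvdn_divisors//.
  case: (boolP (d %| n)%N) => //= dn.
  by rewrite (dvdn_gt0 n0 dn)/= (leq_trans (dvdn_leq n0 dn) nN).
rewrite big_mkcond; apply: eq_big_nat => a /andP[a0 _].
case: ifPn => an; last first.
  rewrite /psum big1// => b _; case: eqP => [abn|]; last by rewrite mul0r.
  by move: an; rewrite -abn dvdn_mulr.
rewrite -(@psum_eq1 (fun b => f a * g b) (n %/ a) N).
  apply: eq_psum => b _; congr ((nat_of_bool _)%:R * _); apply/eqP/eqP => [->|<-].
    by rewrite mulnC divnK.
  by rewrite mulKn.
rewrite divn_gt0// (dvdn_leq n0 an)/= (leq_trans _ nN)//.
exact: leq_div.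
Qed.

(** Both sides run over the lattice points under the hyperbola [d * k <= N]. *)
Lemma psum_conv_weight (F : nat -> R) f g N :
  psum (fun n => F n * conv f g n) N =
  psum (fun d => f d * psum (fun k => F (d * k)%N * g k) (N %/ d)%N) N.
Proof.
under eq_psum => n nN do rewrite (conv_widen f g nN) -psumZ.
rewrite exchange_psum; apply: eq_psum => a /andP[a0 aN].
under eq_psum => n nN do rewrite -psumZ.
rewrite exchange_psum -psumZ.
rewrite -[RHS](@psum_pick (fun b => (a * b <= N)%N) _ N); last 2 first.
- exact: leq_div.
- by move=> b _; rewrite leq_divRL// mulnC.
apply: eq_psum => b /andP[b0 bN].
case: (leqP (a * b)%N N) => abN.
  rewrite mul1r.
  rewrite -[RHS](@psum_eq1 (fun n => f a * (F n * g b)) (a * b) N) ?muln_gt0 ?a0 ?b0//.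
  by apply: eq_psum => n _; rewrite eq_sym; ring.
rewrite mul0r /psum big_nat big1// => n /andP[_ nN].
by case: eqP => [abn|]; [move: nN abN; rewrite -abn; lia | rewrite mul0r mulr0].
Qed.

Lemma psum_conv f g N :
  psum (conv f g) N = psum (fun d => f d * psum g (N %/ d)%N) N.
Proof.
have := psum_conv_weight (fun=> 1) f g N.
under eq_psum do rewrite mul1r; move=> ->.
by apply: eq_psum => d _; congr (_ * _); apply: eq_psum => k _; rewrite mul1r.
Qed.

Lemma convC f g n : (0 < n)%N -> conv f g n = conv g f n.
Proof.
move=> n0; rewrite !(@conv_widen _ _ _ n) ?n0 ?leqnn// exchange_psum.
by apply: eq_psum => b _; apply: eq_psum => a _; rewrite mulnC [f a * _]mulrC.
Qed.

Lemma convA f g h n : (0 < n)%N ->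
  conv (conv f g) h n = conv f (conv g h) n.
Proof.
move=> n0; pose T (a b c : nat) := ((a * b * c)%N == n)%:R * (f a * g b * h c) : R.
have pick (a b c : nat) (x : R) : (0 < a)%N -> (0 < b)%N -> (0 < c)%N ->
    psum (fun d => ((d * c)%N == n)%:R * (((a * b)%N == d)%:R * x)) n =
    ((a * b * c)%N == n)%:R * x.
  move=> a0 b0 c0; case: (leqP (a * b) n) => abn.
    rewrite -[RHS](@psum_eq1 (fun d => ((d * c)%N == n)%:R * x) (a * b)%N n).
      by apply: eq_psum => d _; rewrite mulrCA [(a * b)%N == d]eq_sym.
    by rewrite muln_gt0 a0 b0.
  have -> : ((a * b * c)%N == n) = false by apply/eqP; nia.
  rewrite mul0r /psum big_nat big1// => d /andP[_ dn].
  by have -> : ((a * b)%N == d) = false; [apply/eqP; lia | rewrite mul0r mulr0].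
have n0n : (0 < n <= n)%N by rewrite n0 leqnn.
transitivity (psum (fun a => psum (fun b => psum (T a b) n) n) n).
  rewrite (conv_widen _ _ n0n).
  under eq_psum => d dn do under eq_psum => c cn do
    rewrite (conv_widen _ _ dn) -psumZr -psumZ.
  rewrite exchange_psum.
  transitivity (psum (fun c => psum (fun a => psum (fun b => T a b c) n) n) n);
    last first.
    rewrite exchange_psum; apply: eq_psum => a _; exact: exchange_psum.
  apply: eq_psum => c /andP[c0 _].
  rewrite exchange_psum; apply: eq_psum => a /andP[a0 _].
  under eq_psum => d dn do rewrite -psumZr -psumZ.
  rewrite exchange_psum; apply: eq_psum => b /andP[b0 _].
  rewrite /T -(pick a b c)//; apply: eq_psum => d _.
  by rewrite !mulrA.
rewrite (conv_widen _ _ n0n).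
apply: eq_psum => a /andP[a0 _].
under [RHS]eq_psum => d dn do rewrite (conv_widen _ _ dn) -!psumZ.
rewrite [RHS]exchange_psum; apply: eq_psum => b /andP[b0 _].
under [RHS]eq_psum => d dn do rewrite -!psumZ.
rewrite [RHS]exchange_psum; apply: eq_psum => c /andP[c0 _].
rewrite /T.
have -> : ((a * b * c)%N == n) = ((b * c * a)%N == n).
  by rewrite -mulnA mulnC.
rewrite -(pick b c a)//; apply: eq_psum => d _.
by rewrite [(a * d)%N]mulnC; ring.
Qed.

End Convolution.

(** * The Moebius and von Mangoldt functions *)

Definition moebius (R : realType) (n : nat) : R :=
  \prod_(p <- primes n) (if logn p n == 1%N then -1 else 0).

Definition lnn (R : realType) (n : nat) : R := ln n%:R.

Definition mangoldt (R : realType) : nat -> R := conv (moebius R) (lnn R).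

Section Moebius.
Context {R : realType}.
Implicit Types (f g h : nat -> R) (n N : nat).
Local Notation mu := (moebius R).
Local Notation L := (lnn R).
Local Notation Lam := (mangoldt R).

Lemma moebius1 : mu 1 = 1.
Proof. by rewrite /moebius big_nil. Qed.

Lemma ler_norm_moebius n : `|mu n| <= 1.
Proof.
rewrite /moebius normr_prod; apply: prodr_ile1 => p.
by case: ifP => _; rewrite ?normrN ?normr1 ?normr0 ?lexx ?ler01.
Qed.

Lemma moebius_square p n : (0 < n)%N -> prime p -> (p ^ 2 %| n)%N -> mu n = 0.
Proof.
move=> n0 pp p2n; have l2 : (2 <= logn p n)%N by rewrite -pfactor_dvdn.
have pn : p \in primes n by rewrite -logn_gt0 (leq_trans _ l2).
rewrite /moebius (bigD1_seq p)//= ?primes_uniq//.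
by case: eqP => [l1|_]; [rewrite l1 in l2 | rewrite mul0r].
Qed.

Lemma moebius_prime p n : (0 < n)%N -> prime p -> ~~ (p %| n)%N ->
  mu (p * n)%N = - mu n.
Proof.
move=> n0 pp pn; have p0 := prime_gt0 pp.
have pm : perm_eq (primes (p * n)%N) (p :: primes n).
  apply: uniq_perm; rewrite ?primes_uniq//=.
    by rewrite primes_uniq mem_primes (negPf pn) !andbF.
  by move=> q; rewrite primesM// primes_prime// !inE.
rewrite /moebius (perm_big _ pm)/= big_cons.
rewrite lognM// logn_prime// eqxx lognE pp n0 (negPf pn)/= mulN1r.
congr (- _); apply: eq_big_seq => q qn.
have qp : (q == p) = false.
  by apply/negbTE; apply: contraTneq qn => ->; rewrite mem_primes (negPf pn) !andbF.
by rewrite lognM// logn_prime// qp.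
Qed.

(** Among the divisors of [p ^ k * m] only those of [m] and their multiples
    by [p] are free of the square of [p]. *)
Lemma moebius_split p k m (F : nat -> R) :
  prime p -> ~~ (p %| m)%N -> (0 < m)%N -> (0 < k)%N ->
  \sum_(d <- divisors (p ^ k * m)) mu d * F d =
  \sum_(d <- divisors m) mu d * (F d - F (p * d)%N).
Proof.
move=> pp pm m0 k0; have p0 := prime_gt0 pp.
have n0 : (0 < p ^ k * m)%N by rewrite muln_gt0 expn_gt0 p0.
have -> : \sum_(d <- divisors m) mu d * (F d - F (p * d)%N) =
    \sum_(d <- divisors m ++ map (muln p) (divisors m)) mu d * F d.
  rewrite big_cat big_map/= -big_split; apply: eq_big_seq => d.
  rewrite -dvdn_divisors// => dm.
  rewrite moebius_prime ?(dvdn_gt0 m0 dm)//; first by rewrite mulNr mulrBr.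
  by apply: contra pm => pd; apply: dvdn_trans pd dm.
rewrite (bigID (fun d => p ^ 2 %| d)%N)/= big1_seq ?add0r; last first.
  move=> d /andP[p2d]; rewrite -dvdn_divisors// => dn.
  by rewrite (moebius_square _ pp p2d) ?mul0r// (dvdn_gt0 n0 dn).
rewrite -big_filter; apply: perm_big; apply: uniq_perm.
- by rewrite filter_uniq// divisors_uniq.
- rewrite cat_uniq divisors_uniq/= map_inj_uniq ?divisors_uniq ?andbT; last first.
    by move=> a b /eqP; rewrite eqn_pmul2l// => /eqP.
  apply/hasPn => _ /mapP[d _ ->]; apply/negP; rewrite /= -dvdn_divisors// => pdm.
  by move: pm; rewrite (dvdn_trans _ pdm)// dvdn_mulr.
move=> d; rewrite mem_filter mem_cat -!dvdn_divisors//.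
apply/andP/orP => [[p2d dn]|].
  have [/dvdnP[e de]|pd] := boolP (p %| d)%N; last first.
    left; move: dn; rewrite Gauss_dvdr// coprime_sym coprimeXl//.
    by rewrite prime_coprime.
  right; apply/mapP; exists e; last by rewrite de mulnC.
  rewrite -dvdn_divisors//.
  have pe : ~~ (p %| e)%N.
    by apply: contra p2d => pe; rewrite de -mulnn dvdn_mul.
  have : (e %| p ^ k * m)%N by rewrite (dvdn_trans _ dn)// de dvdn_mulr.
  by rewrite Gauss_dvdr// coprime_sym coprimeXl// prime_coprime.
case=> [dm|/mapP[e]].
  split; last by rewrite dvdn_mull.
  by apply: contra pm => p2d; apply: dvdn_trans dm; apply: dvdn_trans p2d; exact: dvdn_exp.
rewrite -dvdn_divisors// => em ->; split; last first.
  by apply: dvdn_mul => //; apply: dvdn_exp.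
rewrite -mulnn dvdn_pmul2l//; apply: contra pm => pe; exact: dvdn_trans pe em.
Qed.

Lemma prime_power_split n : (1 < n)%N -> exists p k m,
  [/\ prime p, ~~ (p %| m)%N, (0 < m)%N, (0 < k)%N & n = (p ^ k * m)%N].
Proof.
move=> n1; have n0 : (0 < n)%N by apply: ltnW.
have pp := pdiv_prime n1; have [m pm nm] := pfactor_coprime pp n0.
have k0 : (0 < logn (pdiv n) n)%N.
  by rewrite logn_gt0 mem_primes pp n0 pdiv_dvd.
exists (pdiv n), (logn (pdiv n) n), m; split=> //.
- by rewrite -prime_coprime.
- by case: m nm {pm} => // nm; rewrite nm mul0n in n0.
- by rewrite mulnC.
Qed.

Lemma sum_moebius n : (0 < n)%N ->
  \sum_(d <- divisors n) mu d = (n == 1%N)%:R.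
Proof.
move=> n0; have [->|n1] := eqVneq n 1%N; first by rewrite big_seq1 moebius1.
have [|p [k [m [pp pm m0 k0 ->]]]] := @prime_power_split n.
  by rewrite ltn_neqAle eq_sym n1.
under eq_bigr do rewrite -[mu _]mulr1.
by rewrite (moebius_split (fun=> 1) pp)// big1// => d _; rewrite subrr mulr0.
Qed.

Lemma eq_conv f1 f2 g1 g2 n : (0 < n)%N ->
  (forall k, (0 < k)%N -> f1 k = f2 k) ->
  (forall k, (0 < k)%N -> g1 k = g2 k) ->
  conv f1 g1 n = conv f2 g2 n.
Proof.
move=> n0 f12 g12; apply: eq_big_seq => d; rewrite -dvdn_divisors// => dn.
have d0 := dvdn_gt0 n0 dn.
by rewrite f12// g12// divn_gt0// dvdn_leq.
Qed.

Lemma conv_moebius1 n : (0 < n)%N -> conv mu (fun=> 1) n = (n == 1%N)%:R.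
Proof.
by move=> n0; rewrite -sum_moebius//; apply: eq_bigr => d _; rewrite mulr1.
Qed.

Lemma conv_deltal f n : (0 < n)%N ->
  conv (fun k => (k == 1%N)%:R) f n = f n.
Proof.
move=> n0; rewrite /conv (bigD1_seq 1%N)/= ?divisors_uniq//; last first.
  by rewrite -dvdn_divisors// dvd1n.
by rewrite mul1r divn1 big1 ?addr0// => d /negPf ->; rewrite mul0r.
Qed.

Lemma conv_deltar f n : (0 < n)%N ->
  conv f (fun k => (k == 1%N)%:R) n = f n.
Proof. by move=> n0; rewrite convC// conv_deltal. Qed.

Lemma convDr f g h n : conv f (fun k => g k + h k) n = conv f g n + conv f h n.
Proof. by rewrite /conv -big_split; apply: eq_bigr => d _; rewrite mulrDr. Qed.

Lemma convNr f g n : conv f (fun k => - g k) n = - conv f g n.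
Proof. by rewrite /conv -sumrN; apply: eq_bigr => d _; rewrite mulrN. Qed.

Lemma convNl f g n : conv (fun k => - f k) g n = - conv f g n.
Proof. by rewrite /conv -sumrN; apply: eq_bigr => d _; rewrite mulNr. Qed.

Lemma moebius_inversion f g n : (0 < n)%N ->
  (forall k, (0 < k)%N -> conv (fun=> 1) g k = f k) -> conv mu f n = g n.
Proof.
move=> n0 fg; rewrite -(@conv_deltal g n n0) -(eq_conv n0 (g1 := g) conv_moebius1)//.
by rewrite convA//; apply: eq_conv => // k k0; rewrite fg.
Qed.

Lemma lnnM a b : (0 < a)%N -> (0 < b)%N -> L (a * b)%N = L a + L b.
Proof. by move=> a0 b0; rewrite /lnn natrM lnM// posrE ltr0n. Qed.

Lemma lnn_ge0 n : 0 <= L n.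
Proof.
case: n => [|n]; first by rewrite /lnn ln0.
by rewrite /lnn ln_ge0// ler1n.
Qed.

Lemma lnn1 : L 1 = 0. Proof. by rewrite /lnn ln1. Qed.

Lemma lnn_div d n : (0 < n)%N -> (d %| n)%N -> L (n %/ d)%N = L n - L d.
Proof.
move=> n0 dn; have d0 := dvdn_gt0 n0 dn.
have nd0 : (0 < n %/ d)%N by rewrite divn_gt0// dvdn_leq.
by rewrite -{2}(divnK dn) lnnM// addrK.
Qed.

(** In each term the logarithm of [n] splits into those of [d] and [n / d]. *)
Lemma conv_derivation f g n : (0 < n)%N ->
  L n * conv f g n = conv (fun k => L k * f k) g n + conv f (fun k => L k * g k) n.
Proof.
move=> n0; rewrite /conv mulr_sumr -big_split; apply: eq_big_seq => d.
rewrite -dvdn_divisors// => dn; have d0 := dvdn_gt0 n0 dn.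
have nd0 : (0 < n %/ d)%N by rewrite divn_gt0// dvdn_leq.
have -> : L n = L (n %/ d)%N + L d by rewrite -lnnM// divnK.
by rewrite mulrDl addrC mulrA; congr (_ + _); rewrite mulrCA.
Qed.

(** For [n = p ^ k * m] the terms at [d] and [p * d] pair off, leaving [ln p]
    times the sum of the Moebius function over the divisors of [m]. *)
Lemma mangoldt_ge0 n : 0 <= Lam n.
Proof.
case: n => [|n].
  by rewrite /mangoldt /conv big1// => d _; rewrite div0n /lnn ln0 ?mulr0.
have [->|n1] := eqVneq n.+1 1%N.
  by rewrite /mangoldt /conv big_seq1 moebius1 mul1r lnn_ge0.
have [|p [k [m [pp pm m0 k0 ->]]]] := @prime_power_split n.+1.
  by rewrite ltn_neqAle eq_sym n1.
have p0 := prime_gt0 pp.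
rewrite /mangoldt /conv moebius_split//.
rewrite (eq_big_seq (fun d => mu d * L p)); last first.
  move=> d; rewrite -dvdn_divisors// => dm; congr (_ * _).
  have d0 := dvdn_gt0 m0 dm.
  have md0 : (0 < m %/ d)%N by rewrite divn_gt0// dvdn_leq.
  have n0 : (0 < p ^ k * m)%N by rewrite muln_gt0 expn_gt0 p0.
  have pk : (p %| p ^ k)%N by rewrite -{1}(expn1 p) dvdn_exp2l.
  rewrite !lnn_div// ?dvdn_mul// ?dvdn_mull// (@lnnM p d)//; ring.
by rewrite -mulr_suml sum_moebius// mulr_ge0// ?ler0n// lnn_ge0.
Qed.

Lemma conv1_mangoldt n : (0 < n)%N -> conv (fun=> 1) Lam n = L n.
Proof.
move=> n0; rewrite -(@conv_deltal L n n0) -(eq_conv n0 (g1 := L) conv_moebius1)//.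
rewrite -convA//; apply: eq_conv => // k k0; exact: convC.
Qed.

(** The coefficients of [zeta'' / zeta]; those of [zeta * (1 / zeta)''] are
    [selberg_diff]. *)
Definition selberg (n : nat) : R := conv Lam Lam n + L n * Lam n.

Definition selberg_diff (n : nat) : R := conv Lam Lam n - L n * Lam n.

Lemma conv_mangoldt_ge0 n : 0 <= conv Lam Lam n.
Proof. by rewrite /conv sumr_ge0// => d _; rewrite mulr_ge0 ?mangoldt_ge0. Qed.

Lemma ler_norm_selberg_diff n : `|selberg_diff n| <= selberg n.
Proof.
apply: le_trans (ler_normB _ _) _.
by rewrite !ger0_norm ?conv_mangoldt_ge0// mulr_ge0 ?lnn_ge0 ?mangoldt_ge0.
Qed.

Lemma conv_moebius_lnn2 n : (0 < n)%N ->
  conv mu (fun k => L k ^+ 2) n = selberg n.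
Proof.
move=> n0; apply: moebius_inversion => // k k0.
rewrite expr2 -{2}conv1_mangoldt// conv_derivation// convDr; congr (_ + _).
rewrite -convA//; apply: eq_conv => // j j0.
by rewrite mulr1 conv1_mangoldt.
Qed.

Lemma lnn_moebius n : (0 < n)%N -> L n * mu n = - conv mu Lam n.
Proof.
move=> n0.
have Lm k : (0 < k)%N -> conv (fun j => L j * mu j) (fun=> 1) k = - Lam k.
  move=> k0; apply/eqP; rewrite -addr_eq0.
  have := conv_derivation mu (fun=> 1) k0.
  rewrite conv_moebius1// => /eqP; rewrite eq_sym.
  have -> : L k * (k == 1%N)%:R = 0.
    by case: eqP => [->|]; rewrite ?lnn1 ?mul0r ?mulr0.
  congr (_ + _ == _); apply: eq_conv => // j j0; exact: mulr1.
rewrite -[LHS](@conv_deltar (fun k => L k * mu k))//.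
rewrite -(eq_conv n0 (f1 := fun k => L k * mu k) (fun _ _ => erefl) conv_moebius1)//.
rewrite -[conv mu Lam n]convC// -convNl.
rewrite -(eq_conv n0 Lm (g1 := mu))//.
rewrite convA//; apply: eq_conv => // k k0; exact: convC.
Qed.

Lemma lnn2_moebius n : (0 < n)%N -> L n ^+ 2 * mu n = conv selberg_diff mu n.
Proof.
move=> n0; rewrite expr2 -mulrA lnn_moebius// mulrN conv_derivation// opprD.
rewrite convC// (@convC _ selberg_diff)// convDr convNr; congr (_ + _).
rewrite -convA// -convNr convC//; apply: eq_conv => // k k0.
by rewrite lnn_moebius// opprK.
Qed.

End Moebius.

(** * Asymptotics of sums of logarithms *)

Section Monotone_sums.
Context {R : realType}.
Implicit Types (f F : R -> R).

Lemma ln_le_sub1 (x : R) : 0 < x -> ln x <= x - 1.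
Proof.
move=> x0; rewrite -[in ln x](subrK 1 x) addrC le_ln1Dx//.
by rewrite ltrBrDl subrr.
Qed.

Lemma mvt_nonincreasing f F (a b : R) :
  (forall x : R, 1 <= x -> is_derive x 1 F (f x)) ->
  (forall x y : R, 1 <= x -> x <= y -> f y <= f x) ->
  1 <= a -> a <= b ->
  f b * (b - a) <= F b - F a <= f a * (b - a).
Proof.
move=> dF fd a1; rewrite le_eqVlt => /orP[/eqP ->|ab].
  by rewrite !subrr !mulr0 lexx.
have dab x : x \in `]a, b[%R -> is_derive x 1 F (f x).
  by move=> /itvP xab; apply: dF; rewrite (le_trans a1)// xab.
have cF : {within `[a, b], continuous F}.
  apply: derivable_within_continuous => x /itvP xab.
  have x1 : 1 <= x by rewrite (le_trans a1)// xab.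
  by have [] := dF x x1.
have [c /itvP cab ->] := MVT ab dab cF.
rewrite !ler_pM2r ?subr_gt0// !fd ?cab// (le_trans a1)// cab//.
Qed.

(** The errors [f 1 + ... + f n - F n] decrease, and increase once [f n] is
    subtracted from them: [gamma] separates the two sequences. *)
Lemma sum_nonincreasing f F :
  (forall x : R, 1 <= x -> is_derive x 1 F (f x)) ->
  (forall x y : R, 1 <= x -> x <= y -> f y <= f x) ->
  (forall x : R, 1 <= x -> 0 <= f x) ->
  exists gamma : R, forall (n : nat) (y : R), (0 < n)%N -> n%:R <= y < n.+1%:R ->
    `|psum (fun k => f k%:R) n - F y - gamma| <= f n%:R.
Proof.
move=> dF fd f0.
pose u n := psum (fun k => f k%:R) n.+1 - F n.+1%:R.
pose v n := u n - f n.+1%:R.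
have step n : f n.+2%:R <= F n.+2%:R - F n.+1%:R <= f n.+1%:R.
  have := @mvt_nonincreasing f F n.+1%:R n.+2%:R dF fd.
  by rewrite ler1n ler_nat -natrB// subSnn !mulr1; apply.
have vu n : v n <= u n by rewrite lerBlDr lerDl f0// ler1n.
have uS n : u n.+1 <= u n.
  have /andP[+ _] := step n; rewrite /u psumS /=.
  by move: (f _) (F n.+2%:R) (F n.+1%:R) (psum _ _); intros; lra.
have vS n : v n <= v n.+1.
  have /andP[_] := step n; rewrite /v /u [psum _ n.+2]psumS /=.
  by move: (f n.+2%:R) (f _) (F n.+2%:R) (F n.+1%:R) (psum _ _); intros; lra.
have ud : nonincreasing_seq u by apply/nonincreasing_seqP.
have vi : nondecreasing_seq v by apply/nondecreasing_seqP.
have vum n m : v n <= u m.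
  apply: le_trans (vi _ _ (leq_maxl n m)) _; apply: le_trans (vu _) _.
  exact/ud/leq_maxr.
exists (sup (range v)) => -[//|n] y _ /andP[ny yn].
have un : sup (range v) <= u n.
  by apply: ge_sup; [exists (v 0%N), 0%N | move=> _ [k _ <-]; exact: vum].
have vn : v n <= sup (range v).
  have ubv : has_ubound (range v) by exists (u n) => _ [k _ <-]; exact: vum.
  by apply: (ub_le_sup ubv); exists n.
have := @mvt_nonincreasing f F n.+1%:R y dF fd.
rewrite ler1n => /(_ isT ny) /andP[F0 F1].
have y1 : y - n.+1%:R <= 1 by rewrite lerBlDr nat1r ltW.
have F2 : F y - F n.+1%:R <= f n.+1%:R.
  by apply: le_trans F1 _; rewrite ler_piMr// f0// ler1n.
have F3 : 0 <= F y - F n.+1%:R.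
  apply: le_trans F0; rewrite mulr_ge0 ?subr_ge0// f0//.
  by rewrite (le_trans _ ny)// ler1n.
move: un vn F2 F3; rewrite /v /u ler_norml.
by move: (f _) (F _) (F y) (psum _ _) (sup _); intros; apply/andP; split; lra.
Qed.

Lemma sum_nondecreasing f F :
  (forall x : R, 1 <= x -> is_derive x 1 F (f x)) ->
  (forall x y : R, 1 <= x -> x <= y -> f x <= f y) ->
  (forall x : R, 1 <= x -> 0 <= f x) ->
  forall (n : nat) (y : R), (0 < n)%N -> n%:R <= y < n.+1%:R ->
    `|psum (fun k => f k%:R) n - F y + F 1| <= f y.
Proof.
move=> dF fi f0.
have mvt a b : 1 <= a -> a <= b -> f a * (b - a) <= F b - F a <= f b * (b - a).
  move=> a1 ab.
  have dN (x : R) : 1 <= x -> is_derive x 1 (fun x => - F x) (- f x).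
    by move=> x1; have := dF x x1 => ?; apply: is_deriveN.
  have fN (x y : R) : 1 <= x -> x <= y -> - f y <= - f x.
    by move=> x1 xy; rewrite lerN2 fi.
  have /andP[] := mvt_nonincreasing dN fN a1 ab.
  by move: (f a) (f b) (F a) (F b) => *; apply/andP; split; lra.
pose u n := psum (fun k => f k%:R) n.+1 - F n.+1%:R + F 1.
have step n : f n.+1%:R <= F n.+2%:R - F n.+1%:R <= f n.+2%:R.
  have := @mvt n.+1%:R n.+2%:R.
  by rewrite ler1n ler_nat -natrB// subSnn !mulr1; apply.
have u0 n : 0 <= u n.
  elim: n => [|n IHn]; first by rewrite /u psumS psum0 add0r subrK f0.
  move: IHn (step n); rewrite /u [psum _ n.+2]psumS /= => + /andP[].
  by move: (f n.+2%:R) (f n.+1%:R) (F n.+2%:R) (F n.+1%:R) (psum _ _); intros; lra.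
have u1 n : u n <= f n.+1%:R.
  elim: n => [|n IHn]; first by rewrite /u psumS psum0 add0r subrK.
  move: IHn (step n); rewrite /u [psum _ n.+2]psumS /= => + /andP[].
  by move: (f n.+2%:R) (f n.+1%:R) (F n.+2%:R) (F n.+1%:R) (psum _ _); intros; lra.
move=> [//|n] y _ /andP[ny yn].
have n1 : 1 <= n.+1%:R :> R by rewrite ler1n.
have /andP[F0 F1] := mvt _ _ n1 ny.
have y1 : y - n.+1%:R <= 1 by rewrite lerBlDr nat1r ltW.
have F2 : F y - F n.+1%:R <= f y.
  by apply: le_trans F1 _; rewrite ler_piMr// f0// (le_trans n1).
have F3 : 0 <= F y - F n.+1%:R.
  by apply: le_trans F0; rewrite mulr_ge0 ?subr_ge0// f0.
have := fi _ _ n1 ny.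
move: (u0 n) (u1 n) F2 F3; rewrite /u ler_norml.
by move: (f _) (f y) (F _) (F y) (psum _ _); intros; apply/andP; split; lra.
Qed.

Lemma sum_inv : exists gamma : R, forall (n : nat) (y : R),
  (0 < n)%N -> n%:R <= y < n.+1%:R ->
  `|psum (fun k => k%:R^-1) n - ln y - gamma| <= n%:R^-1.
Proof.
apply: (@sum_nonincreasing (fun x => x^-1) (@ln R)) => [x x1|x y x1 xy|x x1].
- by apply: is_derive1_ln; rewrite (lt_le_trans _ x1).
- have x0 : 0 < x by rewrite (lt_le_trans _ x1).
  by rewrite lef_pV2// posrE (lt_le_trans x0).
- by rewrite invr_ge0 (le_trans _ x1).
Qed.

(** The numerator [1 + ln x] in place of [ln x] makes the summand monotone on
    all of [[1, +oo)]. *)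
Lemma sum_ln_div : exists gamma : R, forall (n : nat) (y : R),
  (0 < n)%N -> n%:R <= y < n.+1%:R ->
  `|psum (fun k => (1 + ln k%:R) / k%:R) n - (ln y + ln y ^+ 2 / 2) - gamma|
    <= (1 + ln n%:R) / n%:R.
Proof.
apply: (@sum_nonincreasing (fun x => (1 + ln x) / x)
  (fun x => ln x + ln x ^+ 2 / 2)) => [x x1|x y x1 xy|x x1].
- have x0 : 0 < x by rewrite (lt_le_trans _ x1).
  have dl := is_derive1_ln x0; apply: is_derive_eq.
  by rewrite /GRing.scale/=; field; rewrite gt_eqF.
- have x0 : 0 < x by rewrite (lt_le_trans _ x1).
  have y0 : 0 < y by rewrite (lt_le_trans x0).
  have l0 : 0 <= ln x by rewrite ln_ge0.
  rewrite ler_pdivrMr// mulrAC ler_pdivlMr//.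
  have : ln y - ln x <= y / x - 1.
    by rewrite -ln_div// ln_le_sub1 ?divr_gt0.
  have -> : y / x - 1 = (y - x) / x by field; rewrite gt_eqF.
  rewrite ler_pdivlMr// => H.
  have : 0 <= ln x * (y - x) by rewrite mulr_ge0// subr_ge0.
  lra.
- by rewrite divr_ge0 ?addr_ge0 ?ln_ge0// (le_trans _ x1).
Qed.

Lemma sum_ln2 (n : nat) (y : R) : (0 < n)%N -> n%:R <= y < n.+1%:R ->
  `|psum (fun k => ln k%:R ^+ 2) n - (y * ln y ^+ 2 - 2 * y * ln y + 2 * y) + 2|
    <= ln y ^+ 2.
Proof.
move=> n0 ny.
have := @sum_nondecreasing (fun x => ln x ^+ 2)
  (fun x => x * ln x ^+ 2 - 2 * x * ln x + 2 * x) _ _ _ n y n0 ny.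
rewrite ln1 expr0n/= !mulr0 subr0 add0r mulr1; apply.
- move=> x x1; have x0 : 0 < x by rewrite (lt_le_trans _ x1).
  have dl := is_derive1_ln x0; apply: is_derive_eq.
  by rewrite /GRing.scale/=; field; rewrite gt_eqF.
- move=> x z x1 xz; have x0 : 0 < x by rewrite (lt_le_trans _ x1).
  rewrite lerXn2r ?nnegrE ?ln_ge0 ?(le_trans x1)// ler_ln// posrE.
  by rewrite (lt_le_trans x0).
- by move=> x _; exact: sqr_ge0.
Qed.

Lemma sum_ln (n : nat) : (0 < n)%N ->
  `|psum (fun k => ln k%:R) n - (n%:R * ln n%:R - n%:R) - 1 :> R| <= ln n%:R.
Proof.
move=> n0.
have := @sum_nondecreasing (@ln R) (fun x => x * ln x - x) _ _ _ n n%:R n0.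
rewrite lexx ltr_nat leqnn ln1 mulr0 sub0r; apply => //.
- move=> x x1; have x0 : 0 < x by rewrite (lt_le_trans _ x1).
  have dl := is_derive1_ln x0; apply: is_derive_eq.
  by rewrite /GRing.scale/=; field; rewrite gt_eqF.
- move=> x z x1 xz; have x0 : 0 < x by rewrite (lt_le_trans _ x1).
  by rewrite ler_ln// posrE (lt_le_trans x0).
- by move=> x x1; exact: ln_ge0.
Qed.

End Monotone_sums.

(** * Selberg's formula *)

Section Selberg_formula.
Context {R : realType}.
Local Notation mu := (moebius R).
Local Notation L := (lnn R).

Lemma ln_le_id (x : R) : 0 <= x -> ln x <= x.
Proof.
rewrite le_eqVlt => /orP[/eqP <-|x0]; first by rewrite ln0.
by apply: le_trans (ln_le_sub1 x0) _; rewrite lerBlDr lerDl.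
Qed.

Lemma ln_sqr_le (x : R) : 1 <= x -> ln x ^+ 2 <= 4 * x.
Proof.
move=> x1; have x0 : 0 <= x by rewrite (le_trans _ x1).
have s1 : 1 <= Num.sqrt x by rewrite -[leLHS]sqrtr1 ler_wsqrtr.
have s0 : 0 < Num.sqrt x by rewrite (lt_le_trans _ s1).
have ls : 0 <= ln (Num.sqrt x) by rewrite ln_ge0.
have -> : ln x = 2 * ln (Num.sqrt x).
  by rewrite -{1}(sqr_sqrtr x0) lnXn// mulr_natl.
have -> : 4 * x = (2 * Num.sqrt x) ^+ 2 by rewrite exprMn sqr_sqrtr//; ring.
rewrite lerXn2r ?nnegrE ?mulr_ge0 ?(ltW s0)// ler_pM2l//.
exact/ln_le_id/ltW.
Qed.

Lemma divn_real (N d : nat) : (0 < d)%N ->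
  (N %/ d)%:R <= (N%:R / d%:R : R) < (N %/ d).+1%:R.
Proof.
move=> d0; have d0R : 0 < d%:R :> R by rewrite ltr0n.
rewrite ler_pdivlMr// ltr_pdivrMr// -!natrM ler_nat ltr_nat.
by rewrite leq_trunc_div /= ltn_ceil.
Qed.

Lemma sum_ln_div_sqr (N : nat) : (0 < N)%N ->
  psum (fun d => ln (N%:R / d%:R : R) ^+ 2) N <= 14 * N%:R.
Proof.
move=> N0; have N1 : 1 <= N%:R :> R by rewrite ler1n.
set l := ln (N%:R : R).
have -> : psum (fun d => ln (N%:R / d%:R) ^+ 2) N =
    N%:R * l ^+ 2 - 2 * l * psum (fun d => ln d%:R) N
    + psum (fun d => ln d%:R ^+ 2) N :> R.
  rewrite -psumZ -psum_cst -psumB -psumD; apply: eq_psum => d /andP[d0 _].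
  by rewrite ln_div ?posrE ?ltr0n// -/l; ring.
have := @sum_ln R N N0; have := @sum_ln2 R N N%:R N0.
rewrite lexx ltr_nat leqnn => /(_ erefl).
have l0 : 0 <= l by rewrite ln_ge0.
have := ln_sqr_le N1.
rewrite -/l; move: (psum (fun d => ln d%:R) N) (psum (fun d => ln d%:R ^+ 2) N).
move: l l0 => l l0 s1 s2 ll.
rewrite !ler_norml => /andP[_ H2] /andP[H1 _].
have : 0 <= l * (s1 - (N%:R * l - N%:R) - 1 + l) by rewrite mulr_ge0//; lra.
move: (N%:R : R) ll H1 H2 N1 => n ll H1 H2 N1 H3.
nra.
Qed.

(** The main term [B] is chosen so that summing [B (y / n)] over [n <= y]
    reproduces the sum of [ln ^ 2] up to [O(1 + ln ^ 2 y)]; Moebius inversion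
    then turns the sum of [ln ^ 2] into [B] itself, and the logarithmic error is
    absorbed because it is summed over all the scales [y = N / d]. *)
Lemma sum_selberg : exists c c' A : R, forall N : nat, (0 < N)%N ->
  `|psum selberg N - (2 * N%:R * ln N%:R + c * N%:R + c')| <= A * N%:R.
Proof.
have [g Hg] := @sum_inv R; have [g' Hg'] := @sum_ln_div R.
pose c := -2 - 2 * g; pose c' := 2 + 2 * g' - 2 * g - c * g.
pose A := 14 + 2 * `|c| + `|c'|.
pose B (t : R) := 2 * t * ln t + c * t + c'.
have err (m : nat) (y : R) : (0 < m)%N -> m%:R <= y < m.+1%:R ->
    `|psum (fun n => B (y / n%:R)) m - psum (fun k => ln k%:R ^+ 2) m|
      <= A * (1 + ln y ^+ 2).
  move=> m0 my.
  have m1 : 1 <= m%:R :> R by rewrite ler1n.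
  have y1 : 1 <= y by case/andP: my => my _; exact: le_trans my.
  have y0 : 0 < y by exact: lt_le_trans y1.
  have sB : psum (fun n => B (y / n%:R)) m =
      2 * y * ln y * psum (fun k => k%:R^-1) m
      - 2 * y * (psum (fun k => (1 + ln k%:R) / k%:R) m - psum (fun k => k%:R^-1) m)
      + c * y * psum (fun k => k%:R^-1) m + c' * m%:R.
    rewrite -psumB -!psumZ [c' * _]mulrC -(psum_cst c') -psumB -!psumD.
    apply: eq_psum => n /andP[n0 _].
    rewrite /B ln_div ?posrE ?ltr0n//; field.
    by rewrite pnatr_eq0 -lt0n.
  have l0 : 0 <= ln y by rewrite ln_ge0.
  have := @sum_ln2 R m y m0 my; have := Hg m y m0 my; have := Hg' m y m0 my.
  rewrite sB; move: (psum (fun k => (1 + ln k%:R) / k%:R) m) (psum (fun k => k%:R^-1) m)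
    (psum (fun k => ln k%:R ^+ 2) m) => K H S.
  (* the error terms are measured against [y], and [y < 2 m] *)
  have ym : y <= 2 * m%:R.
    case/andP: my => _; rewrite -natr1 => ?; lra.
  have yf : 0 <= y - m%:R <= 1.
    by case/andP: my => ?; rewrite -natr1 => ?; apply/andP; split; lra.
  have lmy : ln m%:R <= ln y.
    by rewrite ler_ln ?posrE ?ltr0n//; case/andP: my.
  have m0R : 0 < m%:R :> R by rewrite ltr0n.
  move: (ln y) l0 (m%:R : R) lmy m1 m0R ym yf.
  move=> l l0 M lml M1 M0 ym /andP[yf0 yf1] hK hH hS.
  pose h := H - l - g; pose k := K - (l + l ^+ 2 / 2) - g'.
  pose s := S - (y * l ^+ 2 - 2 * y * l + 2 * y) + 2.
  have hh : `|y * h| <= 2.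
    rewrite normrM (gtr0_norm y0); apply: le_trans (ler_pM _ _ ym hH) _ => //.
      exact: ltW.
    by rewrite mulfK// gt_eqF.
  have hk : `|y * k| <= 2 * (1 + l).
    rewrite normrM (gtr0_norm y0); apply: le_trans (ler_pM _ _ ym hK) _ => //.
      exact: ltW.
    have -> : 2 * M * ((1 + ln M) / M) = 2 * (1 + ln M) by field; rewrite gt_eqF.
    by rewrite ler_pM2l// lerD2l.
  have -> : 2 * y * l * H - 2 * y * (K - H) + c * y * H + c' * M - S =
    2 * (l * (y * h)) - 2 * (y * k) + 2 * (y * h) + c * (y * h)
      - c' * (y - M) + 2 - s.
    by rewrite /c' /c /h /k /s; field.
  have hl : `|l * (y * h)| <= 2 * l.
    by rewrite normrM (ger0_norm l0) mulrC ler_wpM2r.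
  have hc : `|c * (y * h)| <= 2 * `|c|.
    by rewrite normrM mulrC ler_wpM2r.
  have hc' : `|c' * (y - M)| <= `|c'|.
    by rewrite normrM (ger0_norm yf0) ler_piMr.
  have hs : `|s| <= l ^+ 2 by [].
  have l2 : 8 * l <= 4 + 4 * l ^+ 2 by have := sqr_ge0 (l - 1); nra.
  have Al : A * (1 + l ^+ 2) >= A + 14 * l ^+ 2.
    have : 0 <= (2 * `|c| + `|c'|) * l ^+ 2 by rewrite mulr_ge0 ?sqr_ge0 ?addr_ge0 ?mulr_ge0.
    rewrite /A; lra.
  have l20 := sqr_ge0 l.
  apply: le_trans Al; rewrite /A.
  move: s (y * k) (y * h) (c' * (y - M)) (c * (y * h)) (l * (y * h)) (l ^+ 2) hs hc' hc hl hk hh l2 l20.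
  move: (`|c|) (`|c'|) (normr_ge0 c) (normr_ge0 c').
  clear => n n' n0 n'0 s v w p q u l2; rewrite !ler_norml.
  move=> /andP[? ?] /andP[? ?] /andP[? ?] /andP[? ?] /andP[? ?] /andP[? ?] ? ?.
  by apply/andP; split; lra.
exists c, c', (15 * A) => N N0.
have -> : psum selberg N = psum (fun d => mu d *
    psum (fun k => ln k%:R ^+ 2) (N %/ d)%N) N.
  rewrite -psum_conv; apply: eq_psum => n /andP[n0 _].
  by rewrite -conv_moebius_lnn2.
have -> : 2 * N%:R * ln N%:R + c * N%:R + c' = psum (fun d => mu d *
    psum (fun n => B (N%:R / d%:R / n%:R)) (N %/ d)%N) N.
  transitivity (psum (fun n => B (N%:R / n%:R) * conv mu (fun=> 1) n) N).
    transitivity (psum (fun n => (n == 1%N)%:R * B (N%:R / n%:R)) N).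
      by rewrite psum_eq1 ?N0// divr1 /B; ring.
    by apply: eq_psum => n /andP[n0 _]; rewrite conv_moebius1// mulrC.
  rewrite psum_conv_weight; apply: eq_psum => d _; congr (_ * _).
  by apply: eq_psum => k _; rewrite mulr1 natrM invfM mulrA.
rewrite -psumB.
have A0 : 0 <= A by rewrite /A !addr_ge0 ?mulr_ge0.
apply: le_trans (ler_norm_psum _ _) _.
have E : psum (fun d => A * (1 + ln (N%:R / d%:R : R) ^+ 2)) N <= 15 * A * N%:R.
  rewrite psumZ psumD psum_cst mulr1 -mulrA mulrCA ler_wpM2l//.
  have := sum_ln_div_sqr N0; lra.
apply: le_trans E; apply: ler_psum => d /andP[d0 dN].
rewrite -mulrBr normrM -[leRHS]mul1r ler_pM// ?ler_norm_moebius//.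
rewrite distrC; apply: err; first by rewrite divn_gt0.
exact: divn_real.
Qed.

(** The sum of [2 * ln n] has the same main term [2 * N * ln N] as that of
    [selberg]; a difference linear in [N] is harmless. *)
Lemma selberg_formula : exists A : R, 0 <= A /\ forall N : nat,
  `|psum (fun n => selberg n - 2 * L n) N| <= A * N%:R.
Proof.
have [c [c' [A HA]]] := sum_selberg.
exists (`|A| + `|c| + `|c'| + 6); split; first by rewrite !addr_ge0.
case=> [|N]; first by rewrite psum0 normr0 mulr0.
have N1 : 1 <= N.+1%:R :> R by rewrite ler1n.
rewrite psumB psumZ.
have := HA N.+1 isT; have := @sum_ln R N.+1 isT.
have : ln (N.+1%:R : R) <= N.+1%:R by rewrite ln_le_id.
have H1 : A * N.+1%:R <= `|A| * N.+1%:R by rewrite ler_wpM2r ?ler_norm.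
have H2 : `|c * N.+1%:R| <= `|c| * N.+1%:R by rewrite normrM normr_nat.
have H3 : `|c'| <= `|c'| * N.+1%:R by rewrite ler_peMr.
have H4 := ler_norm c'; have H5 := ler_norm (- c'); rewrite normrN in H5.
move: H1 H2 H3 H4 H5 N1; rewrite /lnn.
move: (psum (fun n => ln n%:R) _) (psum selberg _) (N.+1%:R : R) => u v n.
move: (ln n) => l; rewrite !ler_norml !mulrDl.
move: (A * n) (`|A| * n) (c * n) (`|c| * n) (`|c'| * n) (`|c'|) => a a' d d' e' e.
clear => H1 /andP[H2 H2'] H3 H4 H5 n1 ln /andP[H6 H6'] /andP[H7 H7'].
apply/andP; split; lra.
Qed.

End Selberg_formula.

(** * Selberg's inequality for the Mertens function *)

Section Mertens.
Context {R : realType}.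
Local Notation mu := (moebius R).
Local Notation L := (lnn R).

Definition mertens (n : nat) : R := psum mu n.

Lemma mertens_lip (m n : nat) : (m <= n)%N ->
  `|mertens n - mertens m| <= n%:R - m%:R.
Proof.
move=> /subnK <-; elim: (n - m)%N => [|k IHk]; first by rewrite add0n !subrr normr0.
rewrite addSn /mertens psumS -natr1.
have -> : psum mu (k + m) + mu (k + m).+1 - psum mu m =
  (mertens (k + m) - mertens m) + mu (k + m).+1 by rewrite /mertens; ring.
apply: le_trans (ler_normD _ _) _.
by rewrite [_ + 1 - _]addrAC lerD// ler_norm_moebius.
Qed.

Lemma mertens_le (n : nat) : `|mertens n| <= n%:R.
Proof. by have := mertens_lip (leq0n n); rewrite /mertens psum0 !subr0. Qed.

Lemma abel_psum (a G : nat -> R) (N : nat) :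
  psum (fun n => a n * G n) N =
  psum (fun n => psum a n * (G n - G n.+1)) N + psum a N * G N.+1.
Proof.
elim: N => [|N IHN]; first by rewrite !psum0 mul0r addr0.
by rewrite !psumS IHN; ring.
Qed.

(** Abel summation twice: the variation of [G] is replaced by that of [T], which
    is then summed back against the constant sequence 1. *)
Lemma abel_le (a G T : nat -> R) (A : R) (N : nat) : 0 <= A ->
  (forall n, `|psum a n| <= A * n%:R) -> G N.+1 = 0 -> T N.+1 = 0 ->
  (forall n, (0 < n)%N -> `|G n - G n.+1| <= T n - T n.+1) ->
  `|psum (fun n => a n * G n) N| <= A * psum T N.
Proof.
move=> A0 aA G0 T0 GT; rewrite abel_psum G0 mulr0 addr0.
apply: le_trans (ler_norm_psum _ _) _.
have -> : psum T N = psum (fun n => n%:R * (T n - T n.+1)) N.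
  have := abel_psum (fun=> 1) T N; rewrite T0 mulr0 addr0.
  under eq_psum do rewrite mul1r; move=> ->.
  by apply: eq_psum => n _; rewrite psum_cst mulr1.
rewrite -psumZ; apply: ler_psum => n /andP[n0 _]; rewrite normrM mulrA.
by apply: ler_pM => //; exact: GT.
Qed.

Lemma harmonic_le (N : nat) : (0 < N)%N ->
  psum (fun n => n%:R^-1) N <= 1 + ln (N%:R : R).
Proof.
case: N => // N _; elim: N => [|N IHN].
  by rewrite psumS psum0 ln1 invr1 add0r addr0.
rewrite psumS; have : N.+2%:R^-1 <= ln (N.+2%:R : R) - ln N.+1%:R; last first.
  by move: IHN; move: (psum _ _) (N.+2%:R^-1) (ln _) (ln _); intros; lra.
have N2 : 0 < (N.+2%:R : R) by rewrite ltr0n.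
have N1 : 0 < (N.+1%:R : R) by rewrite ltr0n.
rewrite -lerN2 opprB -ln_div//; apply: le_trans (ln_le_sub1 _) _.
  by rewrite divr_gt0.
rewrite -{1}(addrK 1 N.+1%:R) natr1 mulrBl divff ?gt_eqF// mul1r.
by rewrite addrAC subrr add0r.
Qed.

(** Since [ln ^ 2 * mu] is the convolution of [selberg_diff] and [mu], its sum is
    bounded by that of [selberg n * |M (N / n)|]. The weight [selberg] may be
    replaced by its mean [2 * ln], because the function [n |-> |M (N / n)|] has
    variation at most that of the integer part of [N / n]. *)
Lemma mertens_selberg : exists C : R, 0 <= C /\ forall N : nat, (0 < N)%N ->
  ln (N%:R : R) ^+ 2 * `|mertens N| <=
  2 * psum (fun n => L n * `|mertens (N %/ n)%N|) N + C * N%:R * (1 + ln N%:R).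
Proof.
have [A [A0 HA]] := @selberg_formula R.
exists (A + 6); split; first by rewrite addr_ge0.
move=> N N0; have N1 : 1 <= N%:R :> R by rewrite ler1n.
set l := ln (N%:R : R); have l0 : 0 <= l by rewrite ln_ge0.
have H1 : `|l ^+ 2 * mertens N - psum (fun n => L n ^+ 2 * mu n) N|
    <= N%:R * l ^+ 2 - psum (fun n => ln n%:R ^+ 2) N.
  rewrite /mertens -psumZ -psumB -psum_cst -psumB.
  apply: le_trans (ler_norm_psum _ _) _; apply: ler_psum => n /andP[n0 nN].
  rewrite -mulrBl normrM ger0_norm ?ler_piMr ?ler_norm_moebius//;
    rewrite subr_ge0 lerXn2r ?nnegrE ?lnn_ge0// /l /lnn ler_ln ?posrE ?ltr0n//;
    by rewrite ler_nat.
have H2 : `|psum (fun n => L n ^+ 2 * mu n) N| <=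
    psum (fun n => selberg n * `|mertens (N %/ n)%N|) N.
  have -> : psum (fun n => L n ^+ 2 * mu n) N = psum (conv selberg_diff mu) N.
    by apply: eq_psum => n /andP[n0 _]; exact: lnn2_moebius.
  rewrite psum_conv; apply: le_trans (ler_norm_psum _ _) _.
  apply: ler_psum => n _.
  by rewrite normrM ler_wpM2r// ler_norm_selberg_diff.
have H3 : `|psum (fun n => (selberg n - 2 * L n) * `|mertens (N %/ n)%N|) N|
    <= A * (N%:R * (1 + l)).
  apply: le_trans (abel_le (T := fun n => (N %/ n)%:R) A0 HA _ _ _) _.
  - by rewrite divn_small// /mertens psum0 normr0.
  - by rewrite divn_small.
  - move=> n n0; apply: le_trans (ler_dist_dist _ _) _; apply: mertens_lip.
    exact: leq_div2l.
  rewrite ler_wpM2l//; apply: le_trans (_ : psum (fun n => N%:R * n%:R^-1) N <= _).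
    by apply: ler_psum => n /andP[n0 _]; case/andP: (@divn_real R N n n0).
  by rewrite psumZ ler_wpM2l// harmonic_le.
have H4 : psum (fun n => (selberg n - 2 * L n) * `|mertens (N %/ n)%N|) N =
    psum (fun n => selberg n * `|mertens (N %/ n)%N|) N
    - 2 * psum (fun n => L n * `|mertens (N %/ n)%N|) N.
  by rewrite -psumZ -psumB; apply: eq_psum => n _; ring.
have := @sum_ln2 R N N%:R N0; rewrite lexx ltr_nat leqnn => /(_ erefl).
rewrite -/l ler_norml => /andP[H5 _].
have := ln_sqr_le N1; rewrite -/l => H6.
have -> : l ^+ 2 * `|mertens N| = `|l ^+ 2 * mertens N|.
  by rewrite normrM ger0_norm ?sqr_ge0.
have H8 := lerB_dist (l ^+ 2 * mertens N) (psum (fun n => L n ^+ 2 * mu n) N).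
rewrite H4 in H3; move/ler_normlP: H3 => [_ H3].
have H7 : 0 <= N%:R * l by rewrite mulr_ge0.
have key (X Y S a w d n : R) : d <= n * l ^+ 2 - S -> w <= X ->
    X - 2 * Y <= A * (n * (1 + l)) ->
    - l ^+ 2 <= S - (n * l ^+ 2 - 2 * n * l + 2 * n) + 2 -> l ^+ 2 <= 4 * n ->
    a - w <= d -> 0 <= n * l -> 1 <= n -> a <= 2 * Y + (A + 6) * n * (1 + l).
  move: (l ^+ 2) => l2; clear; intros; lra.
exact: key H1 H2 H3 H5 H6 H8 H7 N1.
Qed.

End Mertens.

(** * The Mertens function is o(x) *)

Section Windows.
Context {R : realType}.
Local Notation mu := (moebius R).
Local Notation L := (lnn R).
Local Notation M := (@mertens R).

Lemma archi_nat (x : R) : exists n : nat, x <= n%:R.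
Proof.
exists (Num.bound `|x|); apply: le_trans (ler_norm x) _.
exact/ltW/archi_boundP/normr_ge0.
Qed.

(** The sum of [mu d * (N %/ d)] is 1, and replacing [N %/ d] by the real
    quotient costs at most [N]. *)
Lemma psum_moebius_div (N : nat) : `|psum (fun n => mu n * n%:R^-1) N| <= 2.
Proof.
case: (posnP N) => [->|N0]; first by rewrite psum0 normr0.
have NR : 0 < (N%:R : R) by rewrite ltr0n.
have S1 : psum (fun d => mu d * (N %/ d)%:R) N = 1.
  transitivity (psum (conv mu (fun=> 1)) N).
    by rewrite psum_conv; apply: eq_psum => d _; rewrite psum_cst mulr1.
  transitivity (psum (fun n => (n == 1%N)%:R * 1 : R) N).
    by apply: eq_psum => n /andP[n0 _]; rewrite conv_moebius1// mulr1.
  by rewrite (psum_eq1 (fun=> 1))// N0.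
have E : N%:R * psum (fun n => mu n * n%:R^-1) N =
    1 + psum (fun d => mu d * (N%:R / d%:R - (N %/ d)%:R)) N.
  by rewrite -[X in X + _]S1 -psumD -psumZ; apply: eq_psum => d _; ring.
have F : `|psum (fun d => mu d * (N%:R / d%:R - (N %/ d)%:R)) N| <= N%:R.
  apply: le_trans (ler_norm_psum _ _) _; rewrite -[leRHS]mulr1 -psum_cst.
  apply: ler_psum => d /andP[d0 _]; rewrite normrM -[leRHS]mulr1 ler_pM ?ler_norm_moebius//.
  have := @divn_real R N d d0; rewrite -natr1 => /andP[? ?].
  by rewrite ger0_norm; lra.
rewrite -(ler_pM2l NR) -{1}(gtr0_norm NR) -normrM E.
apply: le_trans (ler_normD _ _) _; rewrite normr1.
have : 1 <= (N%:R : R) by rewrite ler1n.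
by move: F; move: (N%:R : R) => n F ?; lra.
Qed.

Lemma psum_mertens_bounded (N : nat) :
  `|psum (fun n => M n * (n%:R^-1 - n.+1%:R^-1)) N| <= 3.
Proof.
have := abel_psum mu (fun n => n%:R^-1) N => /eqP.
rewrite -subr_eq => /eqP <-; apply: le_trans (ler_normB _ _) _.
have -> : 3 = 2 + 1 :> R by ring.
apply: lerD; first exact: psum_moebius_div.
rewrite normrM [X in _ * X]ger0_norm ?invr_ge0// ler_pdivrMr ?ltr0n// mul1r.
by apply: le_trans (mertens_le N) _; rewrite ler_nat.
Qed.

Lemma ln_succ_le (x : R) : 0 < x -> ln (x + 1) - ln x <= x^-1.
Proof.
move=> x0; have x1 : 0 < x + 1 by rewrite addr_gt0.
rewrite -ln_div//; apply: le_trans (ln_le_sub1 _) _; first by rewrite divr_gt0.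
by rewrite mulrDl divff ?gt_eqF// mul1r addrAC subrr add0r.
Qed.

(** If [M] stayed larger than [g t / 2] in absolute value on a long window,
    it would keep its sign there, because its steps are at most 1, and the
    bounded sums of [M t / (t * (t + 1))] would grow like [g / 2 * ln D]. *)
Lemma mertens_window (g : R) : 0 < g -> exists D : nat, (0 < D)%N /\
  forall a : nat, 2 / g <= a%:R -> exists t : nat,
    (a < t <= a * D)%N /\ `|M t| <= g / 2 * t%:R.
Proof.
move=> g0; have [E HE] := archi_nat (expR (13 / g)).
have E0 : (0 < E)%N.
  by rewrite -(ltr0n R); apply: lt_le_trans HE; exact: expR_gt0.
(* With [13 / g] the window makes the sums grow by [13 / 2], more than the twice
   3 that [psum_mertens_bounded] leaves; the factor 3 pays for [a + 2 <= 3 * a]. *)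
exists (3 * E)%N; split; first by rewrite muln_gt0.
move=> a ag; apply: contrapT => H.
have {}H t : (a < t <= a * (3 * E))%N -> g / 2 * t%:R < `|M t|.
  by move=> tb; rewrite ltNge; apply/negP => Mt; apply: H; exists t.
have a0R : 0 < (a%:R : R) by apply: lt_le_trans ag; rewrite divr_gt0.
have a0 : (0 < a)%N by rewrite ltr0n in a0R.
have big t : (a < t <= a * (3 * E))%N -> 1 < `|M t|.
  move=> tb; apply: le_lt_trans (H t tb).
  case/andP: tb => at_ _; rewrite mulrAC ler_pdivlMr// mul1r mulrC -ler_pdivrMr//.
  by apply: le_trans ag _; rewrite ler_nat ltnW.
(* [e] is the sign that [M] keeps on the whole window. *)
pose e := Num.sg (M a.+1).
have e1 : `|e| = 1.
  rewrite normr_sg; have := big a.+1; rewrite ltnSn/=.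
  have -> : (a < a * (3 * E))%N by nia.
  by move=> /(_ isT); case: eqP => [->|//]; rewrite normr0 ltr10.
have eM x : 0 < e * x -> e * x = `|x|.
  by move=> ex; rewrite -(gtr0_norm ex) normrM e1 mul1r.
pose P n := psum (fun n => M n * (n%:R^-1 - n.+1%:R^-1)) n.
have sgn k : (a + k.+1 <= a * (3 * E))%N -> e * M (a + k.+1)%N = `|M (a + k.+1)%N|.
  elim: k => [_|k IHk kb]; first by rewrite addn1 /e -normrEsg.
  have kb' : (a + k.+1 <= a * (3 * E))%N by apply: leq_trans kb; rewrite leq_add2l.
  apply: eM; have := IHk kb'; have := big (a + k.+1)%N.
  rewrite kb' -{1}(addn0 a) ltn_add2l => /(_ isT) M1 eMk.
  have st : `|e * (M (a + k.+2)%N - M (a + k.+1)%N)| <= 1.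
    rewrite normrM e1 mul1r; apply: le_trans (mertens_lip _) _.
      by rewrite leq_add2l.
    by rewrite -natrB ?leq_add2l// subnDl subSnn.
  move: st; rewrite mulrBr eMk ler_norml => /andP[? _]; lra.
have grow k : (a + k <= a * (3 * E))%N ->
    g / 2 * (ln (a + k).+2%:R - ln a.+2%:R) <= e * (P (a + k)%N - P a).
  elim: k => [_|k IHk kb]; first by rewrite addn0 !subrr !mulr0.
  have kb' : (a + k <= a * (3 * E))%N by apply: leq_trans kb; rewrite leq_add2l.
  have tb : (a < a + k.+1 <= a * (3 * E))%N by rewrite kb -{1}(addn0 a) ltn_add2l.
  have := IHk kb'; have := sgn k kb; have := H _ tb.
  rewrite addnS /P psumS -/(P _).
  set t := (a + k)%N => Ht Hs Hk.
  have t1 : 0 < (t.+1%:R : R) by rewrite ltr0n.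
  have t2 : 0 < (t.+2%:R : R) by rewrite ltr0n.
  have w : t.+1%:R^-1 - t.+2%:R^-1 = (t.+1%:R * t.+2%:R)^-1 :> R.
    move: t1 t2; rewrite -[t.+2%:R]natr1; move: (t.+1%:R : R) => x x0 x1; field.
    by rewrite !gt_eqF.
  have A1 : g / 2 * t.+2%:R^-1 <= e * (M t.+1 * (t.+1%:R^-1 - t.+2%:R^-1)).
    rewrite mulrA Hs w invfM mulrA ler_pM2r ?invr_gt0// ler_pdivlMr//.
    exact: ltW.
  have A2 : ln t.+3%:R - ln t.+2%:R <= (t.+2%:R : R)^-1.
    by rewrite -[in ln t.+3%:R]natr1; exact: ln_succ_le.
  have A3 : g / 2 * (ln t.+3%:R - ln t.+2%:R) <= g / 2 * t.+2%:R^-1.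
    by rewrite ler_pM2l// divr_gt0.
  have key (d c l3 l2 la p pa X i : R) : c * (l2 - la) <= d * (p - pa) ->
      c * (l3 - l2) <= c * i -> c * i <= d * X -> c * (l3 - la) <= d * (p + X - pa).
    by clear; intros; lra.
  exact: key Hk A3 A1.
have aD : (a <= a * (3 * E))%N by nia.
have := grow (a * (3 * E) - a)%N; rewrite subnKC// => /(_ (leqnn _)).
set N := (a * (3 * E))%N => HN.
have P6 : e * (P N - P a) <= 6.
  apply: le_trans (ler_norm _) _; rewrite normrM e1 mul1r.
  apply: le_trans (ler_normB _ _) _.
  have := psum_mertens_bounded N; have := psum_mertens_bounded a.
  by rewrite -/(P _) -/(P _); move: `|P a| `|P N|; intros; lra.
have lnE : 13 / g <= ln N.+2%:R - ln a.+2%:R.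
  rewrite -ln_div ?posrE ?ltr0n// -ler_expR; apply: le_trans HE _.
  rewrite lnK ?posrE ?divr_gt0 ?ltr0n// ler_pdivlMr ?ltr0n// -natrM ler_nat.
  by rewrite /N; nia.
have : g / 2 * (13 / g) <= 6.
  by apply: le_trans P6; apply: le_trans HN; rewrite ler_pM2l// divr_gt0.
have -> : g / 2 * (13 / g) = 13 / 2 by field; rewrite gt_eqF.
lra.
Qed.

End Windows.

Section Tauberian.
Context {R : realType}.
Local Notation mu := (moebius R).
Local Notation L := (lnn R).
Local Notation M := (@mertens R).

Lemma psum_interval_ge (f : nat -> R) (x : R) (m n : nat) : (m <= n)%N ->
  (forall k, (m < k <= n)%N -> x <= f k) ->
  (n%:R - m%:R) * x <= psum f n - psum f m.
Proof.
move=> /subnK <-; elim: (n - m)%N => [|k IHk] H.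
  by rewrite add0n !subrr mul0r.
have xf : x <= f (k + m).+1 by apply: H; rewrite addSn ltnS leq_addl leqnn.
have {}IHk : ((k + m)%:R - m%:R) * x <= psum f (k + m) - psum f m.
  by apply: IHk => j /andP[j1 j2]; apply: H; rewrite j1 addSn leqW.
rewrite addSn psumS -natr1.
by move: (psum _ _) (psum _ _) (_%:R) (_%:R) (f _) xf IHk => *; lra.
Qed.

(** What the term of index [n] in Selberg's inequality gains over the estimate
    by [|M y| <= g * y]. *)
Definition saving (g : R) (x n : nat) : R :=
  L n * (g * (x%:R / n%:R) - `|M (x %/ n)%N|).

(** At some [t] of the window [|M t| <= g0 * t / 2], and since [M] has steps at
    most 1, [|M y| <= 3 / 4 * g0 * y] for [y] from [t] to [(1 + 1 / K) * t]; the
    integers [n] with [x / n] in that range make up a positive proportion of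
    those up to [x / t], and [ln n >= ln x / 2] for them. *)
Lemma window_saving (g0 : R) : 0 < g0 ->
  exists (P : nat) (theta : R), [/\ (1 < P)%N, 0 < theta &
  forall (g : R) (X : nat), g0 <= g ->
    (forall y, (X <= y)%N -> `|M y| <= g * y%:R) ->
  exists2 a0 : nat, (0 < a0)%N /\ (X <= a0)%N & forall a x, (a0 <= a)%N ->
    (4 * (a * P) ^ 2 <= x)%N ->
    theta * x%:R * ln x%:R <=
    psum (saving g x) (x %/ a)%N - psum (saving g x) (x %/ (a * P))%N].
Proof.
move=> g00; have [D [D0 HD]] := mertens_window g00.
have [K' HK'] := archi_nat (4 / g0); pose K := K'.+1.
have HK : K%:R^-1 <= g0 / 4.
  rewrite -[g0 / 4]invrK lef_pV2 ?posrE ?invr_gt0 ?divr_gt0 ?ltr0n//.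
  by rewrite invf_div; apply: le_trans HK' _; rewrite ler_nat leqW.
exists (2 * D)%N, (g0 / (16 * K.+1%:R)); split.
- by rewrite mul2n -addnn; lia.
- by rewrite divr_gt0// mulr_gt0// ltr0n.
move=> g X gg MX; have [b Hb] := archi_nat (2 / g0).
exists (b + X + K).+1; first by split => //; lia.
move=> a x ba ax.
have [ba' Xa Ka a0] : [/\ (b <= a)%N, (X <= a)%N, (K.+1 <= a)%N & (0 < a)%N].
  by move: ba; clear; move: (X) (K) => ? ?; split; lia.
have ga : 2 / g0 <= a%:R by apply: le_trans Hb _; rewrite ler_nat.
have [t [/andP[at_ tD] Mt]] := HD a ga.
have t0 : (0 < t)%N by apply: leq_ltn_trans at_.
(* [x / n] lies between [t] and [(1 + 1 / K) * t] when [w < n <= v]. *)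
set v := (x %/ t)%N; set w := (x * K %/ (t * K.+1))%N.
have tx : (4 * t ^ 2 <= x)%N.
  apply: leq_trans ax; rewrite leq_mul2l/= leq_exp2r//.
  by move: tD; clear; nia.
have Kt : (K.+1 <= t)%N by exact: leq_trans Ka (ltnW at_).
have wlow : (x %/ (a * (2 * D)) <= w)%N.
  rewrite leq_divRL ?muln_gt0 ?t0//.
  have := leq_trunc_div x (a * (2 * D)).
  move: (x %/ (a * (2 * D)))%N => u Hu; apply: (@leq_trans (u * (2 * t * K))).
    by rewrite leq_mul2l; apply/orP; right; move: (isT : (0 < K)%N); move: (K); clear; nia.
  apply: leq_trans (leq_mul Hu (leqnn K)); rewrite [(u * (2 * t * K))%N]mulnA.
  by rewrite leq_mul2r leq_mul2l; apply/orP; right; apply/orP; right; move: tD; clear; nia.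
have wv : (w <= v)%N.
  rewrite leq_divRL// -(leq_pmul2r (isT : (0 < K)%N)).
  apply: leq_trans (leq_trunc_div (x * K) (t * K.+1)); rewrite -/w -mulnA.
  by rewrite leq_mul2l leq_mul2l leqnSn !orbT.
have va : (v <= x %/ a)%N by apply: leq_div2l => //; exact: ltnW.
have x0 : (0 < x)%N by apply: leq_trans tx; rewrite muln_gt0 expn_gt0 t0.
have nonneg k : (x %/ (a * (2 * D)) < k <= x %/ a)%N -> 0 <= saving g x k.
  move=> /andP[k0 ka]; rewrite /saving mulr_ge0 ?lnn_ge0// subr_ge0.
  have k0' : (0 < k)%N by apply: leq_ltn_trans k0.
  apply: le_trans (MX _ _) _.
    rewrite leq_divRL// mulnC; move: ka; rewrite leq_divRL//; apply: leq_trans.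
    by rewrite leq_mul2l Xa orbT.
  rewrite ler_wpM2l ?(le_trans (ltW g00))//.
  by case/andP: (@divn_real R x k k0').
have S1 := psum_interval_ge (m := v) (n := (x %/ a)%N) (f := saving g x) (x := 0) va.
have S2 := psum_interval_ge (f := saving g x) (x := 0) wlow.
rewrite !mulr0 in S1 S2.
have {}S1 : psum (saving g x) v <= psum (saving g x) (x %/ a)%N.
  rewrite -subr_ge0; apply: S1 => k /andP[k1 k2]; apply: nonneg; rewrite k2 andbT.
  by apply: leq_ltn_trans k1; apply: leq_trans wv.
have {}S2 : psum (saving g x) (x %/ (a * (2 * D)))%N <= psum (saving g x) w.
  rewrite -subr_ge0; apply: S2 => k /andP[k1 k2]; apply: nonneg; rewrite k1/=.
  by apply: leq_trans k2 _; apply: leq_trans va.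
suff S3 : g0 / (16 * K.+1%:R) * x%:R * ln x%:R <=
    psum (saving g x) v - psum (saving g x) w.
  by apply: le_trans S3 _; exact: lerB.
have xv : (x < v.+1 * t)%N by exact: ltn_ceil.
have wx : (w * (t * K.+1) <= x * K)%N by exact: leq_trunc_div.
have v4 : (4 * t <= v)%N by rewrite leq_divRL// -mulnA.
have v0 : (0 < v)%N by apply: leq_trans v4; rewrite muln_gt0.
have vw : (v <= 2 * K.+1 * (v - w))%N.
  have wK : (w * K.+1 < v.+1 * K)%N.
    rewrite -(ltn_pmul2r t0); move: xv wx; rewrite /K; move: (w) (v) (t) (x) (K').
    clear; nia.
  rewrite mulnBr leq_subRL; last by rewrite leq_mul2l wv orbT.
  move: wK v4 Kt; rewrite /K; move: (w) (v) (t) (K'); clear; nia.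
have x0R : 0 < (x%:R : R) by rewrite ltr0n.
have v0R : 0 < (v%:R : R) by rewrite ltr0n.
have lx : 0 <= ln (x%:R : R) by rewrite ln_ge0// ler1n.
have := psum_interval_ge (f := saving g x)
  (x := ln x%:R / 2 * (g0 / 4 * (x%:R / v%:R))) wv.
move=> H; apply: le_trans (H _).
  have -> : g0 / (16 * K.+1%:R) * x%:R * ln x%:R =
      (ln x%:R / 2 * (g0 / 4 * (x%:R / v%:R))) * (v%:R / (2 * K.+1%:R)).
    have K0 : 0 < (K.+1%:R : R) by rewrite ltr0n.
    by move: (ln _) (K.+1%:R : R) K0 (v%:R : R) v0R => *; field; rewrite !gt_eqF.
  rewrite mulrC ler_wpM2r//.
    by rewrite !mulr_ge0// ?divr_ge0// ?ltW// ?invr_gt0.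
  by rewrite ler_pdivrMr ?mulr_gt0 ?ltr0n// -natrB// -natrM -natrM ler_nat mulnC.
move=> n /andP[wn nv].
have n0 : (0 < n)%N by apply: leq_ltn_trans wn.
have n0R : 0 < (n%:R : R) by rewrite ltr0n.
have t0R : 0 < (t%:R : R) by rewrite ltr0n.
have tn : (t <= x %/ n)%N by rewrite leq_divRL// mulnC -leq_divRL.
have nK : (x * K < n * (t * K.+1))%N by rewrite mulnC -ltn_divLR ?muln_gt0 ?t0// mulnC.
have nx : (x <= n ^ 2)%N.
  have h1 : (x < n * (2 * t))%N by move: nK; rewrite /K; move: (n) (t) (x) (K'); clear; nia.
  rewrite leqNgt; apply/negP => h2.
  have h3 : (x * x < (n * (2 * t)) * (n * (2 * t)))%N by apply: ltn_mul.
  move: h3 h2 tx; rewrite -!mulnn; move: (n) (t) (x); clear => n t x; nia.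
have ln_n : ln x%:R / 2 <= L n.
  rewrite ler_pdivrMr// mulr_natr -lnXn// /lnn -natrX ler_ln ?posrE ?ltr0n//.
    by rewrite ler_nat.
  by rewrite expn_gt0 n0.
have Mn : `|M (x %/ n)%N| <= 3 / 4 * g0 * (x%:R / n%:R).
  have h1 := @mertens_lip R _ _ tn.
  have /andP[h2 _] := @divn_real R x n n0.
  have h3 : x%:R / n%:R <= t%:R + t%:R * K%:R^-1 :> R.
    rewrite ler_pdivrMr//.
    have -> : t%:R + t%:R * K%:R^-1 = t%:R * K.+1%:R / K%:R :> R.
      rewrite -[K.+1%:R]natr1; field; by rewrite pnatr_eq0.
    rewrite mulrAC ler_pdivlMr ?ltr0n// -!natrM ler_nat; apply: ltnW.
    by rewrite [(t * _ * n)%N]mulnC.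
  have h4 : t%:R * K%:R^-1 <= t%:R * (g0 / 4) by rewrite ler_pM2l.
  have h5 : t%:R <= x%:R / n%:R :> R by apply: le_trans h2; rewrite ler_nat.
  have h6 : 3 / 4 * g0 * t%:R <= 3 / 4 * g0 * (x%:R / n%:R).
    by rewrite ler_pM2l// mulr_gt0.
  apply: le_trans h6; have := ler_normD (M (x %/ n)%N - M t) (M t).
  rewrite subrK => h7.
  have key (m d m' T q X' i h : R) : d <= q - T -> q <= X' -> X' <= T + T * i ->
      T * i <= T * (h / 4) -> m <= d + m' -> m' <= h / 2 * T -> m <= 3 / 4 * h * T.
    by clear; intros; lra.
  exact: key h1 h2 h3 h4 h7 Mt.
rewrite /saving ler_pM//.
- by rewrite divr_ge0.
- by rewrite mulr_ge0 ?divr_ge0// ltW.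
have h1 : x%:R / v%:R <= x%:R / n%:R :> R.
  by rewrite ler_pM2l// lef_pV2 ?posrE// ler_nat.
have h2 : 0 <= x%:R / n%:R :> R by rewrite divr_ge0.
have h3 : g0 * (x%:R / n%:R) <= g * (x%:R / n%:R) by rewrite ler_wpM2r.
have h4 : g0 / 4 * (x%:R / v%:R) <= g0 / 4 * (x%:R / n%:R).
  by rewrite ler_pM2l// divr_gt0.
move: Mn h3 h4; move: `|_| (x%:R / n%:R) (x%:R / v%:R); clear; intros; lra.
Qed.

End Tauberian.

Section Mertens_little_o.
Context {R : realType}.
Local Notation L := (lnn R).
Local Notation M := (@mertens R).

Definition mertens_bound (g : R) := exists X : nat, forall y, (X <= y)%N ->
  `|M y| <= g * y%:R.

Lemma multi_window_saving (P a x : nat) (theta g : R) :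
  (forall b, (a <= b)%N -> (4 * (b * P) ^ 2 <= x)%N ->
    theta * x%:R * ln x%:R <=
    psum (saving g x) (x %/ b)%N - psum (saving g x) (x %/ (b * P))%N) ->
  (0 < P)%N -> forall J : nat, (4 * (a * P ^ J) ^ 2 <= x)%N ->
  J%:R * (theta * x%:R * ln x%:R) <=
  psum (saving g x) (x %/ a)%N - psum (saving g x) (x %/ (a * P ^ J))%N.
Proof.
move=> H P0; elim=> [|J IHJ] HJ; first by rewrite mul0r expn0 muln1 subrr.
have aJ : (a * P ^ J * P = a * P ^ J.+1)%N by rewrite expnSr mulnA.
have := H (a * P ^ J)%N; rewrite aJ leq_pmulr ?expn_gt0 ?P0// => /(_ isT HJ).
have HJ' : (4 * (a * P ^ J) ^ 2 <= x)%N.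
  apply: leq_trans HJ; rewrite leq_mul2l/= leq_exp2r// leq_mul2l leq_pexp2l ?orbT//.
have := IHJ HJ'; rewrite -natr1 mulrDl mul1r.
by move: (psum _ _) (psum _ _) (psum _ _) (_ * _ * _) (_ * _) => *; lra.
Qed.

Lemma sum_ln_div_le : exists C : R, 0 <= C /\ forall x : nat, (0 < x)%N ->
  psum (fun n => L n / n%:R) x <= ln x%:R ^+ 2 / 2 + C * (1 + ln x%:R).
Proof.
have [g Hg] := @sum_ln_div R; exists (2 + `|g|); split; first by rewrite addr_ge0.
move=> x x0; have := Hg x x%:R x0; rewrite lexx ltr_nat leqnn => /(_ erefl).
have x1 : 1 <= x%:R :> R by rewrite ler1n.
have l0 : 0 <= ln (x%:R : R) by rewrite ln_ge0.
have H1 : (1 + ln x%:R) / x%:R <= 1 + ln x%:R :> R.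
  by rewrite ler_pdivrMr ?ltr0n// ler_peMr// addr_ge0.
have H2 : psum (fun n => L n / n%:R) x <= psum (fun n => (1 + ln n%:R) / n%:R) x.
  by apply: ler_psum => n _; rewrite ler_wpM2r// lerDr.
have H3 := ler_norm g; have H4 : 0 <= `|g| * ln x%:R by rewrite mulr_ge0.
rewrite ler_norml => /andP[_ H5].
have key (s K l l2 h h' q : R) : s <= K -> K - (l + l2 / 2) - h <= q -> q <= 1 + l ->
    h <= h' -> 0 <= h' * l -> 0 <= l -> s <= l2 / 2 + (2 + h') * (1 + l).
  by clear; intros; lra.
exact: key H2 H5 H1 H3 H4 l0.
Qed.

(** Inserting the savings of about [ln x / (2 * ln P)] windows into Selberg's
    inequality improves any bound [g > g0] by an amount that depends on [g0]
    only. *)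
Lemma tauberian_step (g0 : R) : 0 < g0 -> exists2 theta : R, 0 < theta &
  forall g, g0 <= g -> mertens_bound g -> mertens_bound (g - theta).
Proof.
move=> g00; have [P [th [P1 th0 HP]]] := window_saving g00.
have [C [C0 HC]] := @mertens_selberg R.
have [G [G0 HG]] := sum_ln_div_le.
have P0 : (0 < P)%N by exact: ltnW.
have lP : 0 < ln (P%:R : R) by rewrite ln_gt0// ltr1n.
pose th2 := th / ln (P%:R : R); have th20 : 0 < th2 by rewrite divr_gt0.
exists (th2 / 2); first by rewrite divr_gt0.
move=> g gg [X HX]; have [a [a0 Xa] Ha] := HP g X gg HX.
have g_0 : 0 <= g by rewrite (le_trans _ gg)// ltW.
pose c1 := ln ((4 * a ^ 2 * P ^ 2)%:R : R).
have c10 : 0 <= c1 by rewrite ln_ge0// ler1n !muln_gt0 a0 P0.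
pose C3 := c1 * th2 + 2 * g * G + 2 * a%:R + C.
have C30 : 0 <= C3.
  have h1 : 0 <= c1 * th2 by rewrite mulr_ge0// ltW.
  have h2 : 0 <= 2 * g * G by rewrite mulr_ge0// mulr_ge0.
  have h3 : 0 <= 2 * a%:R :> R by rewrite mulr_ge0.
  by rewrite /C3 addr_ge0// addr_ge0// addr_ge0.
have [Y HY] := archi_nat (expR (1 + 4 * C3 / th2)).
exists (Y + 4 * a ^ 2)%N => x xY.
have x4 : (4 * a ^ 2 <= x)%N by apply: leq_trans xY; rewrite leq_addl.
have a20 : (0 < 4 * a ^ 2)%N by rewrite muln_gt0 expn_gt0 a0.
have x0 : (0 < x)%N by exact: leq_trans x4.
have x0R : 0 < (x%:R : R) by rewrite ltr0n.
have lx : 1 + 4 * C3 / th2 <= ln (x%:R : R).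
  rewrite -ler_expR lnK ?posrE//; apply: le_trans HY _.
  by rewrite ler_nat; apply: leq_trans xY; rewrite leq_addr.
pose n := (x %/ (4 * a ^ 2))%N.
have n0 : (0 < n)%N by rewrite divn_gt0.
have P21 : (1 < P ^ 2)%N by rewrite -(exp1n 2) ltn_exp2r.
(* the number of disjoint windows from [a] up to about the square root of [x] *)
pose J := trunc_log (P ^ 2) n.
have /andP[J1 J2] := trunc_log_bounds P21 n0; rewrite -/J in J1 J2.
have HJ : (4 * (a * P ^ J) ^ 2 <= x)%N.
  have -> : (4 * (a * P ^ J) ^ 2 = (P ^ 2) ^ J * (4 * a ^ 2))%N.
    by rewrite expnMn -!expnM [(J * 2)%N]mulnC mulnA [RHS]mulnC.
  by rewrite -leq_divRL.
have S1 := multi_window_saving (fun b ab => Ha b x ab) P0 HJ.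
have sav0 k : (0 < k <= x %/ a)%N -> 0 <= saving g x k.
  move=> /andP[k0 ka]; rewrite /saving mulr_ge0 ?lnn_ge0// subr_ge0.
  apply: le_trans (HX _ _) _.
    rewrite leq_divRL// mulnC; move: ka; rewrite leq_divRL//; apply: leq_trans.
    by rewrite leq_mul2l Xa orbT.
  by rewrite ler_wpM2l//; case/andP: (@divn_real R x k k0).
have S2 : 0 <= psum (saving g x) (x %/ (a * P ^ J))%N.
  have := psum_interval_ge (f := saving g x) (x := 0) (leq0n (x %/ (a * P ^ J))%N).
  rewrite mulr0 psum0 subr0; apply => k /andP[k0 ka]; apply: sav0; rewrite k0.
  by apply: leq_trans ka _; apply: leq_div2l => //; rewrite leq_pmulr// expn_gt0 P0.
have HJl : ln x%:R <= c1 + 2 * J%:R * ln P%:R :> R.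
  have xJ : (x < 4 * a ^ 2 * P ^ 2 * (P ^ J) ^ 2)%N.
    move: J2; rewrite ltn_divLR// => /leq_trans; apply; apply: eq_leq.
    by rewrite expnS -!expnM [(J * 2)%N]mulnC mulnC mulnA.
  have PJ0 : (0 < P ^ J)%N by rewrite expn_gt0 P0.
  have -> : c1 + 2 * J%:R * ln P%:R = ln ((4 * a ^ 2 * P ^ 2 * (P ^ J) ^ 2)%:R : R).
    have h1 : (0 < 4 * a ^ 2 * P ^ 2)%N by rewrite muln_gt0 a20 expn_gt0 P0.
    have h2 : (0 < (P ^ J) ^ 2)%N by rewrite expn_gt0 PJ0.
    rewrite natrM lnM ?posrE ?ltr0n// -/c1 -expnM natrX lnXn ?ltr0n// -[_ *+ (J * 2)]mulr_natr natrM; ring.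
  by rewrite ler_ln ?posrE ?ltr0n ?(leq_ltn_trans _ xJ)// ler_nat ltnW.
set u := (x %/ a)%N in S1.
have ux : (u <= x)%N by exact: leq_div.
set l := ln (x%:R : R) in lx HJl S1.
have l1 : 1 <= l by apply: le_trans lx; rewrite lerDl !mulr_ge0// invr_ge0 ltW.
have l0 : 0 <= l by exact: le_trans l1.
have T1 : psum (fun n => L n * `|M (x %/ n)%N|) x
    - psum (fun n => L n * `|M (x %/ n)%N|) u <= x%:R * (a%:R * l).
  have := psum_interval_ge (f := fun n => - (L n * `|M (x %/ n)%N|)) (x := - (l * a%:R)) ux.
  have psumN h k : psum (fun n => - h n) k = - psum h k :> R by rewrite /psum sumrN.
  rewrite !psumN => H.
  have {}H : (x%:R - u%:R) * - (l * a%:R) <=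
      - psum (fun n => L n * `|M (x %/ n)%N|) x + psum (fun n => L n * `|M (x %/ n)%N|) u.
    rewrite -[X in _ <= _ + X]opprK; apply: H => k /andP[uk kx].
    have k0 : (0 < k)%N by exact: leq_ltn_trans uk.
    rewrite lerN2 ler_pM ?lnn_ge0//.
      by rewrite /l /lnn ler_ln ?posrE ?ltr0n// ler_nat.
    apply: le_trans (mertens_le _) _; rewrite ler_nat -ltnS ltn_divLR//.
    by move: uk; rewrite ltn_divLR// mulnC => /leq_trans; apply; rewrite leq_mul2r leqnSn orbT.
  have H2 : 0 <= u%:R * (l * a%:R) by rewrite mulr_ge0// mulr_ge0.
  move: H H2; rewrite mulrN mulrBl [a%:R * l]mulrC.
  by move: (psum _ _) (psum _ _) (_ * _) (_ * _) => *; lra.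
have T2 : psum (fun n => L n * `|M (x %/ n)%N|) u =
    g * x%:R * psum (fun n => L n / n%:R) u - psum (saving g x) u.
  rewrite -psumZ -psumB; apply: eq_psum => k _; rewrite /saving.
  by ring.
have T3 : psum (fun n => L n / n%:R) u <= l ^+ 2 / 2 + G * (1 + l).
  apply: le_trans (HG x x0); apply: psum_le => // k k0.
  by rewrite divr_ge0 ?lnn_ge0.
have T4 := HC x x0; rewrite -/l in T4.
have T5 : C3 * (1 + l) <= th2 / 2 * l ^+ 2.
  have h1 : C3 * (1 + l) <= C3 * (2 * l) by rewrite ler_wpM2l//; lra.
  have h2 : 4 * C3 / th2 <= l by lra.
  rewrite ler_pdivrMr// in h2.
  have h3 : 4 * C3 * l <= l * th2 * l by rewrite ler_wpM2r.
  have h4 : l * th2 * l = th2 * l ^+ 2 by ring.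
  by rewrite h4 in h3; move: h1 h3; move: (l ^+ 2) => *; lra.
have T6 : g * x%:R * psum (fun n => L n / n%:R) u <=
    g * x%:R * (l ^+ 2 / 2 + G * (1 + l)) by rewrite ler_wpM2l// mulr_ge0// ltW.
have T7 : (l - c1) * (th2 * x%:R * l) <= 2 * (J%:R * (th * x%:R * l)).
  have -> : 2 * (J%:R * (th * x%:R * l)) = 2 * J%:R * ln P%:R * (th2 * x%:R * l).
    by rewrite /th2; field; rewrite gt_eqF.
  have h : 0 <= th2 * x%:R * l by rewrite mulr_ge0// ltW// mulr_gt0.
  by apply: ler_wpM2r => //; rewrite lerBlDl.
have l2 : 0 < l ^+ 2 by rewrite exprn_gt0// (lt_le_trans _ l1).
rewrite -(ler_pM2l l2).
have T8 : x%:R * (C3 * (1 + l)) <= x%:R * (th2 / 2 * l ^+ 2) by rewrite ler_pM2l.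
have T9 : 0 <= c1 * th2 * x%:R by rewrite mulr_ge0// mulr_ge0// ltW.
have T10 : 0 <= a%:R * (x%:R : R) by rewrite mulr_ge0.
have key (tt cc y h D H l2M sx su s ss X' A Jt : R) : l2M <= 2 * sx + D * X' * (1 + y) ->
    sx - su <= X' * (A * y) -> su = h * X' * s - ss -> Jt <= ss ->
    h * X' * s <= h * X' * (y ^+ 2 / 2 + H * (1 + y)) ->
    (y - cc) * (tt * X' * y) <= 2 * Jt ->
    X' * ((cc * tt + 2 * h * H + 2 * A + D) * (1 + y)) <= X' * (tt / 2 * y ^+ 2) ->
    0 <= cc * tt * X' -> 0 <= A * X' ->
    l2M <= y ^+ 2 * ((h - tt / 2) * X').
  by clear; intros; lra.
apply: key T4 T1 T2 _ T6 T7 T8 T9 T10.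
by move: S1 S2; rewrite -/l; move: (_ * (_ * _)) (psum _ _) (psum _ _) => *; lra.
Qed.

Lemma mertens_bound_all (e : R) : 0 < e -> mertens_bound e.
Proof.
move=> e0; have [th th0 Hth] := tauberian_step e0.
have le_bound (g h : R) : g <= h -> mertens_bound g -> mertens_bound h.
  move=> gh [X HX]; exists X => y /HX/le_trans; apply.
  by rewrite ler_wpM2r.
have H k : mertens_bound (Num.max e (1 - k%:R * th)).
  elim: k => [|k IHk].
    apply: (@le_bound 1); first by rewrite mul0r subr0 le_max lexx orbT.
    by exists 0%N => y _; rewrite mul1r mertens_le.
  have := Hth _ _ IHk; rewrite le_max lexx => /(_ isT); apply: le_bound.
  rewrite le_max lerBlDr ge_max -natr1 mulrDl mul1r.
  case: (leP e (1 - k%:R * th)) => ek.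
    apply/orP; right; move: ek; move: (_ * th) => ? ?; lra.
  apply/orP; left; lra.
have [k Hk] := archi_nat (th^-1); apply: le_bound (H k).
rewrite ge_max lexx/= lerBlDr; apply: (@le_trans _ _ (k%:R * th)).
  by rewrite -ler_pdivrMr// mul1r.
by rewrite lerDr ltW.
Qed.

Lemma mertens_little_o (e : R) : 0 < e ->
  exists2 C : R, 0 <= C & forall N, `|M N| <= e * N%:R + C.
Proof.
move=> e0; have [X HX] := mertens_bound_all e0; exists X%:R => // N.
case: (leqP X N) => XN; first by apply: le_trans (HX _ XN) _; rewrite lerDl.
apply: le_trans (mertens_le N) _; apply: (@le_trans _ _ X%:R).
  by rewrite ler_nat ltnW.
by rewrite lerDr mulr_ge0// ltW.
Qed.

End Mertens_little_o.

(** * The coefficients of zeta (s + 1) / zeta s *)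

(** The sequence whose sum over the divisors of [n] is [1 / n]: it turns the
    weight [1 / n] into a combination of sums over multiples. *)
Definition inv_coef (R : realType) : nat -> R :=
  conv (moebius R) (fun n => n%:R^-1).

Section Inv_coef.
Context {R : realType}.
Local Notation mu := (moebius R).
Local Notation e := (inv_coef R).

Lemma conv_inv_coef1 (n : nat) : (0 < n)%N ->
  conv e (fun=> 1) n = n%:R^-1.
Proof.
move=> n0; rewrite /inv_coef (convA _ _ _ n0).
rewrite (eq_conv n0 (f2 := mu) (g2 := conv (fun=> 1) (fun k => k%:R^-1)))//; last first.
  by move=> k k0; rewrite convC.
rewrite -(convA _ _ _ n0) (eq_conv n0 (@conv_moebius1 R) (fun _ _ => erefl)).
exact: conv_deltal.
Qed.

Lemma inv_sqr_telescope (n : nat) : (0 < n)%N ->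
  n.+1%:R^-1 ^+ 2 <= n%:R^-1 - n.+1%:R^-1 :> R.
Proof.
move=> n0; have n0R : 0 < (n%:R : R) by rewrite ltr0n.
have -> : n%:R^-1 - n.+1%:R^-1 = (n%:R * n.+1%:R)^-1 :> R.
  rewrite -natr1; move: (n%:R : R) n0R => x x0; field.
  by rewrite !gt_eqF// addr_gt0.
rewrite expr2 invfM ler_wpM2r ?invr_ge0// lef_pV2 ?posrE ?ltr0n//.
by rewrite ler_nat.
Qed.

Lemma sum_inv_sqr (N : nat) : psum (fun k => k%:R^-1 ^+ 2) N <= 2 :> R.
Proof.
case: N => [|N]; first by rewrite psum0.
apply: (@le_trans _ _ (2 - N.+1%:R^-1)); last by rewrite lerBlDr lerDl invr_ge0.
elim: N => [|N IHN]; first by rewrite psumS psum0 invr1 expr1n add0r; lra.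
rewrite psumS; apply: le_trans (lerD IHN (inv_sqr_telescope (ltn0Sn N))) _.
by rewrite addrA subrK.
Qed.

Lemma ln_little_o (h : R) : 0 < h ->
  exists2 C : R, 0 <= C & forall N : nat, ln (N%:R : R) <= h * N%:R + C.
Proof.
move=> h0; exists `|ln h|; first exact: normr_ge0.
case=> [|N]; first by rewrite ln0// addr_ge0// mulr0.
have N0 : 0 < (N.+1%:R : R) by rewrite ltr0n.
have : ln (h * N.+1%:R) <= h * N.+1%:R by rewrite ln_le_id// mulr_ge0// ltW.
have h3 : - ln h <= `|ln h| by rewrite -normrN ler_norm.
by rewrite lnM ?posrE// -lerBrDl => /le_trans; apply; rewrite lerD2l.
Qed.

(** Group the terms by the factor [1 / k]: the bounds [h * (N / k)] for the
    Mertens function at [N / k] sum to [O (h * N)], as the series of [1 / k ^ 2]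
    converges. *)
Lemma sum_inv_coef_little_o (h : R) : 0 < h ->
  exists2 C : R, 0 <= C & forall N : nat, `|psum e N| <= h * N%:R + C.
Proof.
move=> h0; have h4 : 0 < h / 4 by rewrite divr_gt0.
have [C C0 HC] := mertens_little_o h4.
have hC : 0 < h / (2 * (C + 1)) by rewrite divr_gt0// mulr_gt0// ltr_pwDr.
have [D D0 HD] := ln_little_o hC.
exists (C * (1 + D)); first by rewrite mulr_ge0// addr_ge0.
case=> [|N]; first by rewrite psum0 normr0 mulr0 add0r mulr_ge0// addr_ge0.
have -> : psum e N.+1 = psum (conv (fun k => k%:R^-1) mu) N.+1.
  by apply: eq_psum => n /andP[n0 _]; rewrite /inv_coef convC.
rewrite psum_conv; apply: le_trans (ler_norm_psum _ _) _.
apply: (@le_trans _ _ (psum (fun k => h / 4 * N.+1%:R * k%:R^-1 ^+ 2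
    + C * k%:R^-1) N.+1)).
  apply: ler_psum => k /andP[k0 _]; rewrite normrM ger0_norm ?invr_ge0//.
  rewrite mulrC; apply: (@le_trans _ _ ((h / 4 * (N.+1 %/ k)%:R + C) * k%:R^-1)).
    by rewrite ler_wpM2r ?invr_ge0// HC.
  rewrite mulrDl lerD2r.
  have -> : h / 4 * N.+1%:R * k%:R^-1 ^+ 2 = h / 4 * (N.+1%:R / k%:R) * k%:R^-1.
    by rewrite expr2 !mulrA.
  rewrite ler_wpM2r ?invr_ge0// ler_wpM2l ?(ltW h4)//.
  by case/andP: (@divn_real R N.+1 k k0).
rewrite psumD !psumZ.
have h5 := sum_inv_sqr N.+1; have h6 := @harmonic_le R N.+1 isT.
have h7 : h / 4 * N.+1%:R * psum (fun k => k%:R^-1 ^+ 2) N.+1 <= h / 4 * N.+1%:R * 2.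
  by rewrite ler_wpM2l// mulr_ge0// ltW.
have h8 : C * psum (fun n => n%:R^-1) N.+1 <= C * (1 + (h / (2 * (C + 1)) * N.+1%:R + D)).
  by rewrite ler_wpM2l//; apply: le_trans h6 _; rewrite lerD2l.
apply: le_trans (lerD h7 h8) _.
have h9 : C * (h / (2 * (C + 1)) * N.+1%:R) <= h / 2 * N.+1%:R.
  rewrite mulrA ler_wpM2r// mulrCA ler_wpM2l ?(ltW h0)//.
  rewrite ler_pdivrMr ?mulr_gt0 ?ltr_pwDr//; lra.
have -> : C * (1 + (h / (2 * (C + 1)) * N.+1%:R + D)) =
  C * (h / (2 * (C + 1)) * N.+1%:R) + C * (1 + D) by ring.
rewrite addrA lerD2r; have -> : h * N.+1%:R = h / 4 * N.+1%:R * 2 + h / 2 * N.+1%:R.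
  by field.
by rewrite lerD2l.
Qed.

Lemma sum_norm_inv_coef (N : nat) : (0 < N)%N ->
  psum (fun d => d%:R^-1 * `|e d|) N <= 2 * (1 + ln (N%:R : R)).
Proof.
move=> N0; apply: (@le_trans _ _
    (psum (fun d => d%:R^-1 * conv (fun=> 1) (fun k => k%:R^-1) d) N)).
  apply: ler_psum => d _; rewrite ler_wpM2l ?invr_ge0//.
  apply: le_trans (ler_norm_sum _ _ _) _; apply: ler_sum => k _.
  by rewrite normrM ler_pM ?ler_norm_moebius// ger0_norm// invr_ge0.
rewrite psum_conv_weight.
apply: (@le_trans _ _ (psum (fun d => 2 * d%:R^-1) N)); last first.
  by rewrite psumZ ler_wpM2l// harmonic_le.
apply: ler_psum => d _; rewrite mul1r.
have -> : psum (fun k => (d * k)%:R^-1 * k%:R^-1) (N %/ d) =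
    d%:R^-1 * psum (fun k => k%:R^-1 ^+ 2) (N %/ d) :> R.
  by rewrite -psumZ; apply: eq_psum => k _; rewrite natrM invfM expr2 mulrA.
by rewrite mulrC ler_wpM2r ?invr_ge0// sum_inv_sqr.
Qed.

Lemma sum_inv_sqr_tail (J N : nat) : (0 < J <= N)%N ->
  psum (fun k => k%:R^-1 ^+ 2) N - psum (fun k => k%:R^-1 ^+ 2) J <= J%:R^-1 :> R.
Proof.
move=> /andP[J0 /subnK <-].
apply: (@le_trans _ _ (J%:R^-1 - (N - J + J)%:R^-1)); last first.
  by rewrite lerBlDr lerDl invr_ge0.
elim: (N - J)%N => [|k IHk]; first by rewrite add0n !subrr.
have n0 : (0 < k + J)%N by rewrite addn_gt0 J0 orbT.
rewrite addSn psumS addrAC; apply: le_trans (lerD IHk (inv_sqr_telescope n0)) _.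
by rewrite addrA subrK.
Qed.

(** The truncation to [d * j <= N] is exact, and the tails it leaves out are
    [O(1 / (d * N))], which is summable against [inv_coef] up to [ln N]. *)
Lemma dirichlet_inv (Psi G : nat -> R) (K A : R) :
  (forall n, (0 < n)%N -> 0 <= Psi n <= K * n%:R^-1 ^+ 2) ->
  (forall d, (0 < d)%N ->
    psum (fun j => Psi (d * j)%N) n @[n --> \oo] --> G d) ->
  psum (fun n => Psi n * n%:R^-1) n @[n --> \oo] --> A ->
  psum (fun d => e d * G d) n @[n --> \oo] --> A.
Proof.
move=> HPsi HG HA.
have K0 : 0 <= K.
  by have /andP[h1 h2] := HPsi 1%N isT; move: (le_trans h1 h2); rewrite invr1 expr1n mulr1.
have tail d N : (0 < d <= N)%N ->
    0 <= G d - psum (fun j => Psi (d * j)%N) (N %/ d)%N <= 2 * K / N%:R * d%:R^-1.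
  move=> /andP[d0 dN].
  have J0 : (0 < N %/ d)%N by rewrite divn_gt0.
  set J := (N %/ d)%N in J0 *.
  have HGd := HG d d0.
  have pos j : (0 < j)%N -> 0 <= Psi (d * j)%N.
    move=> j0; have dj0 : (0 < d * j)%N by rewrite muln_gt0 d0.
    by case/andP: (HPsi _ dj0).
  have JN : J%:R^-1 <= 2 * d%:R / N%:R :> R.
    have N0 : (0 < N)%N by exact: leq_trans dN.
    rewrite ler_pdivlMr ?ltr0n// ler_pdivrMl ?ltr0n//.
    have := ltn_ceil N d0; rewrite -/J => h.
    rewrite -!natrM ler_nat; apply: (leq_trans (ltnW h)); nia.
  apply/andP; split.
    rewrite subr_ge0 -(cvg_lim (@norm_hausdorff _ _) HGd).
    apply: limr_ge; first exact: cvgP HGd.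
    near=> n; apply: psum_le => //.
    by near: n; exact: nbhs_infty_ge.
  rewrite lerBlDr -[G d](cvg_lim (@norm_hausdorff _ _) HGd).
  apply: limr_le; first exact: cvgP HGd.
  near=> n.
  have Jn : (0 < J <= n)%N by rewrite J0/=; near: n; exact: nbhs_infty_ge.
  rewrite -lerBlDr; apply: (@le_trans _ _ (K * d%:R^-1 ^+ 2 *
      (psum (fun k => k%:R^-1 ^+ 2) n - psum (fun k => k%:R^-1 ^+ 2) J))).
    have := psum_interval_ge (m := J) (n := n) (x := 0)
      (f := fun k => K * d%:R^-1 ^+ 2 * k%:R^-1 ^+ 2 - Psi (d * k)%N).
    rewrite mulr0 !psumB !psumZ => H.
    have key (c Sn SJ Pn PJ : R) : 0 <= c * Sn - Pn - (c * SJ - PJ) ->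
        Pn - PJ <= c * (Sn - SJ) by clear; intros; lra.
    apply: key; apply: H => [|k /andP[Jk _]]; first by case/andP: Jn.
    have k0 : (0 < k)%N by exact: leq_ltn_trans Jk.
    have dk0 : (0 < d * k)%N by rewrite muln_gt0 d0.
    rewrite subr_ge0; case/andP: (HPsi _ dk0) => _ /le_trans; apply.
    by rewrite natrM invfM exprMn mulrA.
  apply: (@le_trans _ _ (K * d%:R^-1 ^+ 2 * (2 * d%:R / N%:R))).
    rewrite ler_wpM2l ?mulr_ge0 ?sqr_ge0//.
    by apply: le_trans JN; exact: sum_inv_sqr_tail.
  have -> : K * d%:R^-1 ^+ 2 * (2 * d%:R / N%:R) = 2 * K / N%:R * d%:R^-1.
    have := d0; rewrite -(ltr0n R); move: (d%:R : R) (N%:R^-1) => x y x0.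
    by field; rewrite gt_eqF.
  by [].
pose r N := psum (fun d => e d * G d) N - psum (fun n => Psi n * n%:R^-1) N.
suff r0 : r n @[n --> \oo] --> 0.
  have -> : (fun n => psum (fun d => e d * G d) n) =
      (fun n => r n + psum (fun k => Psi k * k%:R^-1) n).
    by apply/funext => n; rewrite /r subrK.
  by rewrite -[A]add0r; exact: cvgD.
have rE N : `|r N| <= 2 * K / N%:R * (2 * (1 + ln N%:R)).
  case: (posnP N) => [->|N0].
    by rewrite /r !psum0 subrr normr0 invr0 mulr0 mul0r.
  have -> : r N = psum (fun d => e d * (G d - psum (fun j => Psi (d * j)%N) (N %/ d)%N)) N.
    rewrite /r (@eq_psum _ (fun n => Psi n * n%:R^-1) (fun n => Psi n * conv e (fun=> 1) n)).
      rewrite psum_conv_weight -psumB; apply: eq_psum => d _; rewrite mulrBr; congr (_ - _ * _).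
      by apply: eq_psum => k _; rewrite mulr1.
    by move=> n /andP[n0 _]; rewrite conv_inv_coef1.
  apply: le_trans (ler_norm_psum _ _) _.
  apply: (@le_trans _ _ (psum (fun d => 2 * K / N%:R * (d%:R^-1 * `|e d|)) N)).
    apply: ler_psum => d dN; have /andP[t1 t2] := tail d N dN.
    by rewrite normrM mulrC (ger0_norm t1) mulrA ler_wpM2r.
  rewrite psumZ ler_wpM2l ?sum_norm_inv_coef//.
  by rewrite divr_ge0// mulr_ge0.
apply/cvgr0Pnorm_le => eps eps0.
have h0 : 0 < eps / (8 * (K + 1)) by rewrite divr_gt0// mulr_gt0// ltr_pwDr.
have [C C0 HC] := ln_little_o h0.
have [N1 HN1] := archi_nat ((1 + C) / (eps / (8 * (K + 1)))).
near=> N; apply: le_trans (rE N) _.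
have N0 : (0 < N)%N by near: N; exact: nbhs_infty_gt.
have N0R : 0 < (N%:R : R) by rewrite ltr0n.
have h1 : 1 + C <= eps / (8 * (K + 1)) * N%:R.
  rewrite mulrC -ler_pdivrMr//; apply: le_trans HN1 _; rewrite ler_nat.
  by near: N; exact: nbhs_infty_ge.
have h2 : 1 + ln N%:R <= 2 * (eps / (8 * (K + 1)) * N%:R) :> R.
  by have := HC N; move: h1; move: (_ * N%:R) (ln _) => *; lra.
apply: (@le_trans _ _ (2 * K / N%:R * (2 * (2 * (eps / (8 * (K + 1)) * N%:R))))).
  by rewrite ler_wpM2l ?ler_wpM2l// divr_ge0// mulr_ge0.
have -> : 2 * K / N%:R * (2 * (2 * (eps / (8 * (K + 1)) * N%:R))) = eps * (K / (K + 1)).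
  by field; rewrite !gt_eqF// ltr_pwDr.
rewrite ler_piMr ?(ltW eps0)// ler_pdivrMr ?ltr_pwDr//.
by rewrite mul1r lerDl.
Unshelve. all: by end_near.
Qed.

(** Abel summation: against a nonincreasing [f] the coefficients act as a
    density that is arbitrarily small. *)
Lemma abel_inv_coef (h C : R) (f : nat -> R) (N : nat) :
  (forall n, `|psum e n| <= h * n%:R + C) ->
  (forall n, (0 < n)%N -> f n.+1 <= f n) -> 0 <= f N.+1 ->
  `|psum (fun d => e d * f d) N| <= h * psum f N + C * f 1%N.
Proof.
move=> He fd f0; rewrite abel_psum; apply: le_trans (ler_normD _ _) _.
have -> : h * psum f N + C * f 1%N =
    psum (fun n => (h * n%:R + C) * (f n - f n.+1)) N + (h * N%:R + C) * f N.+1.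
  elim: N {f0} => [|N IHN]; first by rewrite !psum0 !mulr0 !add0r.
  by rewrite !psumS mulrDr addrAC IHN -!natr1; ring.
apply: lerD.
  apply: le_trans (ler_norm_psum _ _) _; apply: ler_psum => n /andP[n0 _].
  by rewrite normrM ler_pM// ger0_norm// subr_ge0 fd.
by rewrite normrM ler_pM// ger0_norm.
Qed.

End Inv_coef.

(** * Monotone kernels *)

Section Hyperbolic.
Context {R : realType}.
Implicit Types (s t u v w : R).

Definition sh s := (expR s - expR (- s)) / 2.
Definition ch s := (expR s + expR (- s)) / 2.

Lemma le_of_derive_ge0 (f df : R -> R) (x : R) :
  (forall y : R, is_derive y 1 f (df y)) -> (forall y : R, 0 <= y -> 0 <= df y) ->
  0 <= x -> f 0 <= f x.
Proof.
move=> fd df0; rewrite le_eqVlt => /orP[/eqP <-//|x0].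
have cf : {within `[0, x], continuous f}.
  by apply: derivable_within_continuous => y _; have [] := fd y.
have [c /itvP cx E] := MVT x0 (fun y _ => fd y) cf.
have c0 : 0 <= c by rewrite ltW// cx.
by rewrite -subr_ge0 E subr0 mulr_ge0 ?df0// ltW.
Qed.

Lemma sh0 : sh 0 = 0. Proof. by rewrite /sh oppr0 subrr mul0r. Qed.

Lemma is_derive_expN s : is_derive s 1 (fun x : R => expR (- x)) (- expR (- s)).
Proof.
have h : is_derive s 1 (expR \o (fun x : R => - x)) (expR (- s) * -1).
  exact: is_derive1_comp.
by rewrite mulrN1 in h.
Qed.

Lemma is_derive_sh s : is_derive s 1 sh (ch s).
Proof.
have h := is_derive_expN s; rewrite /sh; apply: is_derive_eq.
by rewrite /ch /GRing.scale/=; field.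
Qed.

Lemma is_derive_ch s : is_derive s 1 ch (sh s).
Proof.
have h := is_derive_expN s; rewrite /ch; apply: is_derive_eq.
by rewrite /sh /GRing.scale/=; field.
Qed.

Lemma ch_ge1 s : 1 <= ch s.
Proof. by rewrite /ch; have := expR_ge1Dx s; have := expR_ge1Dx (- s); lra. Qed.

Lemma ch_gt0 s : 0 < ch s. Proof. exact: lt_le_trans (ch_ge1 s). Qed.

Lemma sh_ge_id s : 0 <= s -> s <= sh s.
Proof.
move=> s0; have := @le_of_derive_ge0 (fun x => sh x - x) (fun x => ch x - 1) s.
rewrite sh0 subrr subr_ge0; apply => // [y|y _]; last by rewrite subr_ge0 ch_ge1.
by have h := is_derive_sh y; apply: is_derive_eq.
Qed.

Lemma sh_ge0 s : 0 <= s -> 0 <= sh s.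
Proof. by move=> s0; apply: le_trans (sh_ge_id s0). Qed.

Lemma sh_gt0 s : 0 < s -> 0 < sh s.
Proof. by move=> s0; apply: lt_le_trans (sh_ge_id (ltW s0)). Qed.

Lemma sh_le_ch s : 0 <= s -> sh s <= s * ch s.
Proof.
move=> s0; have := @le_of_derive_ge0 (fun x => x * ch x - sh x) (fun x => x * sh x) s.
rewrite sh0 mul0r subrr subr_ge0; apply => // [y|y y0]; last first.
  by rewrite mulr_ge0 ?sh_ge0.
have h := is_derive_sh y; have h' := is_derive_ch y; apply: is_derive_eq.
by rewrite /GRing.scale/=; ring.
Qed.

Lemma shD s t : sh (s + t) = sh s * ch t + ch s * sh t.
Proof. by rewrite /sh /ch opprD !expRD; field. Qed.

Lemma chD s t : ch (s + t) = ch s * ch t + sh s * sh t.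
Proof. by rewrite /sh /ch opprD !expRD; field. Qed.

Lemma shN s : sh (- s) = - sh s. Proof. by rewrite /sh opprK; field. Qed.
Lemma chN s : ch (- s) = ch s. Proof. by rewrite /ch opprK addrC. Qed.

Lemma ch_sqr s : ch s ^+ 2 = 1 + sh s ^+ 2.
Proof.
have : expR s * expR (- s) = 1 by rewrite -expRD subrr expR0.
rewrite /ch /sh; move: (expR s) (expR (- s)) => x y xy.
have -> : ((x + y) / 2) ^+ 2 = x * y + ((x - y) / 2) ^+ 2 by field.
by rewrite xy.
Qed.

Lemma ch_le s t : 0 <= s -> s <= t -> ch s <= ch t.
Proof.
move=> s0 st; rewrite -(subrK s t) chD.
have h0 : 0 <= t - s by rewrite subr_ge0.
have h1 : ch s <= ch (t - s) * ch s by rewrite ler_peMl ?ch_ge1// ltW// ch_gt0.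
by apply: le_trans h1 _; rewrite lerDl mulr_ge0// sh_ge0.
Qed.

(** [sh] is convex and vanishes at [0], so its slope from the origin increases. *)
Lemma sh_div_le u v : 0 <= u -> u <= v -> v * sh u <= u * sh v.
Proof.
move=> u0 uv; have w0 : 0 <= v - u by rewrite subr_ge0.
have h1 : sh u + (v - u) * ch u <= sh v.
  rewrite -[in leRHS](subrK u v) addrC [in leRHS]addrC shD.
  have h2 : sh u <= sh u * ch (v - u) by rewrite ler_peMr ?ch_ge1// sh_ge0.
  have h3 : (v - u) * ch u <= ch u * sh (v - u).
    by rewrite mulrC ler_wpM2l ?sh_ge_id// ltW// ch_gt0.
  by rewrite addrC lerD.
have h2 := ler_wpM2l u0 h1.
have h3 := ler_wpM2l w0 (sh_le_ch u0).
by move: h2 h3; move: (sh u) (sh v) (ch u) => *; lra.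
Qed.

(** The addition formulas reduce this to [sh_div_le] at [t - s] and [t + s]. *)
Lemma th_div_le s t : 0 < s -> s <= t ->
  sh t / ch t / t <= sh s / ch s / s.
Proof.
move=> s0 st; have t0 : 0 < t by exact: lt_le_trans st.
have cs := ch_gt0 s; have ct := ch_gt0 t.
have E x : sh x / ch x / x = sh x / (ch x * x) by rewrite (invfM (ch x)) mulrA.
have ps : 0 < ch s * s by rewrite mulr_gt0.
have pt : 0 < ch t * t by rewrite mulr_gt0.
rewrite !E (ler_pdivrMr _ _ pt) mulrAC (ler_pdivlMr _ _ ps).
have := @sh_div_le (t - s) (t + s); rewrite subr_ge0 => /(_ st).
have -> : t - s <= t + s by lra.
move=> /(_ isT); rewrite !shD shN chN.
by move: (sh s) (sh t) (ch s) (ch t) => *; lra.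
Qed.

(** An increase of [f] from [s] to [t] is at most a quarter of the one from
    [s / 2] to [t / 2], as [k] does not increase; halving the arguments again and
    again would make a positive increase exceed the bound 1. This avoids the
    derivatives of the kernels below. *)
Lemma duplication_nonincreasing (f k : R -> R) :
  (forall s, 0 < s -> f (2 * s) = (f s + k s) / 4) ->
  (forall s t, 0 < s -> s <= t -> k t <= k s) ->
  (forall s, 0 < s -> 0 <= f s <= 1) ->
  forall s t, 0 < s -> s <= t -> f t <= f s.
Proof.
move=> fk kd f01.
have H n : forall s t, 0 < s -> s <= t -> (f t - f s) * n%:R <= 1.
  elim: n => [|n IHn] s t s0 st; first by rewrite mulr0.
  have s20 : 0 < s / 2 by rewrite divr_gt0.
  have st2 : s / 2 <= t / 2 by rewrite ler_pM2r// invr_gt0.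
  have t20 : 0 < t / 2 by exact: lt_le_trans st2.
  have t0 : 0 < t by exact: lt_le_trans st.
  have E (x : R) : x = 2 * (x / 2) by field.
  have h1 := IHn _ _ s20 st2; have h2 := kd _ _ s20 st2.
  case: (leP (f t) (f s)) => fts.
    by apply: (@le_trans _ _ 0) => //; rewrite mulr_le0_ge0// subr_le0.
  have h3 : f t - f s <= (f (t / 2) - f (s / 2)) / 4.
    rewrite {1}(E t) {1}(E s) !fk//; lra.
  case: n IHn h1 => [|n] _ h1.
    rewrite mulr1; have /andP[] := f01 t t0; have /andP[] := f01 s s0; lra.
  have h4 : (f t - f s) * n.+2%:R <= (f (t / 2) - f (s / 2)) / 4 * n.+2%:R.
    by rewrite ler_wpM2r.
  apply: le_trans h4 _; have h5 : n.+2%:R <= 4 * n.+1%:R :> R.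
    by rewrite -natrM ler_nat; move: (n); clear; lia.
  have h6 : 0 <= f (t / 2) - f (s / 2) by lra.
  have h7 := ler_wpM2l h6 h5.
  by move: h1 h7; move: (f _ - _) (n.+2%:R) (n.+1%:R) => *; lra.
move=> s t s0 st; rewrite leNgt; apply/negP => fst.
have d0 : 0 < f t - f s by rewrite subr_gt0.
have [n Hn] := archi_nat (2 / (f t - f s)).
have := H n s t s0 st; rewrite ler_pdivrMr// mulrC in Hn.
by move: Hn; move: (_ * _) => *; lra.
Qed.

(** The kernel left when the pole [1 / s ^ 2] is removed from [1 / sh s ^ 2]. *)
Definition csch_kernel s := s^-1 ^+ 2 - (sh s)^-1 ^+ 2.

Lemma csch_kernel_ge0 s : 0 < s -> 0 <= csch_kernel s.
Proof.
move=> s0; have s0' := ltW s0; rewrite subr_ge0 lerXn2r ?nnegrE ?invr_ge0 ?sh_ge0//.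
by rewrite lef_pV2 ?posrE ?sh_gt0// sh_ge_id.
Qed.

Lemma csch_kernel_le s : 0 < s -> csch_kernel s <= s^-1 ^+ 2.
Proof. by move=> s0; rewrite /csch_kernel lerBlDr lerDl sqr_ge0. Qed.

Lemma csch_kernel_le1 s : 0 < s -> csch_kernel s <= 1.
Proof.
move=> s0; have h := sh_gt0 s0.
have -> : csch_kernel s = (sh s ^+ 2 - s ^+ 2) / (s ^+ 2 * sh s ^+ 2).
  by rewrite /csch_kernel; field; rewrite !gt_eqF.
have d0 : 0 < s ^+ 2 * sh s ^+ 2 by apply: mulr_gt0; exact: exprn_gt0.
rewrite (ler_pdivrMr _ _ d0) mul1r.
have : sh s ^+ 2 <= (s * ch s) ^+ 2.
  have s0' := ltW s0; have c0 := ltW (ch_gt0 s).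
  by rewrite lerXn2r ?nnegrE ?sh_ge0 ?sh_le_ch// mulr_ge0.
rewrite (exprMn _ s) ch_sqr; move: (sh s ^+ 2) (s ^+ 2) => *; lra.
Qed.

Lemma csch_kernel_nonincreasing s t : 0 < s -> s <= t ->
  csch_kernel t <= csch_kernel s.
Proof.
move: s t; apply: (@duplication_nonincreasing _ (fun s => (ch s)^-1 ^+ 2)).
- move=> s s0; rewrite /csch_kernel mulr_natl mulr2n shD.
  have cE : (ch s)^-1 ^+ 2 = (1 + sh s ^+ 2)^-1 by rewrite exprVn ch_sqr.
  have h := sh_gt0 s0; have c0 := ch_gt0 s.
  rewrite cE; have -> : (sh s * ch s + ch s * sh s)^-1 ^+ 2 =
      (4 * sh s ^+ 2 * (1 + sh s ^+ 2))^-1.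
    rewrite -ch_sqr; move: (sh s) (ch s) h c0 => x y x0 y0.
    have -> : x * y + y * x = 2 * x * y by ring.
    by field; rewrite !gt_eqF.
  have h1 : 0 < 1 + sh s ^+ 2 by rewrite -ch_sqr exprn_gt0.
  have -> : s + s = 2 * s by ring.
  by move: (sh s) h h1 => x x0 x1; field; rewrite !gt_eqF.
- move=> s t s0 st; have t0 := lt_le_trans s0 st.
  rewrite lerXn2r ?nnegrE ?invr_ge0 ?(ltW (ch_gt0 _))// lef_pV2 ?posrE ?ch_gt0//.
  by rewrite ch_le// ltW.
- by move=> s s0; rewrite csch_kernel_ge0// csch_kernel_le1.
Qed.

(** What remains of [coth s] without its pole [1 / s] increases; its quotient by
    [s] does not. *)
Definition coth_kernel s := (ch s / sh s - s^-1) / s.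

Lemma coth_kernel_bounds s : 0 < s -> 0 <= coth_kernel s <= 1.
Proof.
move=> s0; have h := sh_gt0 s0.
have -> : coth_kernel s = (s * ch s - sh s) / (s ^+ 2 * sh s).
  by rewrite /coth_kernel; field; rewrite !gt_eqF.
have d0 : 0 < s ^+ 2 * sh s by rewrite mulr_gt0// exprn_gt0.
rewrite divr_ge0 ?subr_ge0 ?sh_le_ch ?(ltW s0) ?(ltW d0)//= ler_pdivrMr// mul1r.
have s20 : 0 < s / 2 by rewrite divr_gt0.
have E : s = s / 2 + s / 2 by field.
(* [ch s - 1 = 2 * sh (s / 2) ^ 2] is at most [s * sh s / 2] *)
have h1 : ch s - 1 <= s * sh s.
  rewrite [in ch s]E [in sh s]E shD chD -!expr2 ch_sqr.
  have h2 := sh_le_ch (ltW s20); have h3 := sh_gt0 s20.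
  have h4 := ler_wpM2l (ltW h3) h2.
  have h5 : 0 <= s * (sh (s / 2) * ch (s / 2)).
    have c0 := ltW (ch_gt0 (s / 2)).
    by apply: mulr_ge0; [exact: ltW | apply: mulr_ge0 => //; exact: ltW].
  move: h4 h5; move: (sh _) (ch _) => x y h4 h5.
  have -> : 1 + x ^+ 2 + x ^+ 2 - 1 = 2 * (x * x) by ring.
  have -> : s * (x * y + y * x) = 2 * (s * (x * y)) by ring.
  have E2 : x * (s / 2 * y) = s * (x * y) / 2 by field.
  rewrite E2 in h4.
  lra.
have h2 := ler_wpM2l (ltW s0) h1.
have := sh_ge_id (ltW s0); move: h2; move: (sh s) (ch s) => *; lra.
Qed.

Lemma coth_kernel_nonincreasing s t : 0 < s -> s <= t ->
  coth_kernel t <= coth_kernel s.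
Proof.
move: s t; apply: (@duplication_nonincreasing _ (fun s => sh s / ch s / s)).
- move=> s s0; rewrite /coth_kernel mulr_natl mulr2n shD chD.
  have h := sh_gt0 s0; have c0 := ch_gt0 s.
  have -> : s + s = 2 * s by ring.
  move: (sh s) (ch s) h c0 => x y x0 y0.
  have -> : x * y + y * x = 2 * x * y by ring.
  by field; rewrite !gt_eqF.
- exact: th_div_le.
- exact: coth_kernel_bounds.
Qed.

Definition sh_kernel s := (s / sh s) ^+ 2.

Lemma sh_kernel_ge0 s : 0 <= sh_kernel s. Proof. exact: sqr_ge0. Qed.

Lemma sh_kernel_nonincreasing s t : 0 < s -> s <= t ->
  sh_kernel t <= sh_kernel s.
Proof.
move=> s0 st; have t0 := lt_le_trans s0 st.
have s0' := ltW s0; have t0' := ltW t0.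
have h : t / sh t <= s / sh s.
  rewrite (ler_pdivrMr _ _ (sh_gt0 t0)) mulrAC (ler_pdivlMr _ _ (sh_gt0 s0)).
  exact: sh_div_le.
by apply: lerXn2r => //; rewrite nnegrE divr_ge0 ?sh_ge0.
Qed.

Lemma sh_ge_sqr s : 0 <= s -> s ^+ 2 / 2 <= sh s.
Proof.
move=> s0; have s20 : 0 <= s / 2 by rewrite divr_ge0.
have E : s = s / 2 + s / 2 by field.
rewrite [in sh s]E shD; have h1 := sh_ge_id s20.
have h2 : s / 2 <= ch (s / 2).
  have := ch_sqr (s / 2); have := ch_gt0 (s / 2); move: h1.
  move: (sh _) (ch _) => x y h1 y0 h2; nra.
have h3 := ler_pM s20 s20 h1 h2.
move: h3; have -> : s / 2 * (s / 2) = s ^+ 2 / 4 by field.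
move: (sh _) (ch _) (s ^+ 2) => *; lra.
Qed.

Lemma sh_kernel_le s : 0 < s -> sh_kernel s <= 25 * (1 + 2 * s)^-1 ^+ 2.
Proof.
move=> s0; have h := sh_gt0 s0.
rewrite /sh_kernel -[25](_ : 5 ^+ 2 = _); last by ring.
have d0 : 0 < 1 + 2 * s by lra.
rewrite -exprMn; have s0' := ltW s0; have h' := ltW h; have d0' := ltW d0.
have h3 : s / sh s <= 5 * (1 + 2 * s)^-1.
  rewrite (ler_pdivrMr _ _ h) mulrAC (ler_pdivlMr _ _ d0).
  have := sh_ge_id (ltW s0); have := sh_ge_sqr (ltW s0).
  have -> : s ^+ 2 = s * s by [].
  by move: (sh s) => *; lra.
by apply: lerXn2r => //; rewrite nnegrE divr_ge0.
Qed.

Lemma csch_kernel_decay s : 0 < s -> csch_kernel s <= 16 * (1 + 2 * s)^-1 ^+ 2.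
Proof.
move=> s0; have d0 : 0 < 1 + 2 * s by lra.
have d20 : 0 < (1 + 2 * s) ^+ 2 by rewrite exprn_gt0.
rewrite exprVn ler_pdivlMr//; case: (leP s 1) => s1.
  apply: (@le_trans _ _ (1 * (1 + 2 * s) ^+ 2)).
    by rewrite ler_wpM2r ?csch_kernel_le1// ltW.
  rewrite mul1r expr2; nra.
apply: (@le_trans _ _ (s^-1 ^+ 2 * (1 + 2 * s) ^+ 2)).
  by rewrite ler_wpM2r ?csch_kernel_le// ltW.
rewrite exprVn mulrC ler_pdivrMr ?exprn_gt0// !expr2; nra.
Qed.

Lemma sum_inv_sqr_affine (a : R) (N : nat) : 0 < a ->
  psum (fun d => (1 + d%:R * a)^-1 ^+ 2) N <= a^-1.
Proof.
move=> a0; apply: (@le_trans _ _ (a^-1 - a^-1 * (1 + N%:R * a)^-1)); last first.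
  by rewrite lerBlDr lerDl mulr_ge0 ?invr_ge0 ?addr_ge0 ?mulr_ge0// ltW.
elim: N => [|N IHN]; first by rewrite psum0 mul0r addr0 invr1 mulr1 subrr.
rewrite psumS.
have x0 : 0 < 1 + N%:R * a by rewrite ltr_pwDl// mulr_ge0// ltW.
have y0 : 0 < 1 + N.+1%:R * a by rewrite ltr_pwDl// mulr_ge0// ltW.
have step : (1 + N.+1%:R * a)^-1 ^+ 2 <=
    a^-1 * (1 + N%:R * a)^-1 - a^-1 * (1 + N.+1%:R * a)^-1.
  have -> : a^-1 * (1 + N%:R * a)^-1 - a^-1 * (1 + N.+1%:R * a)^-1 =
      (1 + N.+1%:R * a)^-1 * (1 + N%:R * a)^-1.
    by move: x0 y0; rewrite -natr1; move: (N%:R : R) => x *; field; rewrite !gt_eqF.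
  rewrite expr2 ler_wpM2l ?invr_ge0 ?(ltW y0)// lef_pV2 ?posrE//.
  by rewrite lerD2l ler_wpM2r ?(ltW a0)// ler_nat.
by apply: le_trans (lerD IHN step) _; rewrite addrA subrK.
Qed.

End Hyperbolic.

(** * Estimate of the lattice sum *)

Section Lattice_sum.
Context {R : realType}.
Local Notation e := (inv_coef R).
Implicit Types (a b : R).

Lemma psum_series (f : nat -> R) (n : nat) :
  psum f n = series (fun k => f k.+1) n.
Proof. by rewrite /psum big_add1. Qed.

Lemma zeta_cvg (m : nat) : (2 <= m)%N ->
  psum (fun k => k%:R^-1 ^+ m) n @[n --> \oo] --> zeta (m%:R : R).
Proof.
move=> m2; have -> : zeta (m%:R : R) = limn (psum (fun k => k%:R^-1 ^+ m)).
  congr (limn _); apply/funext => n; rewrite psum_series /series/=.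
  by apply: eq_bigr => k _; rewrite powRN powR_mulrn// exprVn.
apply: nondecreasing_is_cvgn.
  by apply/nondecreasing_seqP => n; rewrite psumS lerDl exprn_ge0// invr_ge0.
exists 2 => _ [n _ <-]; apply: le_trans (sum_inv_sqr n).
apply: ler_psum => k /andP[k0 _]; apply: ler_wiXn2l => //.
by rewrite invf_le1 ?ltr0n// ler1n.
Qed.

Lemma zeta_gt0 (m : nat) : (2 <= m)%N -> 0 < zeta (m%:R : R).
Proof.
move=> m2; have h := zeta_cvg m2.
apply: (@lt_le_trans _ _ 1) => //.
rewrite -(cvg_lim (@norm_hausdorff _ _) h); apply: limr_ge; first exact: cvgP h.
near=> n; have n0 : (0 < n)%N by near: n; exact: nbhs_infty_gt.
have := @psum_le R (fun k => k%:R^-1 ^+ m) 1 n; rewrite psumS psum0 invr1 expr1n add0r.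
by apply=> // k _; rewrite exprn_ge0// invr_ge0.
Unshelve. all: by end_near.
Qed.

Lemma inv_coef_zeta :
  psum (fun d => e d * d%:R^-1 ^+ 2) n @[n --> \oo] --> zeta (3 : R) / zeta 2.
Proof.
have h := @zeta_gt0 2 isT.
have := @dirichlet_inv R (fun n => n%:R^-1 ^+ 2) (fun d => d%:R^-1 ^+ 2 * zeta 2) 1 (zeta 3).
move=> H.
have -> : (fun n => psum (fun d => e d * d%:R^-1 ^+ 2) n) =
    (fun n => psum (fun d => e d * (d%:R^-1 ^+ 2 * zeta 2)) n * (zeta 2)^-1).
  apply/funext => n; rewrite -psumZr; apply: eq_psum => d _.
  by rewrite [e d * (_ * zeta 2)]mulrA mulfK// gt_eqF.
apply: cvgMl; apply: H.
- by move=> n n0; rewrite mul1r lexx sqr_ge0.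
- move=> d d0; under eq_fun do under eq_psum do rewrite natrM invfM exprMn.
  under eq_fun do rewrite psumZ.
  by apply: cvgMr; exact: (@zeta_cvg 2).
- under eq_fun do under eq_psum do rewrite -exprSr.
  exact: (@zeta_cvg 3).
Qed.

(** The sums of [i * expR (- a) ^+ i] and of [expR (- b) ^+ k] over the natural
    numbers, the two factors of a sum over the lattice. *)
Definition pker a := expR (- a) / (1 - expR (- a)) ^+ 2.
Definition qker b := (1 - expR (- b))^-1.

Lemma expRN_lt1 a : 0 < a -> 0 < 1 - expR (- a).
Proof. by move=> a0; rewrite subr_gt0 expR_lt1 oppr_lt0. Qed.

Lemma one_sub_expRN a : 1 - expR (- a) = 2 * expR (- (a / 2)) * sh (a / 2).
Proof.
have -> : 2 * expR (- (a / 2)) * sh (a / 2) =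
    expR (- (a / 2)) * expR (a / 2) - expR (- (a / 2)) * expR (- (a / 2)).
  by rewrite /sh; field.
by rewrite -!expRD addNr expR0; congr (1 - expR _); field.
Qed.

Lemma pker_sh a : 0 < a -> pker a = (sh (a / 2))^-1 ^+ 2 / 4.
Proof.
move=> a0; have h := expRN_lt1 a0.
have s0 : 0 < sh (a / 2) by rewrite sh_gt0// divr_gt0.
have E := one_sub_expRN a.
have E2 : expR (- a) = expR (- (a / 2)) ^+ 2.
  by rewrite expr2 -expRD; congr expR; field.
rewrite /pker E E2; have := expR_gt0 (- (a / 2)).
by move: (expR _) (sh _) s0 => x s *; field; rewrite !gt_eqF.
Qed.

Lemma qker_coth b : 0 < b -> qker b = (1 + ch (b / 2) / sh (b / 2)) / 2.
Proof.
move=> b0; have h := expRN_lt1 b0.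
have s0 : 0 < sh (b / 2) by rewrite sh_gt0// divr_gt0.
have E := one_sub_expRN b.
have E2 : sh (b / 2) + ch (b / 2) = expR (b / 2) by rewrite /sh /ch; field.
have -> : (1 + ch (b / 2) / sh (b / 2)) / 2 = expR (b / 2) / (2 * sh (b / 2)).
  by rewrite -E2; move: (ch _) (sh _) s0 => *; field; rewrite gt_eqF.
have -> : expR (b / 2) = (expR (- (b / 2)))^-1 by rewrite expRN invrK.
rewrite /qker E; have := expR_gt0 (- (b / 2)).
by move: (expR _) (sh _) s0 => x s s0 x0; field; rewrite !gt_eqF.
Qed.

(** Laurent expansion of the two factors: each pole and constant term is split
    off, and what remains is a product of nonincreasing kernels. *)
Lemma lattice_kernel_split (d : nat) a b : (0 < d)%N -> 0 < a -> 0 < b ->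
  d%:R * pker (d%:R * a) * qker (d%:R * b) =
  (a ^+ 2 * b)^-1 * d%:R^-1 ^+ 2
  - (4 * b)^-1 * csch_kernel (d%:R * a / 2)
  + 2^-1 * (d%:R * pker (d%:R * a))
  + b / (4 * a ^+ 2) * (sh_kernel (d%:R * a / 2) * coth_kernel (d%:R * b / 2)).
Proof.
move=> d0 a0 b0; have d0R : 0 < (d%:R : R) by rewrite ltr0n.
rewrite pker_sh ?mulr_gt0// qker_coth ?mulr_gt0//.
rewrite /csch_kernel /sh_kernel /coth_kernel.
have s1 : 0 < sh (d%:R * a / 2) by rewrite sh_gt0// divr_gt0// mulr_gt0.
have s2 : 0 < sh (d%:R * b / 2) by rewrite sh_gt0// divr_gt0// mulr_gt0.
move: (d%:R : R) d0R (ch _) (sh (d%:R * a / 2)) (sh _) s1 s2 => x x0 c s t s0 t0.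
by field; rewrite !gt_eqF.
Qed.

Lemma pow_le_inv (a : R) (n : nat) : 0 < a -> (0 < n)%N ->
  expR (- a) ^+ n <= 6 / a ^+ 3 * n%:R^-1 ^+ 3.
Proof.
move=> a0 n0; have na : 0 < n%:R * a by rewrite mulr_gt0// ltr0n.
have h := expR_ge1Dxn 2 (ltW na).
have -> : expR (- a) ^+ n = (expR (n%:R * a))^-1.
  by rewrite -expRM_natl -expRN mulrN.
have h1 : 0 < (n%:R * a) ^+ 3 / 6 by rewrite divr_gt0// exprn_gt0.
have -> : 6 / a ^+ 3 * n%:R^-1 ^+ 3 = ((n%:R * a) ^+ 3 / 6)^-1.
  rewrite -(ltr0n R) in n0; move: (n%:R : R) n0 => x x0.
  by field; rewrite !gt_eqF.
rewrite lef_pV2 ?posrE ?expR_gt0//; apply: le_trans h.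
by rewrite lerDr.
Qed.

Lemma nat_mul_pow_cvg0 (a : R) : 0 < a -> n%:R * expR (- a) ^+ n @[n --> \oo] --> (0 : R).
Proof.
move=> a0; apply: (@squeeze_cvgr _ _ _ _ (cst 0) (fun n => 6 / a ^+ 3 * n%:R^-1)).
- near=> n; rewrite mulr_ge0// ?exprn_ge0 ?expR_ge0//=.
  have n0 : (0 < n)%N by near: n; exact: nbhs_infty_gt.
  have n1 : 1 <= (n%:R : R) by rewrite ler1n.
  have n0R : 0 < (n%:R : R) by rewrite ltr0n.
  apply: le_trans (ler_wpM2l (ltW n0R) (pow_le_inv a0 n0)) _.
  rewrite mulrCA ler_wpM2l ?divr_ge0 ?exprn_ge0 ?(ltW a0)//.
  rewrite exprS mulrA divff ?gt_eqF// mul1r expr2 ler_piMr ?invr_ge0//.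
  by rewrite invf_le1.
- exact: cvg_cst.
- rewrite -[X in _ --> X](mulr0 (6 / a ^+ 3)); apply: cvgMr.
  apply/gtr0_cvgV0.
    by near=> n; rewrite ltr0n; near: n; exact: nbhs_infty_gt.
  exact: cvgr_idn.
Unshelve. all: by end_near.
Qed.

Lemma pow_cvg0 (a : R) : 0 < a -> expR (- a) ^+ n @[n --> \oo] --> (0 : R).
Proof.
move=> a0; apply: cvg_expr; rewrite ger0_norm ?expR_ge0//.
by rewrite expR_lt1 oppr_lt0.
Qed.

Lemma sum_pow_cvg a : 0 < a ->
  psum (fun n => expR (- a) ^+ n) n @[n --> \oo] --> expR (- a) / (1 - expR (- a)).
Proof.
move=> a0; have h := expRN_lt1 a0; have h0 := pow_cvg0 a0.
move: (expR (- a)) h h0 => q h h0.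
have -> : psum (fun n => q ^+ n) = (fun n => q / (1 - q) - q / (1 - q) * q ^+ n).
  apply/funext; elim=> [|n IHn]; first by rewrite psum0 expr0 mulr1 subrr.
  by rewrite psumS IHn exprS; field; rewrite gt_eqF.
rewrite -[X in _ --> X]subr0 -[X in _ --> _ - X](mulr0 (q / (1 - q))).
by apply: cvgB; [exact: cvg_cst | exact: cvgMr].
Qed.

Lemma sum_nat_pow_cvg a : 0 < a ->
  psum (fun n => n%:R * expR (- a) ^+ n) n @[n --> \oo] --> pker a.
Proof.
move=> a0; have h := expRN_lt1 a0; have h0 := pow_cvg0 a0.
have h1 := nat_mul_pow_cvg0 a0; rewrite /pker.
move: (expR (- a)) h h0 h1 => q h h0 h1.
have -> : psum (fun n => n%:R * q ^+ n) = (fun n => q / (1 - q) ^+ 2 -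
    (q / (1 - q) * (n%:R * q ^+ n) + q / (1 - q) ^+ 2 * q ^+ n)).
  apply/funext; elim=> [|n IHn].
    by rewrite psum0 expr0 mul0r mulr0 add0r mulr1 subrr.
  by rewrite psumS IHn /= !exprS -![n.+1%:R]natr1; field; rewrite gt_eqF.
rewrite -[X in _ --> X]subr0 -[X in _ --> _ - X]addr0.
rewrite -[X in _ --> _ - (X + _)](mulr0 (q / (1 - q))).
rewrite -[X in _ --> _ - (_ + X)](mulr0 (q / (1 - q) ^+ 2)).
by apply: cvgB; [exact: cvg_cst | apply: cvgD; exact: cvgMr].
Qed.

(** The constant term [1 / 2] of [qker] contributes an explicit geometric
    series, of lower order than the bound on its individual terms suggests. *)
Lemma inv_coef_pker a : 0 < a ->
  psum (fun d => e d * (d%:R * pker (d%:R * a))) n @[n --> \oo] -->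
  expR (- a) / (1 - expR (- a)).
Proof.
move=> a0; apply: (@dirichlet_inv R (fun n => n%:R * expR (- a) ^+ n) _ (6 / a ^+ 3)).
- move=> n n0; rewrite mulr_ge0 ?exprn_ge0 ?expR_ge0//=.
  have n0R : 0 < (n%:R : R) by rewrite ltr0n.
  apply: le_trans (ler_wpM2l (ltW n0R) (pow_le_inv a0 n0)) _.
  by rewrite mulrCA [n%:R^-1 ^+ 3]exprS [n%:R * _]mulrA divff ?gt_eqF// mul1r.
- move=> d d0; have da : 0 < d%:R * a by rewrite mulr_gt0// ltr0n.
  under eq_fun do under eq_psum do
    rewrite natrM exprM -expRM_natl mulrN -mulrA.
  under eq_fun do rewrite psumZ.
  by apply: cvgMr; exact: sum_nat_pow_cvg.
- apply: cvg_trans (sum_pow_cvg a0); apply: near_eq_cvg; near=> n.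
  apply: eq_psum => k /andP[k0 _].
  by rewrite mulrAC divff ?mul1r// pnatr_eq0 -lt0n.
Unshelve. all: by end_near.
Qed.

(** Both nonincreasing terms are bounded by multiples of [(1 + d * a) ^- 2], whose
    sum over [d] is at most [1 / a]; this is where the factors
    [1 / (a * b)] and [b / a ^ 3] come from. *)
Lemma lattice_sum_estimate (h : R) : 0 < h -> exists2 C : R, 0 <= C &
  forall a b T : R, 0 < a -> 0 < b ->
  psum (fun d => e d * (d%:R * pker (d%:R * a) * qker (d%:R * b))) n
    @[n --> \oo] --> T ->
  `|T - zeta 3 / zeta 2 / (a ^+ 2 * b)| <=
    h * ((a * b)^-1 + b / a ^+ 3) + C * (b^-1 + b / a ^+ 2) + a^-1.
Proof.
(* 7 absorbs the factors [16 / 4] and [25 / 4] of the bounds below *)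
move=> h0; have h7 : 0 < h / 7 by rewrite divr_gt0.
have [C C0 HC] := @sum_inv_coef_little_o R (h / 7) h7.
exists (7 * C); first by rewrite mulr_ge0.
move=> a b T a0 b0 HT.
have da d : (0 < d)%N -> 0 < d%:R * a / 2 by move=> d0; rewrite divr_gt0// mulr_gt0// ltr0n.
have db d : (0 < d)%N -> 0 < d%:R * b / 2 by move=> d0; rewrite divr_gt0// mulr_gt0// ltr0n.
have dS (d : nat) (x : R) : 0 < x -> d%:R * x / 2 <= d.+1%:R * x / 2.
  by move=> x0; rewrite ler_pM2r ?invr_gt0// ler_pM2r// ler_nat.
have h70 := ltW h7.
have B1 N : `|psum (fun d => e d * csch_kernel (d%:R * a / 2)) N| <=
    h / 7 * (16 * a^-1) + C.
  apply: le_trans (abel_inv_coef (f := fun d => csch_kernel (d%:R * a / 2)) HC _ _) _.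
  - by move=> n n0; apply: csch_kernel_nonincreasing; [exact: da | exact: dS].
  - exact/csch_kernel_ge0/da.
  apply: lerD; last by rewrite ler_piMr// csch_kernel_le1// da.
  rewrite ler_wpM2l//; apply: le_trans (ler_wpM2l _ (sum_inv_sqr_affine N a0)) => //.
  rewrite -psumZ; apply: ler_psum => d /andP[d0 _].
  apply: le_trans (csch_kernel_decay (da d d0)) _.
  by have -> : 2 * (d%:R * a / 2) = d%:R * a by field.
have B2 N : `|psum (fun d => e d * (sh_kernel (d%:R * a / 2) * coth_kernel (d%:R * b / 2))) N|
    <= h / 7 * (25 * a^-1) + C * 25.
  have c01 d : (0 < d)%N -> 0 <= coth_kernel (d%:R * b / 2) <= 1.
    by move=> d0; apply/coth_kernel_bounds/db.
  have c0 d : (0 < d)%N -> 0 <= coth_kernel (d%:R * b / 2) by case/c01/andP.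
  have c1 d : (0 < d)%N -> coth_kernel (d%:R * b / 2) <= 1 by case/c01/andP.
  have le25 d : (0 < d)%N -> sh_kernel (d%:R * a / 2) * coth_kernel (d%:R * b / 2) <=
      25 * (1 + d%:R * a)^-1 ^+ 2.
    move=> d0; apply: (@le_trans _ _ (sh_kernel (d%:R * a / 2) * 1)).
      by rewrite ler_wpM2l ?sh_kernel_ge0 ?c1.
    rewrite mulr1; apply: le_trans (sh_kernel_le (da d d0)) _.
    by have -> : 2 * (d%:R * a / 2) = d%:R * a by field.
  apply: le_trans (abel_inv_coef (f := fun d =>
    sh_kernel (d%:R * a / 2) * coth_kernel (d%:R * b / 2)) HC _ _) _.
  - move=> n n0; apply: ler_pM; rewrite ?sh_kernel_ge0 ?c0//.
      by apply: sh_kernel_nonincreasing; [exact: da | exact: dS].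
    by apply: coth_kernel_nonincreasing; [exact: db | exact: dS].
  - by rewrite mulr_ge0 ?sh_kernel_ge0 ?c0.
  apply: lerD.
    rewrite ler_wpM2l//; apply: le_trans (ler_wpM2l _ (sum_inv_sqr_affine N a0)) => //.
    by rewrite -psumZ; apply: ler_psum => d /andP[d0 _]; exact: le25.
  rewrite ler_wpM2l//; apply: le_trans (le25 1%N isT) _.
  rewrite ler_piMr// exprn_ile1 ?invr_ge0 ?invf_le1 ?mul1r ?addr_ge0 ?(ltW a0)//.
    by rewrite lerDl ltW.
  by rewrite ltr_pwDl// ltW.
pose w := expR (- a) / (1 - expR (- a)).
have w0 : 0 <= w <= a^-1.
  rewrite /w divr_ge0 ?expR_ge0 ?(ltW (expRN_lt1 a0))//=.
  rewrite ler_pdivrMr ?expRN_lt1// mulrC ler_pdivlMr//.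
  have := expR_ge1Dx a; have : expR a * expR (- a) = 1 by rewrite -expRD subrr expR0.
  have := expR_gt0 (- a); move: (expR a) (expR (- a)) => x y y0 xy xa; nra.
pose E := (4 * b)^-1 * (h / 7 * (16 * a^-1) + C)
   + b / (4 * a ^+ 2) * (h / 7 * (25 * a^-1) + C * 25).
have bd N : `|psum (fun d => e d * (d%:R * pker (d%:R * a) * qker (d%:R * b))) N
    - (a ^+ 2 * b)^-1 * psum (fun d => e d * d%:R^-1 ^+ 2) N
    - 2^-1 * psum (fun d => e d * (d%:R * pker (d%:R * a))) N| <= E.
  have -> : psum (fun d => e d * (d%:R * pker (d%:R * a) * qker (d%:R * b))) N =
     (a ^+ 2 * b)^-1 * psum (fun d => e d * d%:R^-1 ^+ 2) N
     - (4 * b)^-1 * psum (fun d => e d * csch_kernel (d%:R * a / 2)) N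
     + 2^-1 * psum (fun d => e d * (d%:R * pker (d%:R * a))) N
     + b / (4 * a ^+ 2) * psum (fun d => e d *
         (sh_kernel (d%:R * a / 2) * coth_kernel (d%:R * b / 2))) N.
    rewrite -!psumZ -psumB -!psumD; apply: eq_psum => d /andP[d0 _].
    by rewrite lattice_kernel_split//; ring.
  have c1 : 0 <= (4 * b)^-1 by rewrite invr_ge0 mulr_ge0// ltW.
  have c2 : 0 <= b / (4 * a ^+ 2) by rewrite divr_ge0 ?mulr_ge0 ?sqr_ge0// ltW.
  have key (u v c x y z : R) : u * v - c * x + y + z - u * v - y = z - c * x by ring.
  rewrite key; apply: le_trans (ler_normB _ _) _.
  rewrite addrC (normrM (4 * b)^-1) (normrM (b / (4 * a ^+ 2))).
  by rewrite (ger0_norm c1) (ger0_norm c2) lerD// ler_wpM2l.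
have lim : `|T - (a ^+ 2 * b)^-1 * (zeta 3 / zeta 2) - 2^-1 * w| <= E.
  have cv : `|psum (fun d => e d * (d%:R * pker (d%:R * a) * qker (d%:R * b))) N
    - (a ^+ 2 * b)^-1 * psum (fun d => e d * d%:R^-1 ^+ 2) N
    - 2^-1 * psum (fun d => e d * (d%:R * pker (d%:R * a))) N| @[N --> \oo] -->
    `|T - (a ^+ 2 * b)^-1 * (zeta 3 / zeta 2) - 2^-1 * w|.
    apply: cvg_norm; apply: cvgB; last by apply: cvgMr; exact: inv_coef_pker.
    by apply: cvgB => //; apply: cvgMr; exact: inv_coef_zeta.
  rewrite -(cvg_lim (@norm_hausdorff _ _) cv); apply: limr_le; first exact: cvgP cv.
  exact: nearW.
have EE : E = 4 / 7 * (h * (a * b)^-1) + 25 / 28 * (h * (b / a ^+ 3))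
    + C * b^-1 / 4 + 25 / 4 * (C * (b / a ^+ 2)).
  by rewrite /E; field; rewrite !gt_eqF.
have e1 : 0 <= h * (a * b)^-1 by rewrite mulr_ge0 ?invr_ge0 ?mulr_ge0// ltW.
have e2 : 0 <= h * (b / a ^+ 3) by rewrite mulr_ge0 ?divr_ge0 ?exprn_ge0// ltW.
have e3 : 0 <= C * b^-1 by rewrite mulr_ge0 ?invr_ge0// ltW.
have e4 : 0 <= C * (b / a ^+ 2) by rewrite mulr_ge0// divr_ge0 ?exprn_ge0// ltW.
have -> : T - zeta 3 / zeta 2 / (a ^+ 2 * b) =
    (T - (a ^+ 2 * b)^-1 * (zeta 3 / zeta 2) - 2^-1 * w) + 2^-1 * w.
  by rewrite subrK [_^-1 * _]mulrC.
apply: le_trans (ler_normD _ _) _; apply: lerD; last first.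
  case/andP: w0 => w1 w2; have w3 : 0 <= 2^-1 * w by apply: mulr_ge0.
  rewrite (ger0_norm w3); apply: le_trans w2.
  by rewrite ler_piMl// invf_le1// ler1n.
apply: le_trans lim _; rewrite EE.
have key (c d x y z t : R) : 0 <= c * x -> 0 <= c * y -> 0 <= d * z -> 0 <= d * t ->
    4 / 7 * (c * x) + 25 / 28 * (c * y) + d * z / 4 + 25 / 4 * (d * t) <=
    c * (x + y) + 7 * d * (z + t) by clear; intros; lra.
exact: key e1 e2 e3 e4.
Qed.

End Lattice_sum.

(** * The sum over primitive vectors *)

Section Primitive_sum.
Context {R : realType}.
Local Open Scope ereal_scope.
Local Notation e := (inv_coef R).

Lemma nneseries_EFin (f : nat -> R) (l : R) : (forall k, (0 <= f k)%R) ->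
  series f n @[n --> \oo] --> l -> \sum_(k <oo) (f k)%:E = l%:E.
Proof.
move=> f0 fl; apply/cvg_lim => //.
have -> : (fun n => \sum_(0 <= k < n) (f k)%:E) = (fun n => (series f n)%:E).
  by apply/funext => n; rewrite sumEFin.
by apply: cvg_EFin; [exact: nearW | exact: fl].
Qed.

Lemma nneseries_EFin_inv (f : nat -> R) (l : R) : (forall k, (0 <= f k)%R) ->
  \sum_(k <oo) (f k)%:E = l%:E -> series f n @[n --> \oo] --> l.
Proof.
move=> f0 fl.
have cv : (\sum_(0 <= k < n) (f k)%:E) @[n --> \oo] --> l%:E.
  by rewrite -fl; apply: is_cvg_nneseries => n _ _; rewrite lee_fin.
have -> : series f = (fun n => fine (\sum_(0 <= k < n) (f k)%:E)).
  by apply/funext => n; rewrite sumEFin.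
exact: fine_cvg cv.
Qed.

Lemma esum_countable (T : countType) (a : T -> \bar R) :
  (forall x, 0 <= a x) ->
  \esum_(x in [set: T]) a x =
  \sum_(n <oo) (if pickle_inv n is Some x then a x else 0).
Proof.
move=> a0; pose g n := if @pickle_inv T n is Some x then a x else 0.
have g0 n : 0 <= g n by rewrite /g; case: pickle_inv.
rewrite -/g nneseries_esumT//.
transitivity (\esum_(n in range (@pickle T)) g n); last first.
  rewrite esum_mkcond; apply: eq_esum => n _.
  case: ifPn => //; rewrite notin_setE => nr; rewrite /g.
  case E: (pickle_inv n) => [x|//]; exfalso; apply: nr; exists x => //.
  by have := @pickle_invK T n; rewrite /ocancel E.
have bij : set_bij [set: T] (range (@pickle T)) (@pickle T).
  split; first by move=> x _; exists x.
    by move=> x y _ _; exact: (pcan_inj pickleK).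
  by move=> n [x _ <-]; exists x.
rewrite (reindex_esum _ _ _ _ bij); apply: eq_esum => x _.
by rewrite /g pickleK_inv.
Qed.

Lemma esumZl (T : countType) (a : T -> \bar R) (c : R) : (0 <= c)%R ->
  (forall x, 0 <= a x) ->
  \esum_(x in [set: T]) (c%:E * a x) = c%:E * \esum_(x in [set: T]) a x.
Proof.
move=> c0 a0; rewrite !esum_countable//; last first.
  by move=> x; rewrite mule_ge0// lee_fin.
rewrite -nneseriesZl//; last by move=> n _; case: pickle_inv.
by apply: eq_eseriesr => n _; case: pickle_inv => //; rewrite mule0.
Qed.

Lemma esum_pair (T1 T2 : choiceType) (a : T1 -> T2 -> \bar R) :
  (forall i j, 0 <= a i j) ->
  \esum_(i in [set: T1]) \esum_(j in [set: T2]) a i j =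
  \esum_(k in [set: T1 * T2]) a k.1 k.2.
Proof.
move=> a0; rewrite esum_esum//; congr (esum _ _).
by apply/seteqP; split.
Qed.

Lemma esum_swap (T1 T2 : choiceType) (a : T1 -> T2 -> \bar R) :
  (forall i j, 0 <= a i j) ->
  \esum_(i in [set: T1]) \esum_(j in [set: T2]) a i j =
  \esum_(j in [set: T2]) \esum_(i in [set: T1]) a i j.
Proof.
move=> a0; rewrite !esum_pair//.
have bij : set_bij [set: T2 * T1] [set: T1 * T2] (fun k => (k.2, k.1)).
  split=> //; first by move=> [i j] [k l] _ _ /= [-> ->].
  by move=> [i j] _; exists (j, i).
by rewrite (reindex_esum _ _ _ _ bij).
Qed.

Definition vscale (n : nat) (x : nat * nat) : nat * nat := (n * x.1, n * x.2)%N.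

(** The factor is the greatest common divisor of the two coordinates. *)
Lemma primitive_bij : set_bij [set: nat * primitive_vec]
  [set u : nat * nat | u <> (0, 0)%N] (fun p => vscale p.1.+1 (val p.2)).
Proof.
split.
- move=> [j [[x1 x2] cx]] _ /= [] /eqP; rewrite muln_eq0/= => /eqP x10 /eqP.
  by rewrite muln_eq0/= => /eqP x20; move: cx; rewrite x10 x20.
- move=> [j [[x1 x2] cx]] [k [[y1 y2] cy]] _ _ /= [E1 E2].
  have jk : j.+1 = k.+1.
    have : (j.+1 * gcdn x1 x2 = k.+1 * gcdn y1 y2)%N by rewrite !muln_gcdr E1 E2.
    by rewrite (eqP cx) (eqP cy) !muln1.
  case: jk E1 E2 => -> /eqP; rewrite eqn_pmul2l// => /eqP E1 /eqP.
  rewrite eqn_pmul2l// => /eqP E2; subst.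
  by congr (_, _); apply: val_inj.
- move=> [u1 u2] /= u0.
  have g0 : (0 < gcdn u1 u2)%N.
    rewrite gcdn_gt0 !lt0n -negb_and; apply/negP => /andP[/eqP h1 /eqP h2].
    by apply: u0; rewrite h1 h2.
  have cx : coprime (u1 %/ gcdn u1 u2) (u2 %/ gcdn u1 u2).
    rewrite /coprime -(eqn_pmul2l g0) muln_gcdr muln1.
    by rewrite ![(gcdn u1 u2 * _)%N]mulnC !divnK ?dvdn_gcdl ?dvdn_gcdr.
  exists ((gcdn u1 u2).-1, exist _ (u1 %/ gcdn u1 u2, u2 %/ gcdn u1 u2)%N cx) => //=.
  rewrite /vscale/= prednK// ![(gcdn u1 u2 * _)%N]mulnC.
  by rewrite !divnK ?dvdn_gcdl ?dvdn_gcdr.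
Qed.

Lemma esum_primitive (h : nat * nat -> \bar R) : (forall u, 0 <= h u) ->
  h (0, 0)%N = 0 ->
  \esum_(j in [set: nat]) \esum_(x in [set: primitive_vec])
    h (vscale j.+1 (val x)) =
  \sum_(i <oo) \sum_(k <oo) h (i, k).
Proof.
move=> h0 h00; rewrite esum_pair// -(reindex_esum _ _ _ h primitive_bij).
rewrite nneseries_esumT; last by move=> n; apply: nneseries_ge0 => k _ _.
transitivity (\esum_(u in [set: nat * nat]) h u).
  rewrite esum_mkcond; apply: eq_esum => u _.
  case: ifPn => //; rewrite notin_setE/= => /contrapT ->.
  by rewrite h00.
rewrite (_ : h = fun k => h (k.1, k.2)); last by apply/funext => -[].
rewrite -(@esum_pair _ _ (fun i k => h (i, k)))//.
by apply: eq_esum => i _; rewrite nneseries_esumT.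
Qed.

Lemma lattice_sum (a b : R) (d : nat) : (0 < a)%R -> (0 < b)%R -> (0 < d)%N ->
  \sum_(i <oo) \sum_(k <oo)
    (d%:R * i%:R * (expR (- a) ^+ (d * i) * expR (- b) ^+ (d * k)))%:E =
  (d%:R * pker (d%:R * a) * qker (d%:R * b))%:E.
Proof.
move=> a0 b0 d0.
have da : (0 < d%:R * a)%R by rewrite mulr_gt0// ltr0n.
have db : (0 < d%:R * b)%R by rewrite mulr_gt0// ltr0n.
have Ea (i : nat) (c : R) : (expR (- c) ^+ (d * i) = expR (- (d%:R * c)) ^+ i)%R.
  by rewrite exprM -expRM_natl mulrN.
have q0 : (0 <= qker (d%:R * b))%R by rewrite invr_ge0 ltW// expRN_lt1.
have inner i : \sum_(k <oo)
    (d%:R * i%:R * (expR (- a) ^+ (d * i) * expR (- b) ^+ (d * k)))%:E =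
    (d%:R * (i%:R * expR (- (d%:R * a)) ^+ i) * qker (d%:R * b))%:E.
  apply: nneseries_EFin; first by move=> k; rewrite !mulr_ge0// exprn_ge0// expR_ge0.
  rewrite (_ : series _ = series (geometric
    (d%:R * (i%:R * expR (- (d%:R * a)) ^+ i)) (expR (- (d%:R * b))))%R).
    by apply: cvg_geometric_series; rewrite ger0_norm ?expR_ge0// expR_lt1 oppr_lt0.
  apply/funext => n; apply: eq_bigr => k _ /=.
  by rewrite !Ea !mulrA.
rewrite (eq_eseriesr (fun i _ => inner i)).
apply: nneseries_EFin.
  by move=> i; rewrite !mulr_ge0// exprn_ge0// expR_ge0.
have -> : series (fun i : nat => (d%:R * (i%:R * expR (- (d%:R * a)) ^+ i) * qker (d%:R * b))%R)
   = (fun n => (d%:R * series (fun i => i%:R * expR (- (d%:R * a)) ^+ i) n * qker (d%:R * b))%R).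
  apply/funext => n; rewrite /series/= mulr_sumr mulr_suml.
  by apply: eq_bigr.
apply: cvgMl; apply: cvgMr; rewrite -cvg_shiftS.
have E : (fun n => series (fun i => i%:R * expR (- (d%:R * a)) ^+ i)%R n.+1) =
    psum (fun i => i%:R * expR (- (d%:R * a)) ^+ i)%R.
  by apply/funext => n; rewrite psum_series /series/= big_nat_recl//= mul0r add0r.
by have := sum_nat_pow_cvg da; rewrite -E.
Qed.

Lemma vec_pow_bounds (a b : R) (x : primitive_vec) : (0 < a)%R -> (0 < b)%R ->
  (0 < vec_pow (expR (- a), expR (- b)) (val x) < 1)%R.
Proof.
move=> a0 b0; rewrite /vec_pow/= mulr_gt0 ?exprn_gt0 ?expR_gt0//=.
have lt1 (c : R) : (0 < c)%R -> (expR (- c) < 1)%R by move=> ?; rewrite expR_lt1 oppr_lt0.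
have le1 (c : R) n : (0 < c)%R -> (expR (- c) ^+ n <= 1)%R.
  by move=> c0; rewrite exprn_ile1 ?expR_ge0// ltW// lt1.
case: x => -[[|x1] x2] /= cx.
  rewrite expr0 mul1r; move: cx; rewrite /coprime gcd0n => /eqP ->.
  by rewrite expr1 lt1.
apply: (@le_lt_trans _ _ (expR (- a) ^+ x1.+1)%R).
  by rewrite ler_piMr ?exprn_ge0 ?expR_ge0 ?le1.
by rewrite exprn_ilt1 ?expR_ge0 ?lt1.
Qed.

(** Let [Psi m] be the sum of [m * x.1 * w ^ m] over the primitive [x], where [w]
    is the weight of [x]. Expanding [w / (1 - w)] gives the series of [Psi m / m],
    and the sums of [Psi] over the multiples of [d] run over a full lattice, hence
    are explicit. *)
Lemma primitive_sum (a b : R) : (0 < a)%R -> (0 < b)%R -> exists2 T : R,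
  \esum_(x in [set: primitive_vec]) ((val x).1%:R *
    (vec_pow (expR (- a), expR (- b)) (val x) /
    (1 - vec_pow (expR (- a), expR (- b)) (val x))))%:E = T%:E &
  psum (fun d => e d * (d%:R * pker (d%:R * a) * qker (d%:R * b)))%R n
    @[n --> \oo] --> T.
Proof.
move=> a0 b0.
pose W (x : primitive_vec) := vec_pow (expR (- a), expR (- b)) (val x).
have W01 x : (0 < W x < 1)%R by exact: vec_pow_bounds.
have W0 x : (0 <= W x)%R by case/andP: (W01 x) => /ltW.
pose Phi (n : nat) := \esum_(x in [set: primitive_vec])
  (n%:R * (val x).1%:R * W x ^+ n)%:E.
have term0 n x : 0 <= (n%:R * (val x).1%:R * W x ^+ n)%:E.
  by rewrite lee_fin !mulr_ge0// exprn_ge0.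
have Phi0 n : 0 <= Phi n by apply: esum_ge0 => x _.
have lat d : (0 < d)%N -> \esum_(j in [set: nat]) Phi (d * j.+1)%N =
    (d%:R * pker (d%:R * a) * qker (d%:R * b))%:E.
  move=> d0; rewrite -lattice_sum//.
  rewrite -(esum_primitive (h := fun u => (d%:R * u.1%:R *
    (expR (- a) ^+ (d * u.1) * expR (- b) ^+ (d * u.2)))%:E)).
  - apply: eq_esum => j _; apply: eq_esum => x _; congr EFin.
    have e1 y : (y * (d * j.+1) = d * (j.+1 * y))%N by rewrite mulnC mulnA.
    by rewrite /W /vec_pow/= exprMn -!exprM !e1 !natrM !mulrA.
  - by move=> u; rewrite lee_fin !mulr_ge0// exprn_ge0// expR_ge0.
  - by rewrite mulr0 mul0r.
have Phi_le n : (0 < n)%N -> Phi n <= (n%:R * pker (n%:R * a) * qker (n%:R * b))%:E.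
  move=> n0; rewrite -(lat n n0); apply: esum_ge; exists [set 0%N].
    by split; [exact: finite_set1 | ].
  by rewrite fsbig_set1 muln1.
have Phi_fin n : (0 < n)%N -> Phi n \is a fin_num.
  by move=> n0; rewrite ge0_fin_numE// (le_lt_trans (Phi_le n n0))// ltry.
pose Psi n := fine (Phi n).
have PsiE n : (0 < n)%N -> Phi n = (Psi n)%:E by move=> n0; rewrite fineK// Phi_fin.
have Psi0 n : (0 <= Psi n)%R by rewrite fine_ge0.
have swapE : \esum_(x in [set: primitive_vec])
    ((val x).1%:R * (W x / (1 - W x)))%:E =
    \sum_(j <oo) (Psi j.+1 * j.+1%:R^-1)%:E.
  transitivity (\esum_(x in [set: primitive_vec]) \esum_(j in [set: nat])
      ((val x).1%:R * W x ^+ j.+1)%:E).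
    apply: eq_esum => x _; rewrite -nneseries_esumT; last first.
      by move=> j; rewrite lee_fin mulr_ge0// exprn_ge0.
    rewrite (@nneseries_EFin _ ((val x).1%:R * (W x / (1 - W x))))//.
      by move=> j; rewrite mulr_ge0// exprn_ge0.
    rewrite (_ : series _ = series (geometric ((val x).1%:R * W x) (W x))%R).
      rewrite mulrA; apply: cvg_geometric_series.
      by rewrite ger0_norm//; case/andP: (W01 x).
    by apply/funext => n; apply: eq_bigr => k _ /=; rewrite exprS mulrA.
  rewrite esum_swap; last by move=> x j; rewrite lee_fin mulr_ge0// exprn_ge0.
  rewrite nneseries_esumT; last by move=> j; rewrite lee_fin mulr_ge0// invr_ge0.
  apply: eq_esum => j _; rewrite mulrC EFinM -PsiE// -esumZl ?invr_ge0//.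
  apply: eq_esum => x _; rewrite -EFinM; congr EFin.
  by rewrite !mulrA mulVf ?mul1r// pnatr_eq0.
have fin : \sum_(j <oo) (Psi j.+1 * j.+1%:R^-1)%:E \is a fin_num.
  have p0 j : 0 <= (Psi j.+1 * j.+1%:R^-1)%:E by rewrite lee_fin mulr_ge0// invr_ge0.
  rewrite ge0_fin_numE; last exact: nneseries_ge0.
  apply: (@le_lt_trans _ _ (\esum_(j in [set: nat]) Phi (1 * j.+1)%N)); last first.
    by rewrite lat// ltry.
  rewrite nneseries_esumT//; apply: le_esum => j _.
  rewrite mul1n PsiE// lee_fin ler_piMr//.
  by rewrite invf_le1 ?ltr0n// ler1n.
exists (fine (\sum_(j <oo) (Psi j.+1 * j.+1%:R^-1)%:E)).
  by rewrite swapE fineK.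
apply: (@dirichlet_inv R Psi _ (16 * qker b / a ^+ 4)).
- move=> n n0; rewrite Psi0/= -lee_fin -PsiE//; apply: le_trans (Phi_le n n0) _.
  rewrite lee_fin.
  have nR : (0 < n%:R :> R)%R by rewrite ltr0n.
  have n1 : (1 <= n%:R :> R)%R by rewrite ler1n.
  have na : (0 < n%:R * a)%R by rewrite mulr_gt0.
  have qb : (0 < qker b)%R by rewrite invr_gt0 expRN_lt1.
  have h1 : (qker (n%:R * b) <= qker b)%R.
    rewrite lef_pV2 ?posrE ?expRN_lt1 ?mulr_gt0// lerD2l lerN2 ler_expR lerN2.
    by rewrite ler_peMl// ltW.
  have h2 : (pker (n%:R * a) <= 16 / (n%:R * a) ^+ 4)%R.
    rewrite pker_sh//.
    have s2 := sh_ge_sqr (ltW (divr_gt0 na (ltr0Sn _ 1))).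
    have s0 : (0 < (n%:R * a / 2) ^+ 2 / 2)%R by rewrite divr_gt0// exprn_gt0// divr_gt0.
    have -> : (16 / (n%:R * a) ^+ 4 = ((n%:R * a / 2) ^+ 2 / 2)^-1 ^+ 2 / 4)%R.
      by move: (n%:R * a)%R na => y y0; field; rewrite gt_eqF.
    rewrite ler_wpM2r ?invr_ge0//; apply: lerXn2r.
    + by rewrite nnegrE invr_ge0 (le_trans (ltW s0)).
    + by rewrite nnegrE invr_ge0 ltW.
    + by rewrite lef_pV2 ?posrE// (lt_le_trans s0).
  have h3 : (0 <= qker (n%:R * b))%R by rewrite invr_ge0 ltW// expRN_lt1// mulr_gt0.
  apply: (@le_trans _ _ (n%:R * (16 / (n%:R * a) ^+ 4) * qker b)%R).
    apply: ler_pM => //.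
      by rewrite mulr_ge0// divr_ge0 ?expR_ge0// exprn_ge0// ltW// expRN_lt1.
    by rewrite ler_wpM2l.
  have -> : (n%:R * (16 / (n%:R * a) ^+ 4) * qker b =
      16 * qker b / a ^+ 4 * n%:R^-1 ^+ 2 * n%:R^-1)%R.
    by move: (n%:R : R) nR => y y0; field; rewrite !gt_eqF.
  have K0 : (0 <= 16 * qker b / a ^+ 4)%R.
    by apply: divr_ge0; [apply: mulr_ge0 => //; exact: ltW | rewrite exprn_ge0// ltW].
  by rewrite ler_piMr ?invf_le1//; apply: mulr_ge0 => //; exact: sqr_ge0.
- move=> d d0.
  rewrite (_ : (fun n => psum _ n) = series (fun j => Psi (d * j.+1)%N)); last first.
    by apply/funext => n; rewrite psum_series.
  apply: nneseries_EFin_inv => //; rewrite -lat// nneseries_esumT; last first.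
    by move=> j; rewrite lee_fin.
  by apply: eq_esum => j _; rewrite PsiE// muln_gt0 d0.
- rewrite (_ : (fun n => psum _ n) = series (fun j => Psi j.+1 * j.+1%:R^-1)%R); last first.
    by apply/funext => n; rewrite psum_series.
  apply: nneseries_EFin_inv; first by move=> j; rewrite mulr_ge0// invr_ge0.
  by rewrite fineK.
Qed.

Lemma primitive_sum_swap (a b : R) (F : nat -> R -> \bar R) :
  \esum_(x in [set: primitive_vec])
     F (val x).2 (vec_pow (expR (- a), expR (- b)) (val x)) =
  \esum_(x in [set: primitive_vec])
     F (val x).1 (vec_pow (expR (- b), expR (- a)) (val x)).
Proof.
have swapP (x : primitive_vec) : coprime (val x).2 (val x).1.
  by rewrite coprime_sym; exact: valP x.
pose sw (x : primitive_vec) : primitive_vec :=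
  exist (fun x : nat * nat => coprime x.1 x.2) ((val x).2, (val x).1) (swapP x).
have swK : involutive sw by move=> [[x1 x2] cx]; apply: val_inj.
have bij : set_bij [set: primitive_vec] [set: primitive_vec] sw.
  split=> //; first by move=> x y _ _; exact: (inv_inj swK).
  by move=> x _; exists (sw x).
rewrite (reindex_esum _ _ _ _ bij); apply: eq_esum => x _ /=.
by rewrite /vec_pow/= mulrC.
Qed.

End Primitive_sum.

(** * The expectation of xi *)

Section Expectation.
Context {R : realType}.
Local Open Scope ereal_scope.
Implicit Types (Q : probability config R) (x : primitive_vec) (nu : config).

Lemma measurable_coord x (A : set nat) : measurable [set nu : config | A (nu x)].
Proof.
have -> : [set nu : config | A (nu x)] =
    \bigcup_(k in A) [set nu : config | nu x = k].
  apply/seteqP; split => [nu Anu|nu [k Ak] /= ->//].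
  by exists (nu x).
apply: bigcup_measurable => k _; apply: sub_sigma_algebra.
by exists x, k.
Qed.

Lemma measurable_fun_coord x (g : nat -> \bar R) :
  measurable_fun [set: config] ((fun nu => g (nu x)) : config -> \bar R).
Proof.
move=> _ B mB; rewrite setTI.
exact: (measurable_coord x (g @^-1` B)).
Qed.

Lemma integral_coord Q x (g : nat -> R) : (forall k, (0 <= g k)%R) ->
  \int[Q]_nu (g (nu x))%:E =
  \sum_(k <oo) (g k)%:E * Q [set nu : config | nu x = k].
Proof.
move=> g0; pose D k := [set nu : config | nu x = k].
have mD k : measurable (D k) by exact: (measurable_coord x [set k]).
have E nu : (g (nu x))%:E = \sum_(k <oo) ((g k)%:E * (\1_(D k) nu)%:E).
  have -> : \sum_(k <oo) ((g k)%:E * (\1_(D k) nu)%:E) =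
      \sum_(k <oo) (g k * (k == nu x)%:R)%:E.
    apply: eq_eseriesr => k _; rewrite -EFinM indicE; congr (_ * _)%:E.
    congr (nat_of_bool _)%:R; apply/idP/eqP; rewrite inE /D/=; first by move=> ->.
    by move=> ->.
  apply/esym/nneseries_EFin; first by move=> k; rewrite mulr_ge0.
  apply: cvg_near_cst; near=> n; rewrite /series/=.
  have nn : (nu x < n)%N by near: n; exact: nbhs_infty_gt.
  rewrite (bigD1_seq (nu x))/= ?iota_uniq ?mem_index_iota//.
  rewrite eqxx mulr1 big1 ?addr0// => k /negPf ->; exact: mulr0.
under eq_integral do rewrite E.
rewrite integral_nneseries//; last 2 first.
- move=> k; apply: measurable_funeM; apply/measurable_EFinP.
  exact: measurable_indic.
- by move=> k nu _; rewrite -EFinM lee_fin mulr_ge0.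
apply: eq_eseriesr => k _; rewrite ge0_integralZl_EFin//.
- by rewrite integral_indic// setIT.
- by apply/measurable_EFinP; exact: measurable_indic.
Unshelve. all: by end_near.
Qed.

Lemma binom_shiftS (r : R) (k : nat) :
  (k.+1%:R * binom_shift r k.+1 = (r + k%:R) * binom_shift r k)%R.
Proof.
rewrite /binom_shift big_ord_recr/= factS natrM invfM.
rewrite mulrCA [(_ * (_^-1 * _))%R]mulrC.
have k0 : (k.+1%:R != 0 :> R)%R by rewrite pnatr_eq0.
have f0 : (k`!%:R != 0 :> R)%R by rewrite pnatr_eq0 -lt0n fact_gt0.
move: (\prod_(i < k) _)%R (k.+1%:R : R)%R (k`!%:R : R)%R k0 f0 => *.
by field; apply/andP.
Qed.

(** The ratio of consecutive probabilities turns the mean [m] of one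
    coordinate into the solution of [m = w * (r + m)]. *)
Lemma coord_mean (r : R) z Q x : (0 < r)%R -> is_Qzr r z Q ->
  (0 < vec_pow z (val x) < 1)%R ->
  \int[Q]_nu (nu x)%:R%:E =
  (r * (vec_pow z (val x) / (1 - vec_pow z (val x))))%:E.
Proof.
move=> r0 [_ HQ]; set w := vec_pow z (val x) => /andP[w0 w1].
have w1' : (0 < 1 - w)%R by rewrite subr_gt0.
pose p k := (binom_shift r k * w ^+ k * (1 - w) `^ r)%R.
have HQk k : Q [set nu : config | nu x = k] = (p k)%:E by rewrite HQ.
have b0 k : (0 <= binom_shift r k)%R.
  rewrite divr_ge0// prodr_ge0// => i _; rewrite addr_ge0// ltW//.
have p0 k : (0 <= p k)%R.
  apply: mulr_ge0; last exact: powR_ge0.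
  by apply: mulr_ge0 => //; rewrite exprn_ge0// ltW.
have rec k : (k.+1%:R * p k.+1 = w * (r * p k + k%:R * p k))%R.
  have := binom_shiftS r k; rewrite /p exprS.
  move: (binom_shift r k.+1) (binom_shift r k) (w ^+ k)%R (_ `^ r)%R => B' B y P E.
  transitivity ((k.+1%:R * B') * (w * y * P))%R; first by ring.
  by rewrite E; ring.
have sum1 : series p n @[n --> \oo] --> (1 : R)%R.
  apply: nneseries_EFin_inv => //.
  have := @integral_coord Q x (fun=> 1%R) (fun _ => ler01).
  have I1 : \int[Q]_(nu in [set: config]) (1%R)%:E = 1.
    by rewrite integral_cst// -[RHS](mule1 1); congr (_ * _); exact: probability_setT.
  rewrite I1 => ->.
  by apply: eq_eseriesr => k _; rewrite mul1e HQk.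
pose m n := series (fun k => k%:R * p k)%R n.
have mrec n : (m n.+1 = w * (r * series p n + m n))%R.
  rewrite /m /series/= big_nat_recl//= mul0r add0r mulr_sumr -big_split/= mulr_sumr.
  by apply: eq_bigr => k _.
have mS n : (m n <= m n.+1)%R.
  by rewrite /m /series/= [leRHS]big_nat_recr//= lerDl mulr_ge0.
have p1 n : (series p n <= 1)%R.
  have nd : nondecreasing_seq (series p).
    by apply/nondecreasing_seqP => k; rewrite /series/= [leRHS]big_nat_recr//= lerDl.
  rewrite -(cvg_lim (@norm_hausdorff _ _) sum1).
  by apply: nondecreasing_cvgn_le => //; exact: cvgP sum1.
have mb n : (m n <= r * (w / (1 - w)))%R.
  have h := mS n; rewrite mrec in h.
  have h1 : (r * series p n <= r)%R by rewrite ler_piMr// ltW.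
  have h2 : (w * (r * series p n) <= w * r)%R by rewrite ler_wpM2l// ltW.
  rewrite mulrA ler_pdivlMr//; move: h h2; rewrite !mulrDr.
  by move: (w * (r * _))%R (m n); clear; intros; lra.
have mc : cvgn m.
  apply: nondecreasing_is_cvgn; first exact/nondecreasing_seqP.
  by exists (r * (w / (1 - w)))%R => _ [n _ <-].
have mE : limn m = (r * (w / (1 - w)))%R.
  have l1 : (fun n => m n.+1) @ \oo --> limn m by rewrite cvg_shiftS.
  have l2 : (fun n => m n.+1) @ \oo --> (w * (r * 1 + limn m))%R.
    under eq_fun do rewrite mrec.
    by apply: cvgMr; apply: cvgD => //; exact: cvgMr.
  have := cvg_unique (@norm_hausdorff _ _) l1 l2.
  move: (limn m) => l E; apply: (mulIf (lt0r_neq0 w1')).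
  rewrite mulrA mulfVK ?lt0r_neq0//; rewrite {1}E; rewrite mulr1 in E *.
  by move: E => E; rewrite mulrBr mulr1 -E; rewrite {1}E; ring.
rewrite (@integral_coord Q x (fun k => k%:R)%R)//.
under eq_eseriesr do rewrite HQk -EFinM.
by apply: nneseries_EFin; [move=> k; rewrite mulr_ge0 | rewrite -mE].
Qed.

Lemma measurable_fun_esum_coord (g : primitive_vec -> nat -> \bar R) :
  (forall x k, 0 <= g x k) ->
  measurable_fun [set: config]
    ((fun nu => \esum_(x in [set: primitive_vec]) g x (nu x)) : config -> \bar R).
Proof.
move=> g0; rewrite (_ : (fun nu : config => \esum_(x in _) _) = (fun nu : config =>
  \sum_(n <oo) (if @pickle_inv primitive_vec n is Some x then g x (nu x) else 0))).
  2: by apply/funext => nu; rewrite esum_countable.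
apply: ge0_emeasurable_sum.
  by move=> k nu _ _; case: pickle_inv.
move=> k _; case: pickle_inv => [x|]; last exact: measurable_cst.
exact: measurable_fun_coord.
Qed.

Lemma integral_esum_coord Q (g : primitive_vec -> nat -> \bar R) :
  (forall x k, 0 <= g x k) ->
  \int[Q]_nu (\esum_(x in [set: primitive_vec]) g x (nu x)) =
  \esum_(x in [set: primitive_vec]) \int[Q]_nu g x (nu x).
Proof.
move=> g0; under eq_integral do rewrite esum_countable//.
rewrite integral_nneseries//; last 2 first.
- move=> k; case: pickle_inv => [x|]; last exact: measurable_cst.
  exact: measurable_fun_coord.
- by move=> k nu _; case: pickle_inv.
rewrite esum_countable; last by move=> x; exact: integral_ge0.
apply: eq_eseriesr => k _; case: pickle_inv => //.
by rewrite integral0.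
Qed.

(** Finite exactly where only finitely many coordinates are nonzero. *)
Definition total nu : \bar R := \esum_(x in [set: primitive_vec]) (nu x)%:R%:E.

Lemma total_support nu : total nu < +oo -> finite_set [set x | nu x != 0%N].
Proof.
move=> tf; apply: contrapT => inf.
have [g Hg] : exists g : R, total nu = g%:E.
  exists (fine (total nu)); rewrite fineK// ge0_fin_numE//.
  by apply: esum_ge0 => x _; rewrite lee_fin.
have [n Hn] := archi_nat (g + 1).
have [B BS Bn] := infinite_set_fset n inf.
have : n%:R%:E <= total nu; last by rewrite Hg lee_fin; lra.
apply: esum_ge; eexists; first by split; [exact: (finite_fset B) | ].
rewrite -fsbig_seq ?fset_uniq// sumEFin lee_fin -natr_sum ler_nat.
apply: leq_trans Bn _; rewrite -sum1_size big_seq [leqRHS]big_seq.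
by apply: leq_sum => x xB; rewrite lt0n; exact: BS.
Qed.

Lemma additive_mulrn (p : nat * nat -> nat) (u : nat * nat) (n : nat) :
  p 0%R = 0%N -> (forall u v, p (u + v)%R = (p u + p v)%N) ->
  p (u *+ n)%R = (p u * n)%N.
Proof.
move=> p0 pD; elim: n => [|n IHn]; first by rewrite mulr0n muln0.
by rewrite mulrS pD IHn mulnS.
Qed.

Lemma xi_infinite nu : ~ finite_set [set x | nu x != 0%N] -> xi nu = 0%R.
Proof.
move=> inf; rewrite /xi fsbig_dflt//.
rewrite (_ : _ `&` _ = [set x | nu x != 0%N])//.
apply/seteqP; split => x /=.
  by case=> _ nx; apply/eqP => n0; apply: nx; rewrite n0 mulr0n.
move=> nx; split => // vx.
have e1 := @additive_mulrn fst (val x) (nu x) erefl (fun _ _ => erefl).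
have e2 := @additive_mulrn snd (val x) (nu x) erefl (fun _ _ => erefl).
move: (valP x) e1 e2; rewrite vx => cx /esym/eqP; rewrite muln_eq0 (negPf nx) orbF.
move=> /eqP x1 /esym/eqP; rewrite muln_eq0 (negPf nx) orbF => /eqP x2.
by move: cx; rewrite x1 x2.
Qed.

Lemma xi_finite nu (p : nat * nat -> nat) : p 0%R = 0%N ->
  (forall u v, p (u + v)%R = (p u + p v)%N) ->
  finite_set [set x | nu x != 0%N] ->
  \esum_(x in [set: primitive_vec]) ((p (val x) * nu x)%N%:R)%:E =
  (p (xi nu))%:R%:E :> \bar R.
Proof.
move=> p0 pD fin; set S := [set x | nu x != 0%N] in fin *.
transitivity (\esum_(x in S) ((p (val x) * nu x)%N%:R)%:E : \bar R).
  rewrite [RHS]esum_mkcond; apply: eq_esum => x _; case: ifPn => //.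
  by rewrite notin_setE /S/= => /negP; rewrite negbK => /eqP ->; rewrite muln0.
rewrite esum_fset//.
rewrite fsbig_finite// sumEFin -natr_sum; congr (_%:R)%:E.
rewrite /xi -(fsbig_widen S)//; last first.
  by move=> x [_ /negP] /=; rewrite negbK => /eqP ->.
rewrite fsbig_finite// (big_morph p pD p0).
by apply: eq_bigr => x _; rewrite additive_mulrn.
Qed.

Lemma primitive_sum_ge1 x : (1 <= (val x).1 + (val x).2)%N.
Proof. by case: x => -[[|x1] [|x2]]. Qed.

Lemma measurable_total : measurable_fun [set: config] (total : config -> \bar R).
Proof.
exact: (measurable_fun_esum_coord (g := fun _ k => k%:R%:E)).
Qed.

(** By convention [xi] is [0] where infinitely many coordinates are nonzero;
    a finite mean of the total makes this a null event, so that the expectation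
    may be computed coordinate by coordinate. *)
Lemma expectation_xi Q (p : nat * nat -> nat) : p 0%R = 0%N ->
  (forall u v, p (u + v)%R = (p u + p v)%N) ->
  \int[Q]_nu total nu < +oo ->
  'E_Q[fun nu => (p (xi nu))%:R] =
  \esum_(x in [set: primitive_vec]) \int[Q]_nu ((p (val x) * nu x)%N%:R)%:E.
Proof.
move=> p0 pD tfin; rewrite unlock.
have t0 nu : 0 <= total nu by apply: esum_ge0 => x _; rewrite lee_fin.
pose g x (k : nat) : \bar R := ((p (val x) * k)%N%:R)%:E.
have g0 x k : 0 <= g x k by rewrite lee_fin.
pose F nu := \esum_(x in [set: primitive_vec]) g x (nu x).
have F0 nu : 0 <= F nu by exact: esum_ge0.
rewrite -(integral_esum_coord Q g0) -/F.
pose D := [set nu : config | total nu < +oo].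
have mF : measurable_fun [set: config] (F : config -> \bar R).
  exact: measurable_fun_esum_coord.
have mD : measurable D.
  have -> : D = [set: config] `&` total @^-1` (~` [set +oo]).
    by rewrite setTI; apply/seteqP; split => nu; rewrite /D/= ltey => /eqP.
  by apply: measurable_total => //; apply: measurableC; exact: emeasurable_set1.
have E : (fun nu => (p (xi nu))%:R%:E) = F \_ D.
  apply/funext => nu; rewrite patchE; case: ifPn; rewrite ?inE ?notin_setE /D/=.
    by move=> /total_support fin; rewrite -xi_finite.
  move=> tinf; rewrite xi_infinite ?p0// => fin; apply: tinf.
  have pD' (u v : nat * nat) : ((u + v)%R.1 + (u + v)%R.2 = u.1 + u.2 + (v.1 + v.2))%N.
    exact: addnACA.
  have H := @xi_finite nu (fun u => (u.1 + u.2)%N) erefl pD' fin.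
  apply: (@le_lt_trans _ _ (\esum_(x in [set: primitive_vec])
    ((((val x).1 + (val x).2) * nu x)%N%:R)%:E)); last by rewrite H ltry.
  apply: le_esum => x _; rewrite lee_fin ler_nat leq_pmull//.
  exact: primitive_sum_ge1.
rewrite E; apply: ge0_ae_eq_integral => //.
- apply/(measurable_restrictT F mD).
  exact: (measurable_funS measurableT (@subsetT _ D) mF).
- by move=> nu _; case: ifP => // _; exact: (lexx (0 : \bar R)).
- by move=> nu _; exact: F0.
have ti : Q.-integrable [set: config] total.
  apply/integrableP; split; first exact: measurable_total.
  by under eq_integral do rewrite gee0_abs//.
have [N [mN N0 sN]] := integrable_ae measurableT ti.
exists N; split=> // nu /= H; apply: sN => /= tf; apply: H => _.
have {}tf := tf I.
by rewrite /patch ifT// inE /D/= ltey_eq tf.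
Qed.

(** Both components are treated together because the finite mean of [total] that
    [expectation_xi] asks for rests on both sums: [x.1 + x.2 >= 1]. *)
Lemma E_xi_eq (r a b : R) Q : (0 < r)%R -> (0 < a)%R -> (0 < b)%R ->
  is_Qzr r (expR (- a), expR (- b))%R Q -> exists T1 T2 : R,
  [/\ E_xi Q = (r * T1, r * T2)%R,
    psum (fun d => inv_coef R d * (d%:R * pker (d%:R * a) * qker (d%:R * b)))%R n
      @[n --> \oo] --> T1 &
    psum (fun d => inv_coef R d * (d%:R * pker (d%:R * b) * qker (d%:R * a)))%R n
      @[n --> \oo] --> T2].
Proof.
move=> r0 a0 b0 HQ; have r0' := ltW r0.
have [T1 HT1 cT1] := primitive_sum a0 b0.
have [T2 HT2 cT2] := primitive_sum b0 a0.
exists T1, T2; split => //.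
pose w x := vec_pow (expR (- a), expR (- b))%R (val x).
have w01 x : (0 < w x < 1)%R by exact: vec_pow_bounds.
have v0 x : (0 <= w x / (1 - w x))%R.
  by case/andP: (w01 x) => h1 h2; rewrite divr_ge0 ?subr_ge0 ?ltW.
have mean x : \int[Q]_nu (nu x)%:R%:E = (r * (w x / (1 - w x)))%:E.
  exact: coord_mean HQ (w01 x).
have HT2' : \esum_(x in [set: primitive_vec])
    ((val x).2%:R * (w x / (1 - w x)))%:E = T2%:E.
  rewrite -HT2.
  exact: (primitive_sum_swap a b (fun n v => (n%:R * (v / (1 - v)))%:E)).
have sumE (p : nat * nat -> nat) (T : R) :
    \esum_(x in [set: primitive_vec]) ((p (val x))%:R * (w x / (1 - w x)))%:E = T%:E ->
    \esum_(x in [set: primitive_vec]) \int[Q]_nu ((p (val x) * nu x)%N%:R)%:E =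
    (r * T)%:E.
  move=> HT; rewrite EFinM -HT -esumZl//; last first.
    by move=> x; rewrite lee_fin mulr_ge0.
  apply: eq_esum => x _; rewrite -EFinM.
  under eq_integral do rewrite natrM EFinM.
  rewrite ge0_integralZl_EFin//; last first.
    exact: (measurable_fun_coord x (fun k => k%:R%:E)).
  by rewrite mean -EFinM mulrCA.
have tfin : \int[Q]_nu total nu < +oo.
  rewrite (integral_esum_coord Q (g := fun _ k => k%:R%:E))//.
  apply: (@le_lt_trans _ _ (\esum_(x in [set: primitive_vec])
    (r%:E * (((val x).1%:R * (w x / (1 - w x)))%:E + ((val x).2%:R * (w x / (1 - w x)))%:E)))).
    apply: le_esum => x _; rewrite mean -EFinD -mulrDl -EFinM lee_fin.
    rewrite ler_wpM2l// ler_peMl// -natrD ler1n; exact: primitive_sum_ge1.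
  rewrite esumZl//; last by move=> x; rewrite adde_ge0// lee_fin mulr_ge0.
  rewrite esumD; [|by move=> x _; rewrite lee_fin mulr_ge0..].
  by rewrite HT1 HT2' -EFinD -EFinM ltry.
rewrite /E_xi (expectation_xi (p := fst))// (expectation_xi (p := snd))//.
by rewrite (sumE fst T1 HT1) (sumE snd T2 HT2').
Qed.

End Expectation.

(** * Choice of the exponents *)

Section Exponents.
Context {R : realType}.

Lemma cube_root (x : R) : 0 <= x -> (x `^ 3^-1) ^+ 3 = x.
Proof.
by move=> x0; rewrite -powR_mulrn ?powR_ge0// -powRrM mulVf// powRr1.
Qed.

Lemma kappa_gt0 : 0 < kappa R.
Proof.
by rewrite powR_gt0// divr_gt0//; [exact: (@zeta_gt0 R 3) | exact: (@zeta_gt0 R 2)].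
Qed.

Lemma kappa_cube : kappa R ^+ 3 = zeta 3 / zeta 2.
Proof.
apply: cube_root; rewrite divr_ge0// ltW//.
  exact: (@zeta_gt0 R 3).
exact: (@zeta_gt0 R 2).
Qed.

(** The cube roots of the components of [n] make the exponents rational
    expressions, so that the relations between them become field identities. *)
Lemma alphaE (r : R) (n : nat * nat) : 0 < r -> (0 < n.1)%N -> (0 < n.2)%N ->
  exists K x y : R, [/\ [/\ 0 < K, 0 < x & 0 < y],
    K ^+ 3 = zeta 3 / zeta 2 * r, x ^+ 3 = n.1%:R, y ^+ 3 = n.2%:R &
    alpha1 r n = K * y / x ^+ 2 /\ alpha2 r n = K * x / y ^+ 2].
Proof.
move=> r0 n1 n2; pose x : R := n.1%:R `^ 3^-1; pose y : R := n.2%:R `^ 3^-1.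
have n1R : 0 < (n.1%:R : R) by rewrite ltr0n.
have n2R : 0 < (n.2%:R : R) by rewrite ltr0n.
have x0 : 0 < x by rewrite powR_gt0.
have y0 : 0 < y by rewrite powR_gt0.
have x3 : x ^+ 3 = n.1%:R by exact/cube_root/ltW.
have y3 : y ^+ 3 = n.2%:R by exact/cube_root/ltW.
have root_div (u v : R) : 0 < u -> 0 < v ->
    (u ^+ 3 / v ^+ 3) `^ 3^-1 = u / v.
  move=> u0 v0; have uv : 0 <= u ^+ 3 / v ^+ 3 by rewrite divr_ge0// exprn_ge0// ltW.
  apply: (@pexpIrn R 3) => //; rewrite ?nnegrE ?powR_ge0 ?divr_ge0 ?(ltW u0) ?(ltW v0)//.
  by rewrite cube_root// exprMn exprVn.
exists (kappa R * r `^ 3^-1), x, y; split=> //.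
- by rewrite mulr_gt0 ?kappa_gt0 ?powR_gt0.
- by rewrite exprMn kappa_cube cube_root// ltW.
rewrite /alpha1 /alpha2 /delta1 /delta2 !powRN -/x -/y -x3 -y3 !root_div//.
by split; field; rewrite !gt_eqF.
Qed.

(** Here [m] is the component of [n] under study, [rho] the ratio of the two
    components in the order that suits it, and [u] the cube root of the norm of
    [n]; the exponents [a] and [b] are comparable and [1 / a] is [O (u)], so
    [1 / (a * b)] is [O (u ^ 2)]. Both components are instances. *)
Lemma component_estimate (r e D K3 : R) : 0 < r -> 0 < e -> 0 < D -> 0 < K3 ->
  K3 = zeta 3 / zeta 2 * r ->
  exists U : R, forall a b rho m u T : R,
  0 < a -> 0 < rho -> rho <= D -> rho^-1 <= D -> b = rho * a ->
  0 < m -> a ^+ 2 * b = K3 / m -> m <= u ^+ 3 -> 0 < u -> U <= u ->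
  psum (fun d => inv_coef R d * (d%:R * pker (d%:R * a) * qker (d%:R * b))) n
    @[n --> \oo] --> T ->
  `|r * T - m| <= e * u ^+ 2.
Proof.
(* [E] is such that [1 / a <= E * u]; then [h] makes the leading part of the error
   equal to [e / 2 * u ^ 2], and from [U] on the terms linear in [u] are below the
   same amount. *)
move=> r0 e0 D0 K0 K3E; pose E := 1 + D / K3.
have E1 : 1 <= E by rewrite lerDl divr_ge0// ltW.
have E0 : 0 < E by exact: lt_le_trans E1.
have E3 : D / K3 <= E ^+ 3.
  apply: (@le_trans _ _ E); first by rewrite /E lerDr.
  by rewrite exprS ler_peMr ?(ltW E0)// exprn_ege1.
pose h := e / (4 * r * D * E ^+ 2).
have h0 : 0 < h by rewrite divr_gt0// !mulr_gt0// exprn_gt0.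
have [C C0 HC] := lattice_sum_estimate h0.
exists (2 * r * (2 * C * D + 1) * E / e).
move=> a b rho m u T a0 rho0 rD riD bE m0 Hm mu u0 Uu HT.
have b0 : 0 < b by rewrite bE mulr_gt0.
have iaE : a^-1 <= E * u.
  rewrite -(@ler_pXn2r R 3) ?nnegrE ?invr_ge0 ?mulr_ge0 ?(ltW a0) ?(ltW E0) ?(ltW u0)//.
  have -> : a^-1 ^+ 3 = rho * m / K3.
    move: Hm; rewrite bE => Hm; have : m * (a ^+ 2 * (rho * a)) = K3.
      by rewrite Hm; field; rewrite gt_eqF.
    by move=> <-; field; rewrite !gt_eqF.
  rewrite exprMn; apply: (@le_trans _ _ (D / K3 * m)).
    have -> : D / K3 * m = D * m / K3 by rewrite mulrAC.
    by rewrite ler_pM2r ?invr_gt0// ler_pM2r.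
  apply: ler_pM => //; first by rewrite divr_ge0// ltW.
  exact: ltW.
have main := HC a b T a0 b0 HT.
have mE : m = r * (zeta 3 / zeta 2 / (a ^+ 2 * b)).
  by rewrite Hm K3E; field; rewrite !gt_eqF//; [exact: (@zeta_gt0 R 3)|exact: (@zeta_gt0 R 2)].
rewrite mE -mulrBr normrM (gtr0_norm r0).
have s1 : rho^-1 + rho <= 2 * D by lra.
have s0 : 0 <= rho^-1 + rho by apply: addr_ge0; rewrite ?invr_ge0 ltW.
have ia0 : 0 <= a^-1 by rewrite invr_ge0 ltW.
have t1 : (a * b)^-1 + b / a ^+ 3 = (rho^-1 + rho) * a^-1 ^+ 2.
  by rewrite bE; field; rewrite !gt_eqF.
have t2 : b^-1 + b / a ^+ 2 = (rho^-1 + rho) * a^-1.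
  by rewrite bE; field; rewrite !gt_eqF.
rewrite t1 t2 in main.
have b1 : (rho^-1 + rho) * a^-1 ^+ 2 <= 2 * D * (E * u) ^+ 2.
  apply: ler_pM => //; first exact: sqr_ge0.
  by apply: lerXn2r => //; rewrite nnegrE mulr_ge0// ltW.
have b2 : (rho^-1 + rho) * a^-1 <= 2 * D * (E * u) by apply: ler_pM.
apply: le_trans (ler_wpM2l (ltW r0) main) _.
apply: (@le_trans _ _ (r * (h * (2 * D * (E * u) ^+ 2) + C * (2 * D * (E * u)) + E * u))).
  by rewrite ler_wpM2l ?(ltW r0)// lerD// lerD// ler_wpM2l// ltW.
have -> : r * (h * (2 * D * (E * u) ^+ 2) + C * (2 * D * (E * u)) + E * u) =
    e / 2 * u ^+ 2 + r * (2 * C * D + 1) * E * u.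
  by rewrite /h; field; rewrite !gt_eqF.
rewrite ler_pdivrMr// in Uu.
have h1 := ler_wpM2r (ltW u0) Uu.
have h2 : 2 * (r * (2 * C * D + 1) * E * u) <= e * u ^+ 2.
  have -> : 2 * (r * (2 * C * D + 1) * E * u) = 2 * r * (2 * C * D + 1) * E * u by ring.
  by have -> : e * u ^+ 2 = u * e * u by ring.
by move: h2; move: (r * (2 * C * D + 1) * E * u) (u ^+ 2) => *; lra.
Qed.

End Exponents.

Theorem theorem1p4 (R : realType) (r : R) (hr : 0 < r)
  (Q : nat * nat -> probability config R)
  (hQ : forall n : nat * nat, (0 < n.1)%N -> (0 < n.2)%N ->
     is_Qzr r (z_of r n) (Q n))
  (c C : R) (hc : 0 < c) :
  forall n : nat * nat,
    E_xi (Q n) = vec_R R n +o_(n \near n_to_oo c C)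
      (eucl_norm (vec_R R n) `^ (2 / 3)).
Proof.
have H : forall e : R, 0 < e -> \forall n \near n_to_oo c C,
    `|((fun n => E_xi (Q n)) - vec_R R) n| <=
    e * `|eucl_norm (vec_R R n) `^ (2 / 3)|.
  move=> e e0.
  have z3 := @zeta_gt0 R 3 isT; have z2 := @zeta_gt0 R 2 isT.
  (* a bound for [n1 / n2] and for [n2 / n1] *)
  pose D : R := `|C| + c^-1.
  have D0 : 0 < D by rewrite ltr_wpDl// invr_gt0.
  pose K3 : R := zeta 3 / zeta 2 * r.
  have K30 : 0 < K3 by rewrite mulr_gt0// divr_gt0.
  have [U HU] := component_estimate hr e0 D0 K30 erefl.
  have [N0 HN0] := archi_nat (`|U| ^+ 3).
  exists ([set i | (N0.+1 <= i)%N], [set i | (N0.+1 <= i)%N]).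
    by split; exact: nbhs_infty_ge.
  move=> [n1 n2] /= [Nn1 Nn2] /andP[rc rC].
  have n10 : (0 < n1)%N by exact: leq_ltn_trans Nn1.
  have n20 : (0 < n2)%N by exact: leq_ltn_trans Nn2.
  have n1R : 0 < (n1%:R : R) by rewrite ltr0n.
  have n2R : 0 < (n2%:R : R) by rewrite ltr0n.
  pose N : R := eucl_norm (vec_R R (n1, n2)); pose u := N `^ 3^-1.
  have N1 : n1%:R <= N.
    rewrite /N /eucl_norm/= -[leLHS]ger0_norm// -sqrtr_sqr ler_wsqrtr//.
    by rewrite lerDl sqr_ge0.
  have N2 : n2%:R <= N.
    rewrite /N /eucl_norm/= -[leLHS]ger0_norm// -sqrtr_sqr ler_wsqrtr//.
    by rewrite lerDr sqr_ge0.
  have N_0 : 0 < N by exact: lt_le_trans N1.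
  have u0 : 0 < u by rewrite powR_gt0.
  have u3 : u ^+ 3 = N by rewrite cube_root// ltW.
  have Uu : U <= u.
    apply: le_trans (ler_norm U) _.
    rewrite -(@ler_pXn2r R 3) ?nnegrE ?normr_ge0 ?(ltW u0)// u3.
    apply: le_trans HN0 _; apply: le_trans N1; rewrite ler_nat; exact: ltnW.
  have u2 : N `^ (2 / 3) = u ^+ 2.
    by rewrite -powR_mulrn ?(ltW u0)// /u -powRrM mulrC.
  rewrite u2 ger0_norm ?sqr_ge0//.
  have [K [x [y [[K0 x0 y0] K3E x3 y3 [a1 a2]]]]] := @alphaE R r (n1, n2) hr n10 n20.
  rewrite /= in x3 y3.
  have al1 : 0 < alpha1 r (n1, n2) by rewrite a1 divr_gt0 ?mulr_gt0 ?exprn_gt0.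
  have al2 : 0 < alpha2 r (n1, n2) by rewrite a2 divr_gt0 ?mulr_gt0 ?exprn_gt0.
  have [T1 [T2 [EQ cT1 cT2]]] := E_xi_eq hr al1 al2 (hQ (n1, n2) n10 n20).
  have CD : `|C| <= D by rewrite /D lerDl invr_ge0 ltW.
  have cD : c^-1 <= D by rewrite /D lerDr.
  have rho0 : 0 < n1%:R / n2%:R :> R by rewrite divr_gt0.
  have rho1 : n1%:R / n2%:R <= D.
    by apply: le_trans rC _; apply: le_trans CD; exact: ler_norm.
  have rho2 : (n1%:R / n2%:R)^-1 <= D.
    by apply: le_trans cD; rewrite lef_pV2 ?posrE.
  have K3_E : K3 = K ^+ 3 by rewrite K3E.
  have e1 : `|r * T1 - n1%:R| <= e * u ^+ 2.
    apply: (HU (alpha1 r (n1, n2)) (alpha2 r (n1, n2)) (n1%:R / n2%:R)) => //.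
    - by rewrite a1 a2 -x3 -y3; field; rewrite !gt_eqF.
    - by rewrite a1 a2 K3_E -x3; field; rewrite !gt_eqF.
    - by rewrite u3.
  have e2 : `|r * T2 - n2%:R| <= e * u ^+ 2.
    apply: (HU (alpha2 r (n1, n2)) (alpha1 r (n1, n2)) (n1%:R / n2%:R)^-1) => //.
    - by rewrite invr_gt0.
    - by rewrite invrK.
    - by rewrite a1 a2 -x3 -y3; field; rewrite !gt_eqF.
    - by rewrite a1 a2 K3_E -y3; field; rewrite !gt_eqF.
    - by rewrite u3.
  have -> : ((fun n => E_xi (Q n)) - vec_R R) (n1, n2) =
      (r * T1 - n1%:R, r * T2 - n2%:R).
    by rewrite /= -[LHS]/(E_xi (Q (n1, n2)) - vec_R R (n1, n2)) EQ.
  (* the norm on pairs is the maximum of the two absolute values *)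
  by rewrite /Num.norm/= ge_max e1 e2.
have := (eqaddoP (n_to_oo_filter_on c C) (fun n => E_xi (Q n)) (@vec_R R)
  (fun n => eucl_norm (vec_R R n) `^ (2 / 3) : R^o)).2 H.
by rewrite funeqE.
Qed.
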